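(* Let $M$ be a von Neumann algebra with a faithful normal state $\nu$, and let $\alpha:\Gamma\curvearrowright M$ be an action of a countable discrete group $\Gamma$ on $M$ by automorphisms which leaves $\nu$ invariant. If $\alpha$ is compact and $\Gamma$ and $M$ have the Haagerup property, then the crossed product von Neumann algebra $\Gamma\ltimes M$ has the Haagerup property.
   Context: Von Neumann algebras have separable preduals. The action $\alpha$ is compact if the closure of the image of $\Gamma$ in $\mathrm{Aut}(M)$ (in the $\nu$-preserving automorphisms, with the topology of pointwise $\|\cdot\|_{2,\nu}$-convergence) is compact. Haagerup property for arbitrary von Neumann algebras (in the sense of Caspers–Skalski and Okayasu–Tomatsu): $M$ with faithful normal state $\nu$ has the Haagerup property if there is a sequence of normal unital completely positive $\nu$-preserving maps $\psi_i:M\to M$ whose $L^2$-extensions $T_{\psi_i}$ on $L^2(M)=L^2(M,\nu)$ (the bounded operators extending $x\mapsto\psi_i(x)$) are compact and such that $\|\psi_i(x)-x\|_{2,\nu}\to0$ for all $x\in M$; this is known not to depend on the choice of $\nu$. A discrete group $\Gamma$ has the Haagerup property if there is a sequence of normalized positive definite $c_0$-functions on $\Gamma$ converging pointwise to $1$. *)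

(* Defs.v *)
From HB Require Import structures.
From mathcomp Require Import all_boot all_order all_algebra.
From mathcomp Require Import all_classical all_reals all_analysis.
From mathcomp.real_closed Require Import complex.

Set Implicit Arguments.
Unset Strict Implicit.
Unset Printing Implicit Defensive.

Import Order.TTheory GRing.Theory Num.Theory.
Import numFieldNormedType.Exports.

Local Open Scope classical_set_scope.
Local Open Scope ring_scope.

(* The norm of a normed module over [R[i]] is [R[i]]-valued (with real
   values), so [dotpE] is an equation in [R[i]].  [dotp] is linear in its
   first argument. *)
HB.mixin Record CompleteNormedModule_isHilbert (R : realType) H
    of CompleteNormedModule R[i] H := {
  dotp : H -> H -> R[i];
  dotpPl : forall (a : R[i]) (x y z : H),
    dotp (a *: x + y) z = a * dotp x z + dotp y z;
  dotpC : forall x y : H, dotp y x = (dotp x y)^*;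
  dotpE : forall x : H, dotp x x = `|x| ^+ 2
}.

#[short(type="hilbertType")]
HB.structure Definition Hilbert (R : realType) :=
  {H of CompleteNormedModule_isHilbert R H & CompleteNormedModule R[i] H}.

Definition bounded_op (R : realType) (H : hilbertType R) : set (H -> H) :=
  [set x | linear x /\ exists c : R[i], forall xi, `|x xi| <= c * `|xi|].

Definition compact_op (R : realType) (H : hilbertType R) (T : H -> H) : Prop :=
  bounded_op T /\ precompact (T @` [set xi | `|xi| <= 1]).

Definition is_adjoint (R : realType) (H : hilbertType R) (x y : H -> H) : Prop :=
  forall xi eta, dotp (x xi) eta = dotp xi (y eta).

(* Meaningful for bounded [x], which have exactly one adjoint. *)
Definition adj (R : realType) (H : hilbertType R) (x : H -> H) : H -> H :=
  xget (fun=> 0) [set y | is_adjoint x y].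

(* On a complex Hilbert space this entails self-adjointness. *)
Definition op_pos (R : realType) (H : hilbertType R) (x : H -> H) : Prop :=
  forall xi, 0 <= dotp (x xi) xi.

Definition op_le (R : realType) (H : hilbertType R) (x y : H -> H) : Prop :=
  op_pos (y - x).

Definition commutant (R : realType) (H : hilbertType R) (S : set (H -> H)) :
    set (H -> H) :=
  [set y | bounded_op y /\ forall x, S x -> x \o y = y \o x].

(* Functionals on [M] and maps from [M] to [M] are total functions on
   [H -> H], of which only the values on [M] matter. *)
Definition von_neumann (R : realType) (H : hilbertType R) (M : set (H -> H)) :
    Prop :=
  [/\ M `<=` bounded_op (H := H),
      forall x, M x -> M (adj x)
    & commutant (commutant M) = M].

Definition linear_on (R : realType) (H : hilbertType R) (V : lmodType R[i])
    (M : set (H -> H)) (f : (H -> H) -> V) : Prop :=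
  forall (a : R[i]) x y, M x -> M y -> f (a *: x + y) = a *: f x + f y.

(* The predual consists of the sigma-weakly continuous functionals. *)
Definition predual (R : realType) (H : hilbertType R) (M : set (H -> H))
    (f : (H -> H) -> R[i]) : Prop :=
  exists xi eta : nat -> H,
    [/\ exists B : R[i], forall N, \sum_(n < N) `|xi n| ^+ 2 <= B,
        exists B : R[i], forall N, \sum_(n < N) `|eta n| ^+ 2 <= B
      & forall x, M x ->
          \sum_(n < N) dotp (x (xi n)) (eta n) @[N --> \oo] --> (f x : R[i]^o)].

Definition separable_predual (R : realType) (H : hilbertType R)
    (M : set (H -> H)) : Prop :=
  exists F : nat -> (H -> H) -> R[i],
    (forall n, predual M (F n)) /\
    forall f, predual M f -> forall eps : R[i], 0 < eps ->
      exists n, forall x, M x -> (forall xi, `|x xi| <= `|xi|) ->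
        `|f x - F n x| <= eps.

(* [s] is, in [M], the supremum of the increasing net [D] of positive elements
   of [M], the net being given by its upward directed set of values. *)
Definition increasing_sup (R : realType) (H : hilbertType R)
    (M D : set (H -> H)) (s : H -> H) : Prop :=
  [/\ D !=set0 /\ D `<=` M `&` op_pos (H := H),
      forall x y, D x -> D y -> exists z, [/\ D z, op_le x z & op_le y z],
      M s /\ forall x, D x -> op_le x s
    & forall t, M t -> (forall x, D x -> op_le x t) -> op_le s t].

Definition faithful_normal_state (R : realType) (H : hilbertType R)
    (M : set (H -> H)) (nu : (H -> H) -> R[i]) : Prop :=
  [/\ linear_on M (nu : (H -> H) -> R[i]^o),
      (forall x, M x -> op_pos x -> 0 <= nu x) /\ nu id = 1,
      forall x, M x -> op_pos x -> nu x = 0 -> x = 0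
    & forall D s, increasing_sup M D s -> supremums (nu @` D) (nu s)].

Definition norm2 (R : realType) (H : hilbertType R) (nu : (H -> H) -> R[i])
    (x : H -> H) : R[i] :=
  sqrtC (nu (adj x \o x)).

Definition normal_map (R : realType) (H : hilbertType R) (M : set (H -> H))
    (psi : (H -> H) -> (H -> H)) : Prop :=
  forall D s, increasing_sup M D s -> increasing_sup M (psi @` D) (psi s).

(* [x : 'I_n -> 'I_n -> (H -> H)] is an [n x n] matrix over [M], acting on
   the n-fold direct sum of [H]. *)
Definition matrix_pos (R : realType) (H : hilbertType R) (n : nat)
    (x : 'I_n -> 'I_n -> H -> H) : Prop :=
  forall xi : 'I_n -> H,
    0 <= \sum_(i < n) dotp (\sum_(j < n) x i j (xi j)) (xi i).

Definition completely_positive (R : realType) (H : hilbertType R)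
    (M : set (H -> H)) (psi : (H -> H) -> (H -> H)) : Prop :=
  forall n (x : 'I_n -> 'I_n -> H -> H),
    (forall i j, M (x i j)) -> matrix_pos x ->
    matrix_pos (fun i j => psi (x i j)).

Definition normal_ucp (R : realType) (H : hilbertType R)
    (M : set (H -> H)) (psi : (H -> H) -> (H -> H)) : Prop :=
  [/\ forall x, M x -> M (psi x), linear_on M psi, normal_map M psi,
      psi id = id & completely_positive M psi].

(* [Lambda] exhibits [K] as the completion of [M] for the inner product
   [<x, y> = nu (y^* x)], which determines [(K, Lambda)] up to a unique
   unitary. *)
Definition is_L2 (R : realType) (H K : hilbertType R) (M : set (H -> H))
    (nu : (H -> H) -> R[i]) (Lambda : (H -> H) -> K) : Prop :=
  [/\ linear_on M Lambda,
      forall x y, M x -> M y -> dotp (Lambda x) (Lambda y) = nu (adj y \o x)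
    & dense (Lambda @` M)].

Definition L2_compact (R : realType) (H : hilbertType R) (M : set (H -> H))
    (nu : (H -> H) -> R[i]) (psi : (H -> H) -> (H -> H)) : Prop :=
  exists (K : hilbertType R) (Lambda : (H -> H) -> K) (T : K -> K),
    [/\ is_L2 M nu Lambda, compact_op T
      & forall x, M x -> T (Lambda x) = Lambda (psi x)].

Definition haagerup_wrt (R : realType) (H : hilbertType R) (M : set (H -> H))
    (nu : (H -> H) -> R[i]) : Prop :=
  exists psi : nat -> (H -> H) -> (H -> H),
    (forall i, [/\ normal_ucp M (psi i),
                   forall x, M x -> nu (psi i x) = nu x
                 & L2_compact M nu (psi i)]) /\
    forall x, M x -> norm2 nu (psi i x - x) @[i --> \oo] --> (0 : R[i]^o).

(* The property does not depend on the faithful normal state. *)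
Definition haagerup (R : realType) (H : hilbertType R) (M : set (H -> H)) :
    Prop :=
  exists nu, faithful_normal_state M nu /\ haagerup_wrt M nu.

Definition positive_definite (R : realType) (G : groupType) (phi : G -> R[i]) :
    Prop :=
  forall n (g : 'I_n -> G) (c : 'I_n -> R[i]),
    0 <= \sum_(i < n) \sum_(j < n) (c i)^* * c j * phi ((g i)^-1 * g j)%g.

Definition group_haagerup (R : realType) (G : groupType) : Prop :=
  exists phi : nat -> G -> R[i],
    (forall i, [/\ positive_definite (phi i), phi i 1%g = 1
       & forall eps : R[i], 0 < eps -> finite_set [set g | eps <= `|phi i g|]]) /\
    forall g, phi i g @[i --> \oo] --> (1 : R[i]^o).

Record vn_aut (R : realType) (H : hilbertType R) (M : set (H -> H))
    (nu : (H -> H) -> R[i]) := VNAut {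
  vn_aut_fun :> (H -> H) -> (H -> H);
  vn_aut_bij : set_bij M M vn_aut_fun;
  vn_aut_linear : linear_on M vn_aut_fun;
  vn_aut_comp : forall x y, M x -> M y ->
    vn_aut_fun (x \o y) = vn_aut_fun x \o vn_aut_fun y;
  vn_aut_adj : forall x, M x -> vn_aut_fun (adj x) = adj (vn_aut_fun x);
  vn_aut_state : forall x, M x -> nu (vn_aut_fun x) = nu x
}.

HB.instance Definition _ R H M nu :=
  gen_eqMixin (@vn_aut R H M nu).
HB.instance Definition _ R H M nu :=
  gen_choiceMixin (@vn_aut R H M nu).

(* The topology of pointwise convergence in [norm2 nu], generated by the balls
   [{theta | norm2 nu (theta x - theta0 x) < eps}] with [theta0] an
   automorphism, [x] in [M] and [eps > 0]. *)
HB.instance Definition _ R H M nu :=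
  @isSubBaseTopological.Build (@vn_aut R H M nu) (set (@vn_aut R H M nu))
    [set B | exists (theta0 : vn_aut M nu) x (eps : R[i]),
       [/\ M x, 0 < eps
         & B = [set theta : vn_aut M nu | norm2 nu (theta x - theta0 x) < eps]]]
    id.

Definition is_action (R : realType) (H : hilbertType R) (M : set (H -> H))
    (nu : (H -> H) -> R[i]) (G : groupType) (alpha : G -> vn_aut M nu) : Prop :=
  forall g h x, M x -> alpha (g * h)%g x = alpha g (alpha h x).

Definition compact_action (R : realType) (H : hilbertType R)
    (M : set (H -> H)) (nu : (H -> H) -> R[i]) (G : groupType)
    (alpha : G -> vn_aut M nu) : Prop :=
  compact (closure (range alpha)).

(* [L] is the Hilbert space [l^2(G, H)], the Hilbert direct sum of copies of
   [H] indexed by [G]; [delta g xi] is the function with value [xi] at [g] and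
   [0] elsewhere. *)
Definition is_l2 (R : realType) (H L : hilbertType R) (G : groupType)
    (delta : G -> H -> L) : Prop :=
  [/\ forall g, linear (delta g),
      forall g h xi eta,
        dotp (delta g xi) (delta h eta) = if g == h then dotp xi eta else 0
    & dense [set v | exists n (g : 'I_n -> G) (xi : 'I_n -> H),
                       v = \sum_(i < n) delta (g i) (xi i)]].

(* [(pi(x) f)(g) = alpha_{g^-1}(x) (f g)] *)
Definition is_pi (R : realType) (H L : hilbertType R) (M : set (H -> H))
    (nu : (H -> H) -> R[i]) (G : groupType) (delta : G -> H -> L)
    (alpha : G -> vn_aut M nu) (x : H -> H) (T : L -> L) : Prop :=
  bounded_op T /\
  forall g xi, T (delta g xi) = delta g (alpha g^-1%g x xi).

(* [(lambda(h) f)(g) = f (h^-1 g)] *)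
Definition is_lambda (R : realType) (H L : hilbertType R) (G : groupType)
    (delta : G -> H -> L) (h : G) (T : L -> L) : Prop :=
  bounded_op T /\ forall g xi, T (delta g xi) = delta (h * g)%g xi.

Definition crossed_product (R : realType) (H L : hilbertType R)
    (M : set (H -> H)) (nu : (H -> H) -> R[i]) (G : groupType)
    (delta : G -> H -> L) (alpha : G -> vn_aut M nu) : set (L -> L) :=
  commutant (commutant
    ([set T | exists2 x, M x & is_pi delta alpha x T] `|`
     [set T | exists h, is_lambda delta h T])).

(* Main.v *)
(* Let [phi n] be the functions on [G] and [psi n] the maps on [M].  As [T_(psi n)] and
   the action are compact, [g |-> alpha_g psi_n alpha_g^-1] is almost periodic for the
   norm of operators on [L2(M)], and von Neumann's construction of the mean of an almost
   periodic function applies: averaging repeatedly over finite nets converges to an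
   equivariant map [psi' n], which is still completely positive, state preserving and
   compact on [L2(M)].  Since the orbits of the action are totally bounded in [L2(M)],
   [psi' n] still converges to the identity.
   The crossed product consists of the operators on [l2(G, H)] whose entries satisfy
   [x_(gk,hk) = alpha_(k^-1)(x_(g,h))]; this uses that every automorphism of [M] is
   implemented by sufficiently many intertwiners, obtained from the GNS representation.
   By equivariance the matrix [phi_n(g h^-1) psi'_n(x_(g,h))] is again of this form, and
   a Schur product argument shows that it defines a completely positive map.  On
   [L2 = l2(G, L2(M))] this map is the direct sum of the operators [phi_n(g) T_(psi' n)],
   which is compact since [phi n] is [c_0].  A completely positive map that preserves a
   faithful normal state is automatically normal. *)

From HB Require Import structures.
From mathcomp Require Import all_boot all_order all_algebra finmap.
From mathcomp Require Import all_classical all_reals all_analysis.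
From mathcomp.real_closed Require Import complex.
From mathcomp Require Import ring lra.
Require Import Defs.

Set Implicit Arguments.
Unset Strict Implicit.
Unset Printing Implicit Defensive.

Import Order.TTheory GRing.Theory Num.Theory.
Import numFieldNormedType.Exports.

Local Open Scope classical_set_scope.
Local Open Scope ring_scope.

(** * Real-valued norms and convergence *)

(** Two obstacles shape the proof. The algebra [M] acts on an arbitrary Hilbert space [H], not on
    its standard one, whereas compactness and the convergence of averages live on [L2(M)]. The
    bridge consists of the bounded maps [T] from [L2(M)] to [H] that commute with the left actions:
    normality of [nu] makes their common kernel zero, and faithfulness then makes the vectors [T 1]
    dense in [H]. Consequently, families in [M] that are bounded in operator norm and converge in
    [L2] converge strongly to an element of [M], so that a mean computed in [L2] is again a map of
    [M]. The same maps supply the commutant elements that force the entries of an operator in the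
    crossed product to be covariant. The closure of the range of [alpha] is used only as a compact
    set of automorphisms, without a group structure or a Haar measure, which is why the mean is
    built from finite averages. Equivariance itself cannot be dispensed with: it is what keeps the
    entrywise map inside the crossed product. Positivity is handled without functional calculus,
    through inverses for automorphisms and through elimination for Schur products. *)

Section RealNorm.
Variables (R : realType).
Local Notation C := R[i].
Local Notation re := (@complex.Re R).
Local Notation im := (@complex.Im R).
Local Notation "x %:C" := (real_complex _ x) : ring_scope.

(** Norms over [R[i]] take values in [R[i]], whose order is only partial; [nr] moves all estimates
    to the ordered field [R]. *)
Definition nr (V : normedZmodType C) (v : V) : R := re `|v|.

Section NormedZmod.
Variable V : normedZmodType C.
Implicit Types v w : V.

Lemma nrE v : `|v| = (nr v)%:C.
Proof. by rewrite /nr RRe_real// realE normr_ge0. Qed.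

Lemma nr_ge0 v : 0 <= nr v.
Proof. by rewrite -ler0c -nrE normr_ge0. Qed.

Lemma nr0 : nr (0 : V) = 0. Proof. by rewrite /nr normr0. Qed.

Lemma nrN v : nr (- v) = nr v. Proof. by rewrite /nr normrN. Qed.

Lemma nrC v w : nr (v - w) = nr (w - v). Proof. by rewrite -nrN opprB. Qed.

Lemma nrD v w : nr (v + w) <= nr v + nr w.
Proof. by rewrite -lecR rmorphD/= -!nrE ler_normD. Qed.

Lemma nrB v w : nr (v - w) <= nr v + nr w.
Proof. by rewrite -(nrN w) nrD. Qed.

Lemma nr_tri u v w : nr (u - w) <= nr (u - v) + nr (v - w).
Proof. by rewrite -[u - w](subrKA v) nrD. Qed.

Lemma nr0_eq0 v : nr v = 0 -> v = 0.
Proof. by move=> h; apply/normr0_eq0; rewrite nrE h. Qed.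

Lemma nr_le_eq0 v : (forall e : R, 0 < e -> nr v <= e) -> v = 0.
Proof.
move=> h; apply: nr0_eq0; apply/eqP; rewrite eq_le nr_ge0 andbT.
by apply/ler_addgt0Pl => e e0; rewrite addr0 h.
Qed.

End NormedZmod.

Implicit Types z w : C.

Lemma nr_sqr z : nr z ^+ 2 = re z ^+ 2 + im z ^+ 2.
Proof.
by apply: (@complexI R); rewrite add_Re2_Im2 rmorphXn/= -nrE.
Qed.

Lemma nrM z w : nr (z * w) = nr z * nr w.
Proof. by apply: (@complexI R); rewrite rmorphM/= -!nrE normrM. Qed.

Lemma conjE z : z^* = conjc z.
Proof. by []. Qed.

Lemma nr_conj z : nr z^* = nr z.
Proof. by rewrite /nr norm_conjC. Qed.

Lemma re_conj z : re z^* = re z. Proof. by case: z. Qed.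
Lemma im_conj z : im z^* = - im z. Proof. by case: z. Qed.
Lemma reD z w : re (z + w) = re z + re w. Proof. by case: z; case: w. Qed.
Lemma imD z w : im (z + w) = im z + im w. Proof. by case: z; case: w. Qed.
Lemma reN z : re (- z) = - re z. Proof. by case: z. Qed.
Lemma imN z : im (- z) = - im z. Proof. by case: z. Qed.
Lemma reM z w : re (z * w) = re z * re w - im z * im w.
Proof. by case: z; case: w. Qed.
Lemma imM z w : im (z * w) = re z * im w + im z * re w.
Proof. by case: z; case: w. Qed.
Lemma rereal (x : R) : re x%:C = x. Proof. by []. Qed.
Lemma imreal (x : R) : im x%:C = 0. Proof. by []. Qed.
Definition iu : C := Complex (0 : R) (1 : R).
Lemma rei : re iu = (0 : R). Proof. by []. Qed.
Lemma imi : im iu = (1 : R). Proof. by []. Qed.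
Definition reimE := (reD, imD, reN, imN, reM, imM, re_conj, im_conj, rereal, imreal, rei, imi).

Lemma re_sum (I : Type) (r : seq I) (P : pred I) (F : I -> C) :
  re (\sum_(i <- r | P i) F i) = \sum_(i <- r | P i) re (F i).
Proof. by elim/big_ind2 : _ => // x a y b <- <-; rewrite reD. Qed.

Lemma complex_eq z w : re z = re w -> im z = im w -> z = w.
Proof. by case: z w => a b [c d]/= -> ->. Qed.

Lemma cge0P z : (0 <= z) <-> (0 <= re z /\ im z = 0).
Proof.
by rewrite lecE/=; split=> [/andP[/eqP ->]|[-> ->]]; rewrite ?eqxx.
Qed.

Lemma cge0E z : 0 <= z -> z = (re z)%:C.
Proof. by case/cge0P => _; case: z => a b /= ->. Qed.

Lemma cgt0E z : 0 < z -> z = (re z)%:C /\ 0 < re z.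
Proof.
by move=> z0; rewrite {1}(cge0E (ltW z0)); split => //; rewrite -ltcR -cge0E// ltW.
Qed.

Lemma re_le z : re z <= nr z.
Proof.
rewrite leNgt; apply/negP => h; have := nr_sqr z; have := nr_ge0 z; nra.
Qed.

Lemma re_abs z : `|re z| <= nr z.
Proof.
by rewrite ler_norml re_le andbT lerNl -reN; apply: le_trans (re_le _) _; rewrite nrN.
Qed.

Lemma im_abs z : `|im z| <= nr z.
Proof.
rewrite -(@ler_pXn2r _ 2) ?nnegrE ?nr_ge0//.
by rewrite real_normK ?num_real// nr_sqr; have := sqr_ge0 (re z); lra.
Qed.

Lemma nr_real (x : R) : nr (x%:C) = `|x|.
Proof.
apply/eqP; rewrite -(@eqrXn2 _ 2) ?nr_ge0//.
by rewrite nr_sqr/= expr0n addr0 real_normK ?num_real.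
Qed.

Lemma mulcJ z : z * z^* = ((nr z) ^+ 2)%:C.
Proof. by apply: complex_eq; rewrite nr_sqr !reimE; ring. Qed.

Lemma cvg_nrP (V : pseudoMetricNormedZmodType C) (T : Type) (F : set_system T)
    {FF : Filter F} (f : T -> V) (l : V) :
  f @ F --> l <-> (forall e : R, 0 < e -> \forall x \near F, nr (l - f x) < e).
Proof.
split => [/cvgrPdist_lt h e e0|h].
  have := h e%:C; rewrite ltcR => /(_ e0); apply: filterS => x.
  by rewrite nrE ltcR.
apply/cvgrPdist_lt => e /cgt0E[-> /h]; apply: filterS => x.
by rewrite nrE ltcR.
Qed.

Lemma cauchy_nr (V : completeNormedModType C) (T : Type) (F : set_system T)
    {FF : ProperFilter F} (f : T -> V) :
  (forall e : R, 0 < e ->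
     exists2 A, F A & forall x y, A x -> A y -> nr (f x - f y) < e) ->
  exists l : V, f @ F --> l.
Proof.
move=> h; suff /cvg_ex : cvg (f @ F) by [].
apply: cauchy_cvg; apply/cauchy_ballP => e /cgt0E[-> /h [A FA hA]].
have FfA : (f @ F) (f @` A) by apply: (@filterS _ F _ A) => // x Ax; exists x.
exists (f @` A, f @` A) => //.
move=> [x y] /= [[u Au <-] [v Av <-]].
by rewrite -ball_normE/= nrE ltcR hA.
Qed.

Lemma cvg_re (T : Type) (F : set_system T) {FF : Filter F} (f : T -> C) (l : C) :
  f @ F --> (l : C^o) ->
  forall e : R, 0 < e -> \forall x \near F, `|re l - re (f x)| < e.
Proof.
move/(cvg_nrP (V := C^o)) => h e /h; apply: filterS => x; apply: le_lt_trans.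
by rewrite -reN -reD; exact: re_abs.
Qed.

Lemma cvg_ge0 (T : Type) (F : set_system T) {FF : ProperFilter F} (f : T -> C) (l : C) :
  f @ F --> (l : C^o) -> (\forall x \near F, 0 <= f x) -> 0 <= l.
Proof.
move=> fl f0; apply/cge0P; split.
  apply/ler_addgt0Pl => e e0.
  have [x [h /cge0P[f0x _]]] := filter_ex (filterI (cvg_re fl e0) f0).
  by have := ler_norml (re l - re (f x)) e; rewrite (ltW h) => /esym/andP[]; lra.
apply/eqP; rewrite -normr_eq0 eq_le normr_ge0 andbT; apply/ler_addgt0Pl => e e0.
move/(cvg_nrP (V := C^o)) : fl => /(_ _ e0) fl.
have [x [h /cge0P[_ f0x]]] := filter_ex (filterI fl f0).
rewrite addr0; apply: le_trans (ltW h); apply: le_trans (im_abs _).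
by rewrite !reimE f0x subr0.
Qed.

Lemma cvg_nr_uniq (V : normedModType C) (T : Type) (F : set_system T)
    {FF : ProperFilter F} (f : T -> V) (l l' : V) :
  f @ F --> l -> f @ F --> l' -> l = l'.
Proof. by move=> h h'; exact: (cvg_unique (@norm_hausdorff _ V) h h'). Qed.

Lemma cvg_nr_le (V : normedModType C) (T : Type) (F : set_system T)
    {FF : ProperFilter F} (f : T -> V) (l : V) (c : R) :
  f @ F --> l -> (\forall x \near F, nr (f x) <= c) -> nr l <= c.
Proof.
move/cvg_nrP => fl fc; apply/ler_addgt0Pl => e e0.
have [x [h h']] := filter_ex (filterI (fl e e0) fc).
rewrite -[l](subrK (f x)); apply: le_trans (nrD _ _) _; lra.
Qed.

Lemma cvgC_nrP (T : Type) (F : set_system T) {FF : Filter F} (f : T -> C) (l : C) :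
  f @ F --> (l : C^o) <-> (forall e : R, 0 < e -> \forall x \near F, nr (l - f x) < e).
Proof. exact: (@cvg_nrP C^o). Qed.

Lemma cvgC_nr (T : Type) (F : set_system T) {FF : Filter F} (f : T -> C) (l : C) (e : R) :
  f @ F --> (l : C^o) -> 0 < e -> \forall x \near F, nr (l - f x) < e.
Proof. by move/cvgC_nrP => h /h. Qed.

Lemma cvg_nr (V : pseudoMetricNormedZmodType C) (T : Type) (F : set_system T)
    {FF : Filter F} (f : T -> V) (l : V) (e : R) :
  f @ F --> l -> 0 < e -> \forall x \near F, nr (l - f x) < e.
Proof. by move/cvg_nrP => h /h. Qed.

Lemma cvgCM (T : Type) (F : set_system T) {FF : Filter F} (f : T -> C) (l a : C) :
  f @ F --> (l : C^o) -> (fun t => a * f t) @ F --> ((a * l : C) : C^o).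
Proof.
move=> h; apply/cvgC_nrP => e e0; have d0 : 0 < e / (nr a + 1).
  by rewrite divr_gt0//; have := nr_ge0 a; lra.
apply: filterS (cvgC_nr h d0) => t; rewrite -mulrBr nrM ltr_pdivlMr; last by have := nr_ge0 a; lra.
by have := nr_ge0 a; have := nr_ge0 (l - f t); nra.
Qed.

Lemma cvgCD (T : Type) (F : set_system T) {FF : Filter F} (f g : T -> C) (l m : C) :
  f @ F --> (l : C^o) -> g @ F --> (m : C^o) -> (fun t => f t + g t) @ F --> ((l + m : C) : C^o).
Proof.
move=> h1 h2; apply/cvgC_nrP => e e0; have d0 : 0 < e / 2 by rewrite divr_gt0.
apply: filterS2 (cvgC_nr h1 d0) (cvgC_nr h2 d0) => t; rewrite opprD addrACA => ? ?.
by apply: le_lt_trans (nrD _ _) _; lra.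
Qed.

Lemma cvgCB (T : Type) (F : set_system T) {FF : Filter F} (f g : T -> C) (l m : C) :
  f @ F --> (l : C^o) -> g @ F --> (m : C^o) -> (fun t => f t - g t) @ F --> ((l - m : C) : C^o).
Proof.
move=> h1 h2; apply/cvgC_nrP => e e0; have d0 : 0 < e / 2 by rewrite divr_gt0.
apply: filterS2 (cvgC_nr h1 d0) (cvgC_nr h2 d0) => t ? ?.
have -> : l - m - (f t - g t) = (l - f t) - (m - g t) by ring.
by apply: le_lt_trans (nrB _ _) _; lra.
Qed.

Lemma cvgC_sum (T J : Type) (F : set_system T) {FF : Filter F} (r : seq J)
    (f : J -> T -> C) (l : J -> C) : (forall j, f j @ F --> (l j : C^o)) ->
  (fun t => \sum_(j <- r) f j t) @ F --> ((\sum_(j <- r) l j : C) : C^o).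
Proof.
move=> h; elim: r => [|j r IH].
  rewrite big_nil; have -> : (fun t => \sum_(j <- [::]) f j t) = fun=> 0.
    by apply/funext => t; rewrite big_nil.
  by apply/cvgC_nrP => e e0; apply: filterE => t; rewrite subrr nr0.
rewrite big_cons; have -> : (fun t => \sum_(j <- j :: r) f j t) =
    fun t => f j t + \sum_(j <- r) f j t by apply/funext => t; rewrite big_cons.
exact: (cvgCD (h j) IH).
Qed.

Lemma cvgC_uniq (T : Type) (F : set_system T) {FF : ProperFilter F} (f : T -> C) (l l' : C) :
  f @ F --> (l : C^o) -> f @ F --> (l' : C^o) -> l = l'.
Proof. exact: (@cvg_nr_uniq C^o). Qed.

End RealNorm.

(** * Sesquilinear forms *)

Section SesquilinearForms.
Variables (R : realType) (V : lmodType R[i]).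
Local Notation C := R[i].
Local Notation re := (@complex.Re R).
Local Notation im := (@complex.Im R).
Local Notation "x %:C" := (real_complex _ x) : ring_scope.

(** Relative to a set [P], because states and GNS maps are total functions on [H -> H] that are
    linear only on the algebra. *)
Definition sesq (P : set V) (B : V -> V -> C) :=
  (forall a x y z, P x -> P y -> P z -> B (a *: x + y) z = a * B x z + B y z) /\
  (forall a x y z, P x -> P y -> P z -> B x (a *: y + z) = a^* * B x y + B x z).

Definition lsub (P : set V) :=
  P 0 /\ forall (a : C) x y, P x -> P y -> P (a *: x + y).

Lemma lsubD P x y : lsub P -> P x -> P y -> P (x + y).
Proof. by move=> [_ h] Px Py; rewrite -[x]scale1r; exact: h. Qed.

Lemma lsubZ P (a : C) x : lsub P -> P x -> P (a *: x).
Proof. by move=> [P0 h] Px; rewrite -[_ *: x]addr0; exact: h. Qed.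

Lemma lsubN P x : lsub P -> P x -> P (- x).
Proof. by move=> h Px; rewrite -scaleN1r; exact: lsubZ. Qed.

Lemma lsubB P x y : lsub P -> P x -> P y -> P (x - y).
Proof. by move=> h Px Py; apply: lsubD => //; exact: lsubN. Qed.

Lemma lsub_sum P (I : Type) (r : seq I) (Q : pred I) (F : I -> V) :
  lsub P -> (forall i, Q i -> P (F i)) -> P (\sum_(i <- r | Q i) F i).
Proof.
move=> h hF; apply: big_ind => //; first by case: h.
by move=> *; exact: lsubD.
Qed.

Section OnSubspace.
Variables (P : set V) (hP : lsub P) (B : V -> V -> C) (hB : sesq P B).
Let P0 : P 0. Proof. by case: hP. Qed.
Let B1 := hB.1. Let B2 := hB.2.

Lemma sesqDl x y z : P x -> P y -> P z -> B (x + y) z = B x z + B y z.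
Proof. by move=> *; rewrite -[x in LHS]scale1r B1// mul1r. Qed.
Lemma sesq0l z : P z -> B 0 z = 0.
Proof. by move=> Pz; have /eqP := @sesqDl 0 0 z P0 P0 Pz; rewrite addr0 -subr_eq0 opprD addNKr oppr_eq0 => /eqP. Qed.
Lemma sesqZl a x z : P x -> P z -> B (a *: x) z = a * B x z.
Proof. by move=> *; rewrite -[a *: x]addr0 B1// sesq0l// addr0. Qed.
Lemma sesqDr x y z : P x -> P y -> P z -> B x (y + z) = B x y + B x z.
Proof. by move=> *; rewrite -[y in LHS]scale1r B2// rmorph1 mul1r. Qed.
Lemma sesq0r z : P z -> B z 0 = 0.
Proof. by move=> Pz; have /eqP := @sesqDr z 0 0 Pz P0 P0; rewrite addr0 -subr_eq0 opprD addNKr oppr_eq0 => /eqP. Qed.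
Lemma sesqZr a x z : P x -> P z -> B x (a *: z) = a^* * B x z.
Proof. by move=> *; rewrite -[a *: z]addr0 B2// sesq0r// addr0. Qed.

Let icj : (iu R)^* = - iu R.
Proof. by apply: complex_eq; rewrite !reimE ?oppr0. Qed.

Lemma polarization x y : P x -> P y ->
  4%:R * B x y = B (x + y) (x + y) - B (x - y) (x - y)
    + iu R * (B (x + iu R *: y) (x + iu R *: y) - B (x - iu R *: y) (x - iu R *: y)).
Proof.
move=> Px Py; have Piy : P (iu R *: y) by exact: lsubZ.
have Pn u : P u -> P (- u) by exact: lsubN.
have Ng u v : P u -> P v -> B (u) (- v) = - B u v.
  by move=> ? ?; rewrite -scaleN1r sesqZr// rmorphN1 mulN1r.
have gN u v : P u -> P v -> B (- u) v = - B u v.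
  by move=> ? ?; rewrite -scaleN1r sesqZl// mulN1r.
have PD u v : P u -> P v -> P (u + v) by move=> ? ?; exact: lsubD.
rewrite !sesqDl ?sesqDr ?gN ?Ng//; try (by auto).
rewrite !sesqZl ?sesqZr//; try (by auto).
rewrite icj.
have ii : iu R * iu R = -1 :> C by rewrite -[LHS]expr2 sqr_i.
ring: ii.
Qed.

End OnSubspace.

Lemma sesq_ext P (B B' : V -> V -> C) : lsub P -> sesq P B -> sesq P B' ->
  (forall x, P x -> B x x = B' x x) -> forall x y, P x -> P y -> B x y = B' x y.
Proof.
move=> hP hB hB' h x y Px Py; apply: (@mulfI _ (4%:R : C)); first by rewrite pnatr_eq0.
have Piy : P (iu R *: y) by exact: lsubZ.
by rewrite (polarization hP hB)// (polarization hP hB')// !h//;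
  (exact: lsubD || exact: lsubB).
Qed.

Section Positive.
Variables (P : set V) (hP : lsub P) (B : V -> V -> C) (hB : sesq P B).
Hypothesis B_ge0 : forall x, P x -> 0 <= B x x.

(** The values at [x + y] and at [x + i y] are real; the first gives the imaginary part of the
    identity, the second its real part. *)
Lemma sesq_herm x y : P x -> P y -> B y x = (B x y)^*.
Proof.
move=> Px Py; have Piy : P (iu R *: y) by exact: lsubZ.
have /cge0P[_ h1] := B_ge0 (lsubD hP Px Py).
have /cge0P[_ h2] := B_ge0 (lsubD hP Px Piy).
have /cge0P[_ hx] := B_ge0 Px; have /cge0P[_ hy] := B_ge0 Py.
move: h1 h2; rewrite !(sesqDl hB, sesqDr hB)//; try exact: lsubD.
rewrite !(sesqZl hP hB, sesqZr hP hB)// => h1 h2.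
move: h1 h2; rewrite !reimE hx hy => h1 h2.
apply: complex_eq; rewrite !reimE; lra.
Qed.

Lemma cauchy_schwarz x y : P x -> P y ->
  nr (B x y) ^+ 2 <= re (B x x) * re (B y y).
Proof.
move=> Px Py; set z := B x y; have hyx : B y x = z^* by exact: sesq_herm.
(* Positivity at [x - s z y]; the optimal [s] is the inverse of [B y y]. *)
have h s : 0 <= re (B x x) - 2 * s * nr z ^+ 2 + s ^+ 2 * nr z ^+ 2 * re (B y y).
  have Pu : P ((- (s%:C * z)) *: y) by exact: lsubZ.
  have /cge0P[+ _] := B_ge0 (lsubD hP Px Pu).
  rewrite !(sesqDl hB, sesqDr hB)//; try exact: lsubD.
  rewrite !(sesqZl hP hB, sesqZr hP hB)// hyx -/z nr_sqr !reimE.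
  have /cge0P[_ ->] := B_ge0 Py; move=> h; apply: le_trans h _.
  by rewrite le_eqVlt; apply/orP; left; apply/eqP; ring.
have /cge0P[a0 _] := B_ge0 Px; have /cge0P[b0 _] := B_ge0 Py.
move: h a0 b0; have := sqr_ge0 (nr z).
move: (nr z ^+ 2) (re (B x x)) (re (B y y)) => m a b m0 h a0 b0.
have [b1|b1] := eqVneq b 0.
  rewrite b1 mulr0 in h *; have [->//|mn0] := eqVneq m 0.
  (* If [B y y = 0] the bound is affine in [s], and this [s] would make it [-1]. *)
  have := h ((a + 1) / (2 * m)).
  have -> : 2 * ((a + 1) / (2 * m)) * m = a + 1 by field.
  by rewrite mulr0; lra.
have b2 : 0 < b by rewrite lt_def b1.
have := h b^-1; have -> : a - 2 * b^-1 * m + b^-1 ^+ 2 * m * b = (a * b - m) / b.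
  by field.
by rewrite pmulr_lge0 ?invr_gt0// subr_ge0.
Qed.

End Positive.
End SesquilinearForms.

Section FunctionSpace.
Variables (T : Type) (V : zmodType).
Implicit Types f g : T -> V.

Lemma fctD f g x : (f + g) x = f x + g x. Proof. by []. Qed.
Lemma fctN f x : (- f) x = - f x. Proof. by []. Qed.
Lemma fct0 x : (0 : T -> V) x = 0. Proof. by []. Qed.
Lemma fct_sum (I : Type) (r : seq I) (P : pred I) (F : I -> T -> V) x :
  (\sum_(i <- r | P i) F i) x = \sum_(i <- r | P i) F i x.
Proof. by elim/big_rec2 : _ => // i u v _ <-. Qed.
Lemma fctZ (K : pzRingType) (W : lmodType K) (a : K) (f : T -> W) x : (a *: f) x = a *: f x.
Proof. by []. Qed.
Definition fctE := (fctD, fctN, @fctZ, fct0, fct_sum).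
End FunctionSpace.

(** * Hilbert spaces and bounded operators *)

Section HilbertBasics.
Variables (R : realType) (H : hilbertType R).
Local Notation C := R[i].
Local Notation re := (@complex.Re R).
Local Notation im := (@complex.Im R).
Local Notation "x %:C" := (real_complex _ x) : ring_scope.
Implicit Types x y z : H.

Lemma lsubT (V : lmodType C) : lsub [set: V]. Proof. by split. Qed.

Lemma dotp_sesq : sesq [set: H] (dotp : H -> H -> C).
Proof.
split=> a x y z _ _ _; first exact: dotpPl.
by rewrite dotpC dotpPl rmorphD rmorphM/= -!dotpC.
Qed.

Lemma dotpDl x y z : dotp (x + y) z = dotp x z + dotp y z.
Proof. by rewrite (sesqDl dotp_sesq). Qed.
Lemma dotpDr x y z : dotp x (y + z) = dotp x y + dotp x z.
Proof. by rewrite (sesqDr dotp_sesq). Qed.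
Lemma dotpZl a x z : dotp (a *: x) z = a * dotp x z.
Proof. by rewrite (sesqZl (lsubT H) dotp_sesq). Qed.
Lemma dotpZr a x z : dotp x (a *: z) = a^* * dotp x z.
Proof. by rewrite (sesqZr (lsubT H) dotp_sesq). Qed.
Lemma dotp0l z : dotp 0 z = 0.
Proof. by rewrite (sesq0l (lsubT H) dotp_sesq). Qed.
Lemma dotp0r z : dotp z 0 = 0.
Proof. by rewrite (sesq0r (lsubT H) dotp_sesq). Qed.
Lemma dotpNl x z : dotp (- x) z = - dotp x z.
Proof. by rewrite -scaleN1r dotpZl mulN1r. Qed.
Lemma dotpNr x z : dotp x (- z) = - dotp x z.
Proof. by rewrite -scaleN1r dotpZr rmorphN1 mulN1r. Qed.
Lemma dotpBl x y z : dotp (x - y) z = dotp x z - dotp y z.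
Proof. by rewrite dotpDl dotpNl. Qed.
Lemma dotpBr x y z : dotp x (y - z) = dotp x y - dotp x z.
Proof. by rewrite dotpDr dotpNr. Qed.

Lemma dotp_suml (I : Type) (r : seq I) (P : pred I) (F : I -> H) z :
  dotp (\sum_(i <- r | P i) F i) z = \sum_(i <- r | P i) dotp (F i) z.
Proof. by elim/big_rec2 : _ => [|i u v _ <-]; rewrite ?dotp0l ?dotpDl. Qed.
Lemma dotp_sumr (I : Type) (r : seq I) (P : pred I) (F : I -> H) z :
  dotp z (\sum_(i <- r | P i) F i) = \sum_(i <- r | P i) dotp z (F i).
Proof. by elim/big_rec2 : _ => [|i u v _ <-]; rewrite ?dotp0r ?dotpDr. Qed.

Lemma dotpxx x : dotp x x = (nr x ^+ 2)%:C.
Proof. by rewrite dotpE nrE -rmorphXn. Qed.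
Lemma re_dotpxx x : re (dotp x x) = nr x ^+ 2.
Proof. by rewrite dotpxx. Qed.
Lemma dotp_ge0 x : 0 <= dotp x x.
Proof. by rewrite dotpxx lecR sqr_ge0. Qed.

Lemma dotp_CS x y : nr (dotp x y) <= nr x * nr y.
Proof.
rewrite -(@ler_pXn2r _ 2) ?nnegrE ?mulr_ge0 ?nr_ge0//.
rewrite exprMn -!re_dotpxx.
by apply: (cauchy_schwarz (lsubT H) dotp_sesq) => // z _; exact: dotp_ge0.
Qed.

Lemma dotp_eq0 x : (forall y, dotp x y = 0) -> x = 0.
Proof.
move=> /(_ x) /(congr1 re); rewrite re_dotpxx/= => /eqP.
by rewrite sqrf_eq0 => /eqP /nr0_eq0.
Qed.

Lemma dotp_inj x y : (forall z, dotp x z = dotp y z) -> x = y.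
Proof.
move=> h; apply/eqP; rewrite -subr_eq0; apply/eqP/dotp_eq0 => z.
by rewrite dotpBl h subrr.
Qed.

Lemma nrZ (a : C) x : nr (a *: x) = nr a * nr x.
Proof. by apply: (@complexI R); rewrite rmorphM/= -!nrE normrZ. Qed.

Lemma nr_sqrD x y : nr (x + y) ^+ 2 = nr x ^+ 2 + 2 * re (dotp x y) + nr y ^+ 2.
Proof.
rewrite -!re_dotpxx dotpDl !dotpDr (dotpC x y) !reimE; ring.
Qed.

Lemma nr_sqrB x y : nr (x - y) ^+ 2 = nr x ^+ 2 - 2 * re (dotp x y) + nr y ^+ 2.
Proof. by rewrite nr_sqrD nrN dotpNr !reimE; ring. Qed.

Lemma nr_real_scale (s : R) x : 0 <= s -> nr (s%:C *: x) = s * nr x.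
Proof. by move=> s0; rewrite nrZ nr_real ger0_norm. Qed.

Lemma cvg_dotp (T : Type) (F : set_system T) {FF : Filter F} (f g : T -> H) x y :
  f @ F --> x -> g @ F --> y -> (fun t => dotp (f t) (g t)) @ F --> (dotp x y : C^o).
Proof.
move=> /cvg_nrP hf /cvg_nrP hg; apply/cvgC_nrP => e e0.
pose d := e / (nr x + nr y + 1 + e).
have Mp : 0 < nr x + nr y + 1 + e.
  by have := nr_ge0 x; have := nr_ge0 y; lra.
have d0 : 0 < d by rewrite divr_gt0.
have dM : d * (nr x + nr y + 1 + e) = e by rewrite mulfVK// gt_eqF.
have d1 : d <= 1.
  by rewrite ler_pdivrMr// mul1r; have := nr_ge0 x; have := nr_ge0 y; lra.
near=> t.
have h1 : nr (x - f t) < d by near: t; exact: hf.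
have h2 : nr (y - g t) < d by near: t; exact: hg.
have -> : dotp x y - dotp (f t) (g t) =
    dotp x (y - g t) + dotp (x - f t) y - dotp (x - f t) (y - g t).
  by rewrite !(dotpBl, dotpBr); ring.
have a1 := dotp_CS x (y - g t); have a2 := dotp_CS (x - f t) y.
have a3 := dotp_CS (x - f t) (y - g t).
apply: le_lt_trans (nrB _ _) _; apply: le_lt_trans (lerD (nrD _ _) (lexx _)) _.
have := nr_ge0 (x - f t); have := nr_ge0 (y - g t); have := nr_ge0 x; have := nr_ge0 y.
nra.
Unshelve. all: by end_near. Qed.

Lemma cvg_dotpl (T : Type) (F : set_system T) {FF : Filter F} (f : T -> H) x y :
  f @ F --> x -> (fun t => dotp (f t) y) @ F --> (dotp x y : C^o).
Proof. by move=> hf; apply: cvg_dotp => //; exact: cvg_cst. Qed.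

Lemma cvg_dotpr (T : Type) (F : set_system T) {FF : Filter F} (f : T -> H) x y :
  f @ F --> y -> (fun t => dotp x (f t)) @ F --> (dotp x y : C^o).
Proof. by move=> hf; apply: cvg_dotp => //; exact: cvg_cst. Qed.

Definition adh (A : set H) : set H :=
  [set x | forall e : R, 0 < e -> exists2 a, A a & nr (x - a) < e].

Lemma adh_sub (A : set H) : A `<=` adh A.
Proof. by move=> x Ax e e0; exists x; rewrite // subrr nr0. Qed.

Lemma dense_adh (A : set H) : dense A <-> (forall x, adh A x).
Proof.
split=> [dA x e e0|h O [x Ox] oO].
  have xe : nbhs x (ball x e%:C) by apply: nbhsx_ballx; rewrite ltcR.
  have [y [By Ay]] : (ball x e%:C)° `&` A !=set0.
    apply: dA; last exact: open_interior.
    by exists x; exact: xe.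
  exists y => //; have := interior_subset By.
  by rewrite -ball_normE/= nrE ltcR.
have /nbhs_ballP[e /cgt0E[-> e0] he] := open_nbhs_nbhs (conj oO Ox).
have [a Aa ha] := h x _ e0; exists a; split => //; apply: he.
by rewrite -ball_normE/= nrE ltcR.
Qed.

Lemma adh_cvg (A : set H) x : adh A x ->
  exists2 f : nat -> H, (forall n, A (f n)) & f @ \oo --> x.
Proof.
move=> h; have /choice[f hf] : forall n : nat, exists y, A y /\ nr (x - y) < n.+1%:R^-1.
  by move=> n; have [|y] := h n.+1%:R^-1; [rewrite invr_gt0|exists y].
exists f; first by move=> n; case: (hf n).
apply/cvg_nrP => e e0; near=> n.
apply: lt_trans (hf n).2 _.
by near: n; exact: (near_infty_natSinv_lt (PosNum e0)).
Unshelve. all: by end_near. Qed.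

Lemma adh_dotp0 (A : set H) x y : adh A x -> (forall a, A a -> dotp a y = 0) -> dotp x y = 0.
Proof.
move=> /adh_cvg [f Af fx] h.
have h0 : (fun n => dotp (f n) y) @ \oo --> (0 : C^o).
  by apply/cvgC_nrP => e e0; near=> n; rewrite h// subrr nr0.
exact: (cvgC_uniq (cvg_dotpl (y := y) fx) h0).
Unshelve. all: by end_near. Qed.

End HilbertBasics.

Section BoundedOperators.
Variables (R : realType).
Local Notation C := R[i].
Local Notation "x %:C" := (real_complex _ x) : ring_scope.
Implicit Types H K : hilbertType R.

(** The two-space version of [bounded_op], with a real nonnegative constant; [bop_bounded]
    identifies them on endomorphisms. *)
Definition bop H K (A : H -> K) :=
  linear A /\ exists2 c : R, 0 <= c & forall x, nr (A x) <= c * nr x.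

Lemma bop_bounded H (A : H -> H) : bounded_op A <-> bop A.
Proof.
split=> -[lA].
  move=> [c h]; split=> //; exists (nr c); first exact: nr_ge0.
  move=> x; have := h x; rewrite !nrE lecE => /andP[_].
  rewrite !reimE mulr0 subr0 => hx; apply: le_trans hx _.
  by rewrite ler_wpM2r ?nr_ge0// re_le.
move=> [c c0 h]; split=> //; exists c%:C => x.
by rewrite !nrE -rmorphM lecR.
Qed.

Section Maps.
Variables H K : hilbertType R.
Implicit Types A B : H -> K.

Lemma lin0 A : linear A -> A 0 = 0.
Proof. by move=> l; have := l (-1) 0 0; rewrite scaler0 addr0 scaleN1r addNr. Qed.
Lemma linDE A x y : linear A -> A (x + y) = A x + A y.
Proof. by move=> l; have := l 1 x y; rewrite !scale1r. Qed.
Lemma linZE A a x : linear A -> A (a *: x) = a *: A x.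
Proof. by move=> l; have := l a x 0; rewrite lin0// !addr0. Qed.
Lemma linNE A x : linear A -> A (- x) = - A x.
Proof. by move=> l; rewrite -scaleN1r linZE// scaleN1r. Qed.
Lemma linBE A x y : linear A -> A (x - y) = A x - A y.
Proof. by move=> l; rewrite linDE// linNE. Qed.
Lemma lin_sum A (I : Type) (r : seq I) (P : pred I) (F : I -> H) : linear A ->
  A (\sum_(i <- r | P i) F i) = \sum_(i <- r | P i) A (F i).
Proof. by move=> l; elim/big_rec2 : _ => [|i u v _ <-]; rewrite ?lin0 ?linDE. Qed.

Lemma bop_cvg A (T : Type) (F : set_system T) {FF : Filter F} (f : T -> H) x :
  bop A -> f @ F --> x -> A (f t) @[t --> F] --> A x.
Proof.
move=> [lA [c c0 hA]] /cvg_nrP hf; apply/cvg_nrP => e e0.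
have d0 : 0 < e / (c + 1) by rewrite divr_gt0//; lra.
apply: filterS (hf _ d0) => t ht; rewrite -linBE//.
apply: le_lt_trans (hA _) _.
rewrite ltr_pdivlMr in ht; last lra.
by have := nr_ge0 (x - f t); nra.
Qed.

Lemma bop_ext (A B : H -> K) (D : set H) : bop A -> bop B -> (forall x, adh D x) ->
  (forall x, D x -> A x = B x) -> A = B.
Proof.
move=> hA hB dD h; apply/funext => x; have [f Df fx] := adh_cvg (dD x).
apply: (cvg_nr_uniq (bop_cvg hA fx)).
under eq_fun do rewrite h//; exact: bop_cvg.
Qed.

Lemma bop0 : bop (fun _ : H => 0 : K).
Proof.
split=> [a x y|]; first by rewrite scaler0 addr0.
by exists 0 => // x; rewrite nr0 mul0r.
Qed.

Lemma bop_lin a A B : bop A -> bop B -> bop (a *: A + B).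
Proof.
move=> [lA [c c0 hA]] [lB [d d0 hB]]; split=> [b x y|].
  by rewrite !fctE lA lB !scalerDr !scalerA (mulrC a b) addrACA.
exists (nr a * c + d); first by rewrite addr_ge0// mulr_ge0// nr_ge0.
move=> x; rewrite !fctE; apply: le_trans (nrD _ _) _.
by rewrite mulrDl lerD// nrZ -mulrA ler_wpM2l// nr_ge0.
Qed.

Lemma bop_unique_adj (A : H -> K) (B B' : K -> H) :
  (forall x y, dotp (A x) y = dotp x (B y)) ->
  (forall x y, dotp (A x) y = dotp x (B' y)) -> B = B'.
Proof.
move=> h h'; apply/funext => y; apply: dotp_inj => z.
by rewrite dotpC -h h' -dotpC.
Qed.

End Maps.

Lemma bop_id H : bop (id : H -> H).
Proof. by split=> //; exists 1 => // x; rewrite mul1r. Qed.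

Lemma bop_comp (H1 H2 H3 : hilbertType R) (A : H2 -> H3) (B : H1 -> H2) :
  bop A -> bop B -> bop (A \o B).
Proof.
move=> [lA [c c0 hA]] [lB [d d0 hB]]; split=> [a x y|]; first by rewrite /= lB lA.
exists (c * d); first by rewrite mulr_ge0.
by move=> x; apply: le_trans (hA _) _; rewrite -mulrA ler_wpM2l.
Qed.

(* Minimising [|iota v|^2 - 2 Re (f v)] over [P]. *)
Lemma riesz (V : lmodType C) (P : set V) H (iota : V -> H) (f : V -> C) (c : R) :
  lsub P ->
  (forall a x y, P x -> P y -> iota (a *: x + y) = a *: iota x + iota y) ->
  (forall a x y, P x -> P y -> f (a *: x + y) = a * f x + f y) ->
  (forall v, P v -> nr (f v) <= c * nr (iota v)) ->
  exists2 w, adh (iota @` P) w & forall v, P v -> f v = dotp (iota v) w.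
Proof.
move=> hP iL fL hc; have [P0 _] := hP.
have i0 : iota 0 = 0.
  by have := iL (-1) 0 0 P0 P0; rewrite scaler0 addr0 scaleN1r addNr.
have f0 : f 0 = 0.
  by have := fL (-1) 0 0 P0 P0; rewrite scaler0 addr0 mulN1r addNr.
pose re := @complex.Re R.
pose J v := nr (iota v) ^+ 2 - 2 * re (f v).
have Jlb v : P v -> - c ^+ 2 <= J v.
  move=> Pv; have := hc v Pv; have := re_le (f v).
  rewrite /J -/re; have := sqr_ge0 (nr (iota v) - c); nra.
pose S := J @` P.
have S0 : has_inf S.
  split; first by exists (J 0), 0.
  by exists (- c ^+ 2) => _ [v Pv <-]; exact: Jlb.
pose m := inf S.
have mle v : P v -> m <= J v by move=> Pv; apply: ge_inf; [exact: S0.2|exists v].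
have JE (t : C) u v : P u -> P v -> J (t *: u + v) =
    J v + 2 * re (t * (dotp (iota u) (iota v) - f u)) + nr t ^+ 2 * nr (iota u) ^+ 2.
  move=> Pu Pv; rewrite /J iL// fL// nr_sqrD nrZ dotpZl exprMn mulrBr /re !reimE.
  ring.
(* The filter of near-minimisers of [J]. Its image under [iota] is Cauchy by the parallelogram law,
   since midpoints cannot go below [m]. *)
pose F := filter_from [set e : R | 0 < e] (fun e => [set v | P v /\ J v < m + e]).
have FF : ProperFilter F.
  apply: filter_from_proper; last first.
    move=> e e0; have [_ [v Pv <-] h] := inf_adherent e0 S0.
    by exists v.
  apply: filter_from_filter; first by exists 1 => /=.
  move=> e d e0 d0; exists (Num.min e d); first by rewrite /= lt_min e0.
  move=> v [Pv]; rewrite -ltrBlDl lt_min => /andP[h1 h2].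
  by split; split=> //; rewrite -ltrBlDl.
have [w Fw] : exists w : H, iota x @[x --> F] --> w.
  apply: cauchy_nr => e e0.
  exists [set v | P v /\ J v < m + e ^+ 2 / 4].
    by exists (e ^+ 2 / 4) => //=; rewrite divr_gt0// exprn_gt0.
  move=> u v [Pu hu] [Pv hv].
  rewrite -(@ltr_pXn2r _ 2) ?nnegrE ?nr_ge0 ?ltW//.
  have half : P (2^-1 *: u + 2^-1 *: v) by apply: hP.2 => //; exact: lsubZ.
  have := mle _ half.
  have i2 : iota (2^-1 *: v) = 2^-1 *: iota v by rewrite -[X in iota X]addr0 iL// i0 addr0.
  have f2 : f (2^-1 *: v) = 2^-1 * f v by rewrite -[X in f X]addr0 fL// f0 addr0.
  move: hu hv; rewrite /J iL//; last exact: lsubZ.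
  rewrite fL//; last exact: lsubZ.
  rewrite i2 f2 -scalerDr nrZ -mulrDr.
  have -> : (2^-1 : C) = (2^-1)%:C by rewrite fmorphV rmorph_nat.
  rewrite nr_real gtr0_norm ?invr_gt0// exprMn nr_sqrD nr_sqrB /re !reimE.
  lra.
exists w.
  move=> e e0; move/cvg_nrP : Fw => /(_ _ e0) [d d0 hd].
  have [_ [v Pv <-] h] := inf_adherent d0 S0.
  by exists (iota v); [exists v|apply: hd].
move=> v Pv; apply/eqP; rewrite eq_sym -subr_eq0; apply/eqP.
set z := _ - _.
(* First variation at a near-minimiser in the direction [t *: v], with [t] chosen so that [t * z] is
   the real number [- s |z|^2]. *)
have key (s : R) : 0 <= - 2 * s * nr z ^+ 2 + s ^+ 2 * nr z ^+ 2 * nr (iota v) ^+ 2.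
  apply/ler_addgt0Pl => e e0.
  pose t : C := - s%:C * z^*.
  have e2 : 0 < e / (4 * (nr t + 1)).
    by rewrite divr_gt0// mulr_gt0//; have := nr_ge0 t; lra.
  have hn : \forall u \near F, nr (dotp (iota v) w - dotp (iota v) (iota u)) <
      e / (4 * (nr t + 1)) by apply: cvgC_nr e2; exact: cvg_dotpr.
  have e4 : F [set v | P v /\ J v < m + e / 2].
    by exists (e / 2) => //=; rewrite divr_gt0.
  have [u [hu [Pu Ju]]] := filter_ex (filterI hn e4).
  have Ptu : P (t *: v + u) by exact: hP.2.
  have := mle _ Ptu; rewrite JE//.
  have -> : dotp (iota v) (iota u) - f v = z - (dotp (iota v) w - dotp (iota v) (iota u)).
    by rewrite /z; ring.
  rewrite mulrBr; set q := (dotp (iota v) w - _) in hu *.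
  have tz : t * z = (- s * nr z ^+ 2)%:C.
    by apply: complex_eq; rewrite /t nr_sqr !reimE; ring.
  have -> : nr t ^+ 2 = s ^+ 2 * nr z ^+ 2.
    by rewrite /t nrM nr_conj exprMn nrN nr_real real_normK ?num_real.
  have tq : nr (t * q) <= e / 4.
    rewrite nrM; move: hu; rewrite ltr_pdivlMr ?mulr_gt0//; last first.
      by have := nr_ge0 t; lra.
    have := nr_ge0 t; have := nr_ge0 q; nra.
  have := re_abs (t * q); rewrite ler_norml => /andP[h1 h2].
  rewrite tz /re reD reN rereal; lra.
apply: nr0_eq0; apply/eqP; rewrite -sqrf_eq0 eq_le sqr_ge0 andbT.
move: key (sqr_ge0 (nr z)); move: (nr z ^+ 2) => Z key Z0.
have b0 := sqr_ge0 (nr (iota v)).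
(* An [s] so small that the linear term beats the quadratic one unless [z = 0]. *)
have := key (nr (iota v) ^+ 2 + 1)^-1.
set b := nr (iota v) ^+ 2 in b0 *; have b1 : 0 < b + 1 by lra.
have -> : - 2 * (b + 1)^-1 * Z + (b + 1)^-1 ^+ 2 * Z * b = - Z * ((b + 2) / (b + 1) ^+ 2).
  by field; rewrite gt_eqF.
by rewrite pmulr_lge0 ?oppr_ge0// divr_gt0//; [lra|rewrite exprn_gt0].
Qed.

End BoundedOperators.

(** * Adjoints, extensions and positive operators *)

Section Adjoints.
Variables (R : realType).
Local Notation C := R[i].
Local Notation re := (@complex.Re R).
Local Notation "x %:C" := (real_complex _ x) : ring_scope.
Implicit Types H K : hilbertType R.

Section RieszOperator.
Variables (V : lmodType C) (P : set V) (H K : hilbertType R).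
Variables (iota : V -> H) (g : V -> K) (c : R).
Hypotheses (hP : lsub P)
  (iL : forall a x y, P x -> P y -> iota (a *: x + y) = a *: iota x + iota y)
  (gL : forall a x y, P x -> P y -> g (a *: x + y) = a *: g x + g y)
  (gc : forall v, P v -> nr (g v) <= c * nr (iota v)) (c0 : 0 <= c).

Lemma adh_image_lin a x y :
  adh (iota @` P) x -> adh (iota @` P) y -> adh (iota @` P) (a *: x + y).
Proof.
move=> hx hy e e0; have a1 : 0 < nr a + 1 by have := nr_ge0 a; lra.
have e1 : 0 < e / 2 / (nr a + 1) by rewrite !divr_gt0.
have e2 : 0 < e / 2 by rewrite divr_gt0.
have [_ [u Pu <-] hu] := hx _ e1; have [_ [v Pv <-] hv] := hy _ e2.
exists (a *: iota u + iota v).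
  by exists (a *: u + v); [exact: hP.2|rewrite iL].
rewrite opprD addrACA -scalerBr.
apply: le_lt_trans (nrD _ _) _; rewrite nrZ.
move: hu; rewrite ltr_pdivlMr// => hu; have := nr_ge0 a; have := nr_ge0 (x - iota u).
nra.
Qed.

Lemma adh_image_uniq x y : adh (iota @` P) x -> adh (iota @` P) y ->
  (forall v, P v -> dotp (iota v) x = dotp (iota v) y) -> x = y.
Proof.
move=> hx hy h; apply/eqP; rewrite -subr_eq0; apply/eqP.
have hxy : adh (iota @` P) (x - y).
  by rewrite addrC -scaleN1r; exact: adh_image_lin.
have : dotp (x - y) (x - y) = 0.
  by apply: (adh_dotp0 hxy) => _ [v Pv <-]; rewrite dotpBr h// subrr.
by move/(congr1 re); rewrite re_dotpxx/= => /eqP; rewrite sqrf_eq0 => /eqP/nr0_eq0.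
Qed.

(** [B] is the adjoint of the bounded map [iota v |-> g v] defined on the image of [iota]. Keeping
    its values in the closure of that image makes it unique, hence linear. For [g = iota] it is the
    orthogonal projection onto this closure. *)
Lemma riesz_op : exists B : K -> H,
  [/\ linear B, forall y, nr (B y) <= c * nr y,
      forall y, adh (iota @` P) (B y)
    & forall v y, P v -> dotp (g v) y = dotp (iota v) (B y)].
Proof.
have h (y : K) : exists w, adh (iota @` P) w /\
    forall v, P v -> dotp (g v) y = dotp (iota v) w.
  have [||w h1 h2] := @riesz R V P H iota (fun v => dotp (g v) y) (c * nr y) hP iL.
  - by move=> a u v Pu Pv; rewrite gL// dotpPl.
  - move=> v Pv; apply: le_trans (dotp_CS _ _) _.
    by rewrite mulrAC ler_wpM2r ?nr_ge0// gc.
  - by exists w.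
have [B hB] := choice h; exists B.
have bB y : nr (B y) <= c * nr y.
  have [a1 a2] := hB y; have [f hf fB] := adh_cvg a1.
  have [->|By0] := eqVneq (nr (B y)) 0; first by rewrite mulr_ge0 ?nr_ge0.
  have Bp : 0 < nr (B y) by rewrite lt_def By0 nr_ge0.
  rewrite -(ler_pM2r Bp) -expr2 -re_dotpxx.
  apply/ler_addgt0Pl => e e0.
  have cy := mulr_ge0 c0 (nr_ge0 y).
  have d0 : 0 < e / (nr (B y) + c * nr y + 1).
    by rewrite divr_gt0//; lra.
  have [n hn] := filter_ex (cvg_nr fB d0).
  have [v Pv vE] := hf n.
  have -> : dotp (B y) (B y) = dotp (B y - f n) (B y) + dotp (g v) y.
    by rewrite a2// vE dotpBl subrK.
  rewrite reD; have h1 := le_trans (re_le _) (dotp_CS (B y - f n) (B y)).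
  have h2 := le_trans (re_le _) (dotp_CS (g v) y).
  have h3 := gc Pv; rewrite vE in h3.
  have h4 : nr (f n) <= nr (B y) + nr (B y - f n).
    by rewrite nrC -{1}[f n](subrK (B y)) addrC nrD.
  have y0 := nr_ge0 y; have d1 := nr_ge0 (B y - f n).
  move: hn; rewrite ltr_pdivlMr => [hn|]; last lra.
  have h5 : nr (g v) * nr y <= c * nr (f n) * nr y by rewrite ler_wpM2r.
  have h6 : c * nr y * nr (f n) <= c * nr y * (nr (B y) + nr (B y - f n)).
    by rewrite ler_wpM2l// mulr_ge0.
  nra.
split=> //; last by move=> v y Pv; case: (hB y) => _ ->.
  move=> a x y; apply: adh_image_uniq.
  - by case: (hB (a *: x + y)).
  - by apply: adh_image_lin; [case: (hB x)|case: (hB y)].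
  - move=> v Pv; rewrite dotpDr dotpZr -!(hB _).2// dotpDr dotpZr//.
by move=> y; case: (hB y).
Qed.

End RieszOperator.

Lemma bop_adjoint H K (A : H -> K) (c : R) : 0 <= c -> linear A ->
  (forall x, nr (A x) <= c * nr x) ->
  exists B : K -> H, [/\ linear B, forall y, nr (B y) <= c * nr y &
    forall x y, dotp (A x) y = dotp x (B y)].
Proof.
move=> c0 lA hA.
have [B [lB bB _ hB]] := @riesz_op H setT H K id A c (lsubT H) (fun _ _ _ _ _ => erefl)
  (fun a x y _ _ => lA a x y) (fun x _ => hA x) c0.
by exists B; split => // x y; exact: hB.
Qed.

Lemma bop_has_adjoint H K (A : H -> K) : bop A ->
  exists2 B : K -> H, bop B & forall x y, dotp (A x) y = dotp x (B y).
Proof.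
move=> [lA [c c0 hA]]; have [B [lB bB hB]] := bop_adjoint c0 lA hA.
by exists B => //; split=> //; exists c.
Qed.

Lemma adj_is_adjoint H (A : H -> H) : bop A -> is_adjoint A (adj A).
Proof.
move=> /bop_has_adjoint[B _ hB].
by apply: (@xgetPex _ (fun=> 0) [set y | is_adjoint A y]); exists B.
Qed.

Lemma adj_dotp H (A : H -> H) x y : bop A -> dotp (A x) y = dotp x (adj A y).
Proof. by move=> /adj_is_adjoint; apply. Qed.

Lemma adj_dotp' H (A : H -> H) x y : bop A -> dotp (adj A x) y = dotp x (A y).
Proof. by move=> hA; rewrite dotpC -adj_dotp// -dotpC. Qed.

Lemma adj_uniq H (A B : H -> H) : is_adjoint A B -> adj A = B.
Proof.
move=> h; apply: (bop_unique_adj (A := A)) => //.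
by apply: (@xgetPex _ (fun=> 0) [set y | is_adjoint A y]); exists B.
Qed.

Lemma bop_adj H (A : H -> H) : bop A -> bop (adj A).
Proof. by move=> /bop_has_adjoint[B bB hB]; rewrite (adj_uniq hB). Qed.

Lemma adjK H (A : H -> H) : bop A -> adj (adj A) = A.
Proof. by move=> hA; apply: adj_uniq => x y; exact: adj_dotp'. Qed.

Lemma adj_comp H (A B : H -> H) : bop A -> bop B -> adj (A \o B) = adj B \o adj A.
Proof. by move=> hA hB; apply: adj_uniq => x y; rewrite /= !adj_dotp. Qed.

Lemma adj_id H : adj (id : H -> H) = id.
Proof. exact: adj_uniq. Qed.

Lemma adj_lin H a (A B : H -> H) : bop A -> bop B ->
  adj (a *: A + B) = a^* *: adj A + adj B.
Proof.
move=> hA hB; apply: adj_uniq => x y.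
by rewrite !fctE dotpPl dotpDr dotpZr conjCK !adj_dotp.
Qed.

(** Continuous extension as a double adjoint: [riesz_op] gives the adjoint [B] of the densely
    defined map, and [A] is the adjoint of [B]. *)
Lemma extension (V : lmodType C) (P : set V) H K (iota : V -> H) (g : V -> K) (c : R) :
  lsub P ->
  (forall a x y, P x -> P y -> iota (a *: x + y) = a *: iota x + iota y) ->
  (forall a x y, P x -> P y -> g (a *: x + y) = a *: g x + g y) ->
  (forall v, P v -> nr (g v) <= c * nr (iota v)) -> 0 <= c ->
  (forall x, adh (iota @` P) x) ->
  exists A : H -> K, [/\ linear A, forall x, nr (A x) <= c * nr x &
    forall v, P v -> A (iota v) = g v].
Proof.
move=> hP iL gL gc c0 dP.
have [B [lB bB _ hB]] := riesz_op hP iL gL gc c0.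
have [A [lA bA hA]] := bop_adjoint c0 lB bB.
exists A; split=> // v Pv; apply: dotp_inj => z.
by rewrite dotpC -hA -dotpC hB.
Qed.

Section Positive.
Variables (H : hilbertType R).
Implicit Types A B : H -> H.

Definition qf A x := re (dotp (A x) x).

Lemma op_sesq A : linear A -> sesq [set: H] (fun x y => dotp (A x) y).
Proof.
move=> lA; split=> a x y z _ _ _; first by rewrite lA dotpPl.
by rewrite dotpDr dotpZr.
Qed.

Lemma op_ext A B : linear A -> linear B ->
  (forall x, dotp (A x) x = dotp (B x) x) -> A = B.
Proof.
move=> lA lB h; apply/funext => x; apply: dotp_inj => z.
by apply: (sesq_ext (lsubT H) (op_sesq lA) (op_sesq lB)).
Qed.

Lemma op_posE A x : op_pos A -> dotp (A x) x = (qf A x)%:C.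
Proof. by move=> /(_ x); exact: cge0E. Qed.

Lemma qf_ge0 A x : op_pos A -> 0 <= qf A x.
Proof. by move=> /(_ x) /cge0P[]. Qed.

Lemma pos_sym A x y : linear A -> op_pos A -> dotp (A x) y = dotp x (A y).
Proof.
move=> lA pA; rewrite (dotpC (A y)).
by apply: (sesq_herm (lsubT H) (op_sesq lA)) => // u _; exact: pA.
Qed.

Lemma pos_adj A : linear A -> op_pos A -> adj A = A.
Proof. by move=> lA pA; apply: adj_uniq => x y; exact: pos_sym. Qed.

Lemma pos_CS A x y : linear A -> op_pos A -> nr (dotp (A x) y) ^+ 2 <= qf A x * qf A y.
Proof.
move=> lA pA; apply: (cauchy_schwarz (lsubT H) (op_sesq lA)) => // u _; exact: pA.
Qed.

(** Cauchy-Schwarz for the form [<A x, y>] at the vectors [x] and [A x], divided by [|A x|^2]. *)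
Lemma pos_sqr A (c : R) x : linear A -> op_pos A -> 0 <= c ->
  (forall y, qf A y <= c * nr y ^+ 2) -> nr (A x) ^+ 2 <= c * qf A x.
Proof.
move=> lA pA c0 hA.
have [->|Ax0] := eqVneq (nr (A x)) 0.
  by rewrite expr0n mulr_ge0// qf_ge0.
have Ap : 0 < nr (A x) ^+ 2 by rewrite exprn_gt0// lt_def Ax0 nr_ge0.
have := pos_CS x (A x) lA pA; rewrite dotpxx nr_real ger0_norm ?sqr_ge0// => h.
rewrite -(ler_pM2r Ap) -expr2; apply: le_trans h _.
by rewrite (mulrC c) -mulrA ler_wpM2l ?qf_ge0// hA.
Qed.

Lemma pos_qf0 A x : bop A -> op_pos A -> qf A x = 0 -> A x = 0.
Proof.
move=> [lA [c c0 hA]] pA q0.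
have /(pos_sqr x lA pA c0) : forall y, qf A y <= c * nr y ^+ 2.
  move=> y; apply: le_trans (re_le _) _; apply: le_trans (dotp_CS _ _) _.
  by rewrite expr2 mulrA ler_wpM2r ?nr_ge0.
rewrite q0 mulr0 => h; apply: nr0_eq0; apply/eqP.
by rewrite -sqrf_eq0 eq_le h sqr_ge0.
Qed.

(** Surjectivity comes from Riesz: the lower bound controls [v |-> <v, y>] by [|A v|], so this
    functional is [<A v, w> = <v, A w>] for some [w]. *)
Lemma sym_inverse A (c : R) : bop A -> (forall x y, dotp (A x) y = dotp x (A y)) ->
  0 < c -> (forall x, c * nr x <= nr (A x)) ->
  exists2 B, bop B & (forall x, B (A x) = x) /\ (forall x, A (B x) = x).
Proof.
move=> bA sA c0 hA; have lA := bA.1.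
have h y : exists w, A w = y.
  have [|||w _ hw] := @riesz R H setT H A (fun v => dotp v y) (nr y / c) (lsubT H).
  - by move=> *; exact: lA.
  - by move=> a u v _ _; rewrite dotpPl.
  - move=> v _; apply: le_trans (dotp_CS _ _) _.
    by rewrite mulrC -mulrA ler_wpM2l ?nr_ge0// mulrC ler_pdivlMr// mulrC.
  - exists w; apply: dotp_inj => z.
    by rewrite dotpC (dotpC z y) hw// sA.
have [B hB] := choice h.
have inj x y : A x = A y -> x = y.
  move=> e; apply/eqP; rewrite -subr_eq0; apply/eqP/nr0_eq0/eqP.
  have := hA (x - y); rewrite linBE// e subrr nr0.
  by rewrite pmulr_rle0// eq_le nr_ge0 andbT.
exists B; last by split=> // x; apply: inj; rewrite hB.
split=> [a x y|]; first by apply: inj; rewrite lA !hB.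
exists c^-1; first by rewrite invr_ge0 ltW.
by move=> x; rewrite mulrC ler_pdivlMr// mulrC -{2}(hB x).
Qed.

End Positive.
End Adjoints.

(** * Von Neumann algebras *)

Section OperatorAlgebras.
Variables (R : realType) (H : hilbertType R).
Local Notation C := R[i].
Local Notation re := (@complex.Re R).
Local Notation "x %:C" := (real_complex _ x) : ring_scope.
Implicit Types (N D S : set (H -> H)) (x y z d s : H -> H).

(* For a [*]-closed [N] this is [N'' = N]; it does not require [S] to be [*]-closed. *)
Definition vn_alg N :=
  (exists2 S, (forall y, S y -> bop y) & commutant S = N) /\
  forall x, N x -> N (adj x).

Lemma von_neumann_alg N : von_neumann N -> vn_alg N.
Proof.
case=> h1 h2 h3; split=> //; exists (commutant N) => // y [/bop_bounded//].
Qed.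

Section Algebra.
Variables (N : set (H -> H)) (hN : vn_alg N).

Lemma vn_bop x : N x -> bop x.
Proof. by case: hN => -[S hS <-] _ [/bop_bounded]. Qed.

Lemma vn_linear x : N x -> linear x. Proof. by case/vn_bop. Qed.

Lemma vn_adj x : N x -> N (adj x). Proof. by case: hN => _; apply. Qed.

Lemma vn_id : N id.
Proof. by case: hN => -[S hS <-] _; split; [apply/bop_bounded; exact: bop_id|]. Qed.

Lemma vn_lin (a : C) x y : N x -> N y -> N (a *: x + y).
Proof.
case: hN => -[S hS <-] _ [/bop_bounded bx hx] [/bop_bounded by_ hy].
split; first by apply/bop_bounded; exact: bop_lin.
move=> z Sz; have lz := (hS _ Sz).1; apply/funext => u /=.
rewrite !fctE lz; congr (_ *: _ + _).
- by have /(congr1 (@^~ u)) := hx _ Sz.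
- by have /(congr1 (@^~ u)) := hy _ Sz.
Qed.

Lemma vn_comp x y : N x -> N y -> N (x \o y).
Proof.
case: hN => -[S hS <-] _ [/bop_bounded bx hx] [/bop_bounded by_ hy].
split; first by apply/bop_bounded; exact: bop_comp.
by move=> z Sz; rewrite compA hx// -compA hy// compA.
Qed.

Lemma vn0 : N 0.
Proof. by have := vn_lin (-1) vn_id vn_id; rewrite scaleN1r addNr. Qed.

Lemma vn_lsub : lsub N. Proof. by split; [exact: vn0|exact: vn_lin]. Qed.

Lemma vnD x y : N x -> N y -> N (x + y). Proof. exact: lsubD vn_lsub. Qed.
Lemma vnB x y : N x -> N y -> N (x - y). Proof. exact: lsubB vn_lsub. Qed.
Lemma vnN x : N x -> N (- x). Proof. exact: lsubN vn_lsub. Qed.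
Lemma vnZ (a : C) x : N x -> N (a *: x). Proof. exact: lsubZ vn_lsub. Qed.
Lemma vn_sum (I : Type) (r : seq I) (Q : pred I) (F : I -> H -> H) :
  (forall i, Q i -> N (F i)) -> N (\sum_(i <- r | Q i) F i).
Proof. exact: lsub_sum vn_lsub. Qed.

Lemma vn_lim (T : Type) (F : set_system T) {FF : ProperFilter F} (f : T -> H -> H) x :
  bop x -> (\forall t \near F, N (f t)) ->
  (forall u, f t u @[t --> F] --> x u) -> N x.
Proof.
case: hN => -[S hS <-] _ bx Nf hf; split; first exact/bop_bounded.
move=> z Sz; apply/funext => u /=.
apply: (cvg_nr_uniq (bop_cvg (hS _ Sz) (hf u))).
apply: cvg_trans (hf (z u)); apply: near_eq_cvg; apply: filterS Nf => t [_ /(_ _ Sz)].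
by move=> /(congr1 (@^~ u)) /=.
Qed.

End Algebra.

Lemma qfD x y u : qf (x + y) u = qf x u + qf y u.
Proof. by rewrite /qf fctE dotpDl reD. Qed.
Lemma qfN x u : qf (- x) u = - qf x u.
Proof. by rewrite /qf fctE dotpNl reN. Qed.
Lemma qfB x y u : qf (x - y) u = qf x u - qf y u.
Proof. by rewrite qfD qfN. Qed.
Lemma qfZ (a : R) x u : qf (a%:C *: x) u = a * qf x u.
Proof. by rewrite /qf fctE dotpZl reM rereal imreal mul0r subr0. Qed.
Lemma qf_id u : qf (id : H -> H) u = nr u ^+ 2. Proof. exact: re_dotpxx. Qed.
Lemma qf0 u : qf (0 : H -> H) u = 0. Proof. by rewrite /qf (dotp0l u). Qed.

Lemma op_pos0 : op_pos (0 : H -> H). Proof. by move=> u; rewrite (dotp0l u). Qed.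
Lemma op_pos_id : op_pos (id : H -> H). Proof. by move=> u; exact: dotp_ge0. Qed.
Lemma op_posD x y : op_pos x -> op_pos y -> op_pos (x + y).
Proof. by move=> hx hy u; rewrite fctE dotpDl addr_ge0. Qed.
Lemma op_posZ (a : R) x : 0 <= a -> op_pos x -> op_pos (a%:C *: x).
Proof. by move=> a0 hx u; rewrite fctE dotpZl mulr_ge0// lecR. Qed.
Lemma op_pos_sqr x : bop x -> op_pos (adj x \o x).
Proof. by move=> bx u; rewrite /= adj_dotp'// dotp_ge0. Qed.
Lemma op_pos_conj x y : bop x -> op_pos y -> op_pos (adj x \o y \o x).
Proof. by move=> bx hy u; rewrite /= adj_dotp'. Qed.

Lemma op_le_refl x : op_le x x. Proof. by rewrite /op_le subrr; exact: op_pos0. Qed.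
Lemma op_le_trans x y z : op_le x y -> op_le y z -> op_le x z.
Proof. by move=> h1 h2; rewrite /op_le -[z - x](subrKA y); exact: op_posD. Qed.
Lemma op_le_qf x y u : op_le x y -> qf x u <= qf y u.
Proof. by move=> h; rewrite -subr_ge0 -qfB; exact: qf_ge0. Qed.
Lemma op_le0 x : op_le 0 x <-> op_pos x. Proof. by rewrite /op_le subr0. Qed.
Lemma op_le_pos x y : op_pos x -> op_le x y -> op_pos y.
Proof. by move=> hx; rewrite -[y in op_pos y](subrK x) => h; exact: op_posD. Qed.
Lemma qf_op_le x y : op_pos x -> op_pos y -> (forall u, qf x u <= qf y u) -> op_le x y.
Proof.
move=> hx hy h u; rewrite fctE dotpDl fctE dotpNl !op_posE// -rmorphB lecR subr_ge0//.
Qed.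
Lemma op_le_antisym x y : linear x -> linear y -> op_le x y -> op_le y x -> x = y.
Proof.
move=> lx ly h1 h2; apply: op_ext => // u; apply/eqP; rewrite eq_le.
have := h1 u; have := h2 u; rewrite !fctE !dotpDl !dotpNl !subr_ge0.
by move=> -> ->.
Qed.

Lemma bop_qf_bound x : bop x -> exists2 c : R, 0 <= c & forall u, qf x u <= c * nr u ^+ 2.
Proof.
move=> [_ [c c0 h]]; exists c => // u; apply: le_trans (re_le _) _.
by apply: le_trans (dotp_CS _ _) _; rewrite expr2 mulrA ler_wpM2r ?nr_ge0.
Qed.

(** The filter of upper sections, along which a directed set converges as a net indexed by
    itself. *)
Definition tail D := filter_from D (fun d0 => [set d | D d /\ op_le d0 d]).

Definition directed D := D !=set0 /\
  forall x y, D x -> D y -> exists z, [/\ D z, op_le x z & op_le y z].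

Lemma tail_proper D : directed D -> ProperFilter (tail D).
Proof.
move=> [[d0 Dd0] dirD]; apply: filter_from_proper; last first.
  by move=> d Dd; exists d; split=> //; exact: op_le_refl.
apply: filter_from_filter; first by exists d0.
move=> x y Dx Dy; have [z [Dz xz yz]] := dirD x y Dx Dy.
exists z => // d [Dd zd]; split; split=> //; exact: op_le_trans zd.
Qed.

Lemma tail_self D : directed D -> tail D D.
Proof. by move=> [[d Dd] _]; exists d => // d' []. Qed.

Lemma tail_ge D d : D d -> tail D [set d' | op_le d d'].
Proof. by move=> Dd; exists d => // d' []. Qed.

(** Vigier's theorem. By [pos_sqr] for [d' - d], the squared distance of [d u] and [d' u] is at most
    [c] times the increment of the bounded increasing net of numbers [qf d u]. *)
Lemma vigier D (c : R) : directed D -> (forall d, D d -> linear d /\ op_pos d) ->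
  0 <= c -> (forall d u, D d -> qf d u <= c * nr u ^+ 2) ->
  exists2 t, bop t & forall u, d u @[d --> tail D] --> t u.
Proof.
move=> dirD Dpos c0 hc; have FF := tail_proper dirD; have [[d0 Dd0] _] := dirD.
have diff d d' u : D d -> D d' -> op_le d d' ->
    nr (d' u - d u) ^+ 2 <= c * (qf d' u - qf d u).
  move=> Dd Dd' le; rewrite -qfB.
  have [ld pd] := Dpos _ Dd; have [ld' pd'] := Dpos _ Dd'.
  apply: (@pos_sqr R H (d' - d)) => //.
    by move=> a x y; rewrite !fctE ld ld' scalerDr scalerN opprD addrACA.
  by move=> y; rewrite qfB; have := qf_ge0 y pd; have := hc _ y Dd'; lra.
have cv u : exists l : H, d u @[d --> tail D] --> l.
  pose S := [set qf d u | d in D].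
  have S0 : has_sup S.
    split; first by exists (qf d0 u), d0.
    by exists (c * nr u ^+ 2) => _ [d Dd <-]; exact: hc.
  apply: cauchy_nr => e e0.
  have e1 : 0 < e ^+ 2 / (4 * (c + 1)) by rewrite divr_gt0 ?exprn_gt0//; lra.
  have [_ [d1 Dd1 <-] h1] := sup_adherent e1 S0.
  exists [set d | D d /\ op_le d1 d]; first by exists d1.
  have hd d : D d /\ op_le d1 d -> nr (d u - d1 u) < e / 2.
    move=> [Dd le]; rewrite -(@ltr_pXn2r _ 2) ?nnegrE ?nr_ge0//; last lra.
    apply: le_lt_trans (diff _ _ u Dd1 Dd le) _.
    have := ub_le_sup S0.2 (imageP (fun d => qf d u) Dd).
    rewrite -/S => h2.
    have : (qf d u - qf d1 u) * (4 * (c + 1)) < e ^+ 2.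
      by rewrite -ltr_pdivlMr; lra.
    have := op_le_qf u le; rewrite exprMn exprVn; nra.
  move=> d d' hdd hdd'; apply: le_lt_trans (nr_tri _ (d1 u) _) _.
  by rewrite (nrC (d1 u)); have := hd _ hdd; have := hd _ hdd'; lra.
have [t ht] := choice cv; exists t => //.
have bt u : nr (t u) <= (c + 1) * nr u.
  apply: (cvg_nr_le (ht u)); apply: filterS (tail_self dirD) => d Dd.
  have [ld pd] := Dpos _ Dd.
  have := pos_sqr u ld pd c0 (fun v : H => hc d v Dd).
  have := hc d u Dd; have := nr_ge0 u; have := nr_ge0 (d u) => a1 a2 a3 a4.
  rewrite -(@ler_pXn2r _ 2) ?nnegrE ?mulr_ge0//; last lra.
  have : nr (d u) ^+ 2 <= c * (c * nr u ^+ 2) by apply: le_trans a4 _; rewrite ler_wpM2l.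
  have := sqr_ge0 (nr u); nra.
split; last by exists (c + 1) => //; lra.
move=> a x y; apply: (cvg_nr_uniq (ht (a *: x + y))).
have h : a *: d x + d y @[d --> tail D] --> a *: t x + t y.
  by apply: cvgD; [apply: cvgZl_tmp|]; exact: ht.
apply: cvg_trans h; apply: near_eq_cvg; apply: filterS (tail_self dirD) => d Dd.
by rewrite (Dpos _ Dd).1.
Qed.

Lemma sot_op_pos (T : Type) (F : set_system T) {FF : ProperFilter F} (f : T -> H -> H) x :
  (forall u, f t u @[t --> F] --> x u) -> (\forall t \near F, op_pos (f t)) -> op_pos x.
Proof.
move=> hf pf u; apply: (cvg_ge0 (cvg_dotpl (y := u) (hf u))).
by apply: filterS pf => t; exact.
Qed.

Section Suprema.
Variables (N : set (H -> H)) (hN : vn_alg N).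

Lemma sot_increasing_sup D s : directed D -> D `<=` N `&` op_pos (H := H) ->
  N s -> (forall d, D d -> op_le d s) ->
  (forall u e, 0 < e -> exists2 d, D d & qf s u - e <= qf d u) ->
  increasing_sup N D s.
Proof.
move=> [D0 dirD] DN Ns ub ap; split=> // t Nt tub.
have [d0 Dd0] := D0; have [Nd0 pd0] := DN _ Dd0.
apply: qf_op_le; [exact: op_le_pos pd0 (ub _ Dd0)|exact: op_le_pos pd0 (tub _ Dd0)|].
move=> u; apply/ler_addgt0Pl => e e0; have [d Dd] := ap u e e0.
by have := op_le_qf u (tub _ Dd); lra.
Qed.

Lemma directed_sup D x : directed D -> D `<=` N `&` op_pos (H := H) -> bop x ->
  (forall d, D d -> op_le d x) ->
  exists2 s, increasing_sup N D s & (forall u, d u @[d --> tail D] --> s u) /\ op_le s x.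
Proof.
move=> dirD DN bx ub; have FF := tail_proper dirD.
have [c c0 hc] := bop_qf_bound bx.
have [|d u Dd|s bs hs] := vigier (c := c) dirD _ c0.
- by move=> d /DN[Nd pd]; split=> //; exact: vn_linear Nd.
- by apply: le_trans (hc u); exact: op_le_qf (ub _ Dd).
have dle d : D d -> op_le d s.
  move=> Dd; apply: (@sot_op_pos _ (tail D) _ (fun d' => d' - d)).
    by move=> u; rewrite fctE; apply: cvgB; [exact: hs|exact: cvg_cst].
  exact: tail_ge.
have Ns : N s.
  by apply: (vn_lim hN bs _ hs); apply: filterS (tail_self dirD) => d /DN[].
exists s.
  apply: sot_increasing_sup => // u e e0.
  have hqs : \forall d \near tail D, `|qf s u - qf d u| < e.
    by apply: cvg_re e0; apply: cvg_dotpl; exact: hs.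
  have [d [Dd hd]] := filter_ex (filterI (tail_self dirD) hqs).
  by exists d => //; move: hd; rewrite ltr_norml => /andP[]; lra.
split=> //; apply: (@sot_op_pos _ (tail D) _ (fun d' => x - d')).
  by move=> u; rewrite fctE; apply: cvgB; [exact: cvg_cst|exact: hs].
by apply: filterS (tail_self dirD) => d /ub.
Qed.

Lemma increasing_sup_directed D s : increasing_sup N D s -> directed D.
Proof. by case=> -[]. Qed.

(** The supremum within [N] is the strong limit, because that limit lies in [N]. This makes the
    order-theoretic notion of normality accessible to limits. *)
Lemma increasing_sup_sot D s : increasing_sup N D s ->
  forall u, d u @[d --> tail D] --> s u.
Proof.
move=> hs; have dirD := increasing_sup_directed hs.
case: (hs) => -[_ DN] _ [Ns ub] lub.
have [s' hs' [cs' le]] := directed_sup dirD DN (vn_bop hN Ns) ub.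
case: hs' => _ _ [Ns' ub'] _.
suff -> : s = s' by [].
apply: op_le_antisym (lub _ Ns' ub') le; exact: (vn_linear hN).
Qed.

Lemma increasing_sup_qf D s u (e : R) : increasing_sup N D s -> 0 < e ->
  exists2 d, D d & qf s u - e <= qf d u.
Proof.
move=> hs e0; have dirD := increasing_sup_directed hs; have FF := tail_proper dirD.
have hqs : \forall d \near tail D, `|qf s u - qf d u| < e.
  by apply: cvg_re e0; apply: cvg_dotpl; exact: increasing_sup_sot.
have [d [Dd hd]] := filter_ex (filterI (tail_self dirD) hqs).
by exists d => //; move: hd; rewrite ltr_norml => /andP[]; lra.
Qed.

End Suprema.
End OperatorAlgebras.

(** * Faithful normal states *)

Section States.
Variables (R : realType) (H : hilbertType R) (N : set (H -> H)) (nu : (H -> H) -> R[i]).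
Local Notation C := R[i].
Local Notation re := (@complex.Re R).
Local Notation "x %:C" := (real_complex _ x) : ring_scope.
Hypotheses (hN : vn_alg N) (hnu : faithful_normal_state N nu).
Implicit Types (x y z a c : H -> H).

Lemma stL (a : C) x y : N x -> N y -> nu (a *: x + y) = a * nu x + nu y.
Proof. by case: hnu => + _ _ _; apply. Qed.
Lemma st0 : nu 0 = 0.
Proof. by have := stL (-1) (vn0 hN) (vn0 hN); rewrite scaleN1r addNr mulN1r addNr. Qed.
Lemma stD x y : N x -> N y -> nu (x + y) = nu x + nu y.
Proof. by move=> *; rewrite -[x in LHS]scale1r stL// mul1r. Qed.
Lemma stZ (a : C) x : N x -> nu (a *: x) = a * nu x.
Proof. by move=> *; rewrite -[_ *: _]addr0 stL ?st0 ?addr0//; exact: vn0. Qed.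
Lemma stN x : N x -> nu (- x) = - nu x.
Proof. by move=> *; rewrite -scaleN1r stZ// mulN1r. Qed.
Lemma stB x y : N x -> N y -> nu (x - y) = nu x - nu y.
Proof. by move=> *; rewrite stD ?stN//; exact: vnN. Qed.
Lemma st_sum (I : Type) (r : seq I) (Q : pred I) (F : I -> H -> H) :
  (forall i, Q i -> N (F i)) -> nu (\sum_(i <- r | Q i) F i) = \sum_(i <- r | Q i) nu (F i).
Proof.
move=> hF; pose P x (r : C) := N x /\ nu x = r.
suff: P (\sum_(i <- r | Q i) F i) (\sum_(i <- r | Q i) nu (F i)) by case.
elim/big_ind2 : _ => [|x a y b [Nx <-] [Ny <-]|i Qi]; first by split; [exact: vn0|exact: st0].
- by split; [exact: vnD|rewrite stD].
- by split=> //; exact: hF.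
Qed.
Lemma st_ge0 x : N x -> op_pos x -> 0 <= nu x.
Proof. by case: hnu => _ [+ _] _ _; apply. Qed.
Lemma st_id : nu id = 1. Proof. by case: hnu => _ [_ ->]. Qed.
Lemma st_eq0 x : N x -> op_pos x -> nu x = 0 -> x = 0.
Proof. by case: hnu => _ _ + _; apply. Qed.
Lemma st_le x y : N x -> N y -> op_le x y -> nu x <= nu y.
Proof. by move=> Nx Ny /(st_ge0 (vnB hN Ny Nx)); rewrite stB// subr_ge0. Qed.
Lemma st_leR x y : N x -> N y -> op_le x y -> re (nu x) <= re (nu y).
Proof. by move=> Nx Ny h; have := st_le Nx Ny h; rewrite lecE => /andP[]. Qed.

Lemma st_sup D s (e : R) : increasing_sup N D s -> 0 < e ->
  exists2 d, D d & re (nu s) - e < re (nu d).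
Proof.
move=> hs e0; case: hnu => _ _ _ /(_ _ _ hs) [_ lub].
apply: contrapT => h; case: (hs) => -[[d0 Dd0] DN] _ [Ns ub] _.
have [Nd0 pd0] := DN _ Dd0.
have ps : op_pos s by exact: op_le_pos pd0 (ub _ Dd0).
have : nu s <= (re (nu s) - e)%:C.
  apply: lub => _ [d Dd <-]; have [Nd pd] := DN _ Dd.
  rewrite (cge0E (st_ge0 Nd pd)) lecR leNgt; apply/negP => h'.
  by apply: h; exists d.
by rewrite {1}(cge0E (st_ge0 Ns ps)) lecR; lra.
Qed.

Lemma vn_sqr x : N x -> N (adj x \o x).
Proof. by move=> Nx; apply: vn_comp => //; exact: vn_adj. Qed.

Lemma effect_sqr a : linear a -> op_pos a -> op_le a id -> forall u, nr (a u) ^+ 2 <= qf a u.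
Proof.
move=> la pa a1 u; rewrite -[qf a u]mul1r; apply: pos_sqr => // y.
by rewrite mul1r -qf_id; exact: op_le_qf.
Qed.

(** A chain is directed and bounded by [id], so it has a supremum in [N], which stays in [A] by
    hypothesis. *)
Lemma zorn_effects (A : set (H -> H)) :
  (forall a, A a -> [/\ N a, op_pos a & op_le a id]) -> A 0 ->
  (forall D s, D `<=` A -> increasing_sup N D s -> A s) ->
  exists2 a, A a & forall b, A b -> op_le a b -> b = a.
Proof.
move=> hA A0 cA.
pose T := {a : H -> H | A a}.
pose r (a b : T) := `[< op_le (sval a) (sval b) >].
have [||||t ht] := @Zorn T r.
- by move=> t; apply/asboolP; exact: op_le_refl.
- by move=> a b c /asboolP h1 /asboolP h2; apply/asboolP; exact: op_le_trans h2.
- move=> [a Aa] [b Ab] /asboolP/= h1 /asboolP/= h2; apply: eq_exist.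
  have [Na _ _] := hA _ Aa; have [Nb _ _] := hA _ Ab.
  exact: op_le_antisym (vn_linear hN Na) (vn_linear hN Nb) h1 h2.
- move=> B tB; have [[b0 Bb0]|B0] := pselect (exists b, B b); last first.
    by exists (exist _ _ A0) => s Bs; case: B0; exists s.
  pose D := [set sval b | b in B].
  have DA : D `<=` A by move=> _ [[a Aa] _ <-].
  have dirD : directed D.
    split; first by exists (sval b0), b0.
    move=> _ _ [a Ba <-] [b Bb <-]; have [/asboolP h|/asboolP h] := tB _ _ Ba Bb.
      by exists (sval b); split=> //; [exists b|exact: op_le_refl].
    by exists (sval a); split=> //; [exists a|exact: op_le_refl].
  have DN : D `<=` N `&` op_pos (H := H) by move=> d /DA/hA[].
  have [d /DA/hA[] //|s hs _] := directed_sup hN dirD DN (bop_id H).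
  exists (exist _ s (cA _ _ DA hs)) => b Bb; apply/asboolP => /=.
  by case: hs => _ _ [_ ub] _; apply: ub; exists b.
exists (sval t); first by case: t ht.
move=> b Ab h; have := ht (exist _ b Ab) => /(_ _)/(congr1 sval) <- //.
exact/asboolP.
Qed.

(** The functional [y |-> nu (c y c)] lies below the vector functional of [eta]; this is what makes
    [y eta |-> La (y c)] well defined and bounded. *)
Definition dominated c (eta : H) :=
  forall y, N y -> op_pos y -> re (nu (c \o y \o c)) <= qf y eta.

Lemma qf_lin_bound x : bop x -> op_pos x -> exists2 r : R, 0 < r & op_le x (r%:C *: id).
Proof.
move=> bx px; have [r r0 hr] := bop_qf_bound bx; exists (r + 1); first lra.
apply: qf_op_le => //; first by apply: op_posZ; [lra|exact: op_pos_id].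
by move=> u; rewrite qfZ qf_id; have := hr u; have := sqr_ge0 (nr u); nra.
Qed.

(** Take [xi] with [nu e < <e xi, xi>] and a maximal [a <= e] at which the vector functional of [xi]
    is at most [nu]. Then [c = e - a] is non-zero and, by maximality, [nu x <= <x xi, xi>] for every
    positive [x <= c]. Suitable multiples of [c y c] are such [x], so [eta = c xi] works. *)
Lemma exists_dominated e : N e -> op_pos e -> op_le e id -> e <> 0 ->
  exists c eta, [/\ N c, op_pos c, op_le c e, c <> 0 & dominated c eta].
Proof.
move=> Ne pe e1 e0.
have [xi hxi] : exists xi, re (nu e) < qf e xi.
  have [u hu] : exists u, 0 < qf e u.
    apply: contrapT => h; apply: e0.
    apply: op_ext; [exact: vn_linear Ne|exact: vn_linear (vn0 hN)|] => u.
    rewrite op_posE//; apply: complex_eq => //=; last by rewrite (dotp0l u).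
    rewrite (dotp0l u); apply/eqP; rewrite eq_le qf_ge0// andbT leNgt.
    by apply/negP => h'; apply: h; exists u.
  have /cge0P[ne0 _] := st_ge0 Ne pe.
  (* As [s >= 1], the form at [s u] is at least [s * qf e u], which exceeds [nu e]. *)
  pose s := (re (nu e) + 1) / qf e u + 1.
  have q0 : qf e u != 0 by rewrite gt_eqF.
  have s1 : 1 <= s by rewrite lerDr divr_ge0 ?ltW//; lra.
  exists (s%:C *: u); rewrite /qf linZE ?dotpZl ?dotpZr; last exact: vn_linear Ne.
  have -> : (s%:C)^* = s%:C :> C by apply: complex_eq; rewrite !reimE ?oppr0.
  rewrite !reimE !mul0r !subr0 -/(qf e u).
  have -> : s * qf e u = re (nu e) + 1 + qf e u by rewrite /s mulrDl mul1r mulfVK.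
  have := hu; nra.
pose A : set (H -> H) := [set a | [/\ N a, op_pos a, op_le a e & qf a xi <= re (nu a)]].
have [|||a [Na pa ae qa] amax] := zorn_effects (A := A).
- by move=> a [Na pa ae _]; split=> //; exact: op_le_trans e1.
- by split; [exact: vn0|exact: op_pos0|exact/op_le0|rewrite qf0 st0].
- move=> D s DA hs; case: (hs) => -[[d0 Dd0] DN] _ [Ns ub] lub.
  have [Nd0 pd0] := DN _ Dd0.
  split=> //; [exact: op_le_pos pd0 (ub _ Dd0)|by apply: lub => // d /DA[]|].
  apply/ler_addgt0Pl => ep ep0; have [d Dd hd] := increasing_sup_qf hN xi hs ep0.
  have [Nd _ _ h] := DA _ Dd; have := st_leR Nd Ns (ub _ Dd); lra.
have Nc : N (e - a) by exact: vnB.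
have c0 : e - a <> 0.
  by move=> /eqP; rewrite subr_eq0 => /eqP ea; move: hxi; rewrite ea; lra.
have ce : op_le (e - a) e by rewrite /op_le opprB addrC subrK.
have lc := vn_linear hN Nc.
exists (e - a), ((e - a) xi); split=> // y Ny py.
set c := e - a in Nc c0 ce lc ae *.
have key x : N x -> op_pos x -> op_le x c -> re (nu x) <= qf x xi.
  move=> Nx px xc; rewrite leNgt; apply/negP => h.
  have : A (a + x).
    split; [exact: vnD|exact: op_posD| |by rewrite qfD stD// reD; lra].
    by rewrite /op_le opprD addrA.
  move=> /amax h'; have : a + x = a by apply: h'; rewrite /op_le addrC addKr.
  by move=> /eqP; rewrite -subr_eq0 addrC addKr => /eqP x0; move: h; rewrite x0 qf0 st0 ltxx.
have [r r0 yr] := qf_lin_bound (vn_bop hN Ny) py.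
have bc := vn_bop hN Nc; have ac : adj c = c by exact: pos_adj.
have Ncyc : N (c \o y \o c) by do 2 apply: (vn_comp hN) => //.
have pcyc : op_pos (c \o y \o c) by rewrite -{1}ac; exact: op_pos_conj.
have qcyc u : qf (c \o y \o c) u = qf y (c u) by rewrite /qf /= pos_sym.
have rC : 0 <= r^-1 by rewrite invr_ge0 ltW.
(* From [y <= r] and [c <= 1] one gets [c y c <= r c^2 <= r c]. *)
have h : op_le (r^-1%:C *: (c \o y \o c)) c.
  apply: qf_op_le => //; first exact: op_posZ.
  move=> u; rewrite qfZ qcyc mulrC ler_pdivrMr// mulrC.
  have := op_le_qf (c u) yr; rewrite qfZ qf_id.
  have := effect_sqr lc ae (op_le_trans ce e1) u; nra.
have := key _ (vnZ hN _ Ncyc) (op_posZ rC pcyc) h.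
rewrite stZ// reM rereal imreal mul0r subr0 qfZ ler_pM2l ?invr_gt0//.
by rewrite qcyc.
Qed.

End States.

(** * The standard representation *)

Section GNS.
Variables (R : realType) (H : hilbertType R) (N : set (H -> H)) (nu : (H -> H) -> R[i]).
Local Notation C := R[i].
Local Notation re := (@complex.Re R).
Local Notation "x %:C" := (real_complex _ x) : ring_scope.
Hypotheses (hN : vn_alg N) (hnu : faithful_normal_state N nu).
Variables (K : hilbertType R) (La : (H -> H) -> K) (hLa : is_L2 N nu La).
Implicit Types (x y z a c : H -> H).

Let LaL (a : C) x y : N x -> N y -> La (a *: x + y) = a *: La x + La y.
Proof. by case: hLa => + _ _; apply. Qed.
Lemma L2_lin (a : C) x y : N x -> N y -> La (a *: x + y) = a *: La x + La y.
Proof. exact: LaL. Qed.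
Lemma L2_0 : La 0 = 0.
Proof. by have := LaL (-1) (vn0 hN) (vn0 hN); rewrite scaleN1r addNr scaleN1r addNr. Qed.
Lemma L2D x y : N x -> N y -> La (x + y) = La x + La y.
Proof. by move=> *; rewrite -[x in LHS]scale1r LaL// scale1r. Qed.
Lemma L2Z (a : C) x : N x -> La (a *: x) = a *: La x.
Proof. by move=> *; rewrite -[_ *: _ in LHS]addr0 LaL ?L2_0 ?addr0//; exact: vn0. Qed.
Lemma L2N x : N x -> La (- x) = - La x.
Proof. by move=> *; rewrite -scaleN1r L2Z// scaleN1r. Qed.
Lemma L2B x y : N x -> N y -> La (x - y) = La x - La y.
Proof. by move=> *; rewrite L2D ?L2N//; exact: vnN. Qed.

Lemma L2_dotp x y : N x -> N y -> dotp (La x) (La y) = nu (adj y \o x).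
Proof. by case: hLa => _ + _; apply. Qed.

Lemma L2_sqr x : N x -> nr (La x) ^+ 2 = re (nu (adj x \o x)).
Proof. by move=> Nx; rewrite -re_dotpxx L2_dotp. Qed.

Lemma L2_dense k : adh (La @` N) k.
Proof. by case: hLa => _ _ /dense_adh; apply. Qed.

Lemma L2_norm2 x : N x -> norm2 nu x = (nr (La x))%:C.
Proof.
move=> Nx; rewrite /norm2 -L2_dotp// dotpxx rmorphXn/= sqrCK// lecR nr_ge0//.
Qed.

Lemma L2_comp x y z : N x -> N y -> N z ->
  dotp (La (x \o y)) (La z) = dotp (La y) (La (adj x \o z)).
Proof.
move=> Nx Ny Nz; have Nx' := vn_adj hN Nx.
rewrite !L2_dotp//; try exact: (vn_comp hN).
by rewrite adj_comp ?adjK//; exact: (vn_bop hN).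
Qed.

Lemma L2_comp_bound x y (r : R) : N x -> N y -> 0 <= r -> (forall u, nr (x u) <= r * nr u) ->
  nr (La (x \o y)) <= r * nr (La y).
Proof.
move=> Nx Ny r0 hr; have Nxy := vn_comp hN Nx Ny.
have [bx by_ bxy] := And3 (vn_bop hN Nx) (vn_bop hN Ny) (vn_bop hN Nxy).
rewrite -(@ler_pXn2r _ 2) ?nnegrE ?mulr_ge0 ?nr_ge0// exprMn !L2_sqr//.
have r2 : 0 <= r ^+ 2 by exact: sqr_ge0.
have Nyy := vn_sqr hN Ny.
have -> : r ^+ 2 * re (nu (adj y \o y)) = re (nu ((r ^+ 2)%:C *: (adj y \o y))).
  by rewrite (stZ hN hnu)// reM rereal imreal mul0r subr0.
apply: (st_leR hN hnu); [exact: vn_sqr|exact: vnZ|].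
apply: qf_op_le; [exact: op_pos_sqr|by apply: op_posZ => //; exact: op_pos_sqr|].
move=> u; rewrite qfZ /qf /= !adj_dotp'// !re_dotpxx /= -exprMn.
by rewrite ler_pXn2r ?nnegrE ?mulr_ge0 ?nr_ge0.
Qed.

Lemma L2_eq0 x : N x -> La x = 0 -> x = 0.
Proof.
move=> Nx h; have bx := vn_bop hN Nx.
have h0 : adj x \o x = 0.
  apply: (st_eq0 hnu); [exact: vn_sqr|exact: op_pos_sqr|].
  by rewrite -L2_dotp// h dotp0l.
apply/funext => u; apply: nr0_eq0; apply/eqP; rewrite -sqrf_eq0 -re_dotpxx.
by rewrite -adj_dotp'// -[adj x (x u)]/((adj x \o x) u) h0 (dotp0l u).
Qed.

Lemma L2_inj x y : N x -> N y -> La x = La y -> x = y.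
Proof.
move=> Nx Ny h; apply/eqP; rewrite -subr_eq0; apply/eqP; apply: L2_eq0; first exact: vnB.
by rewrite L2B// h subrr.
Qed.

Lemma L2_id x : N x -> nu x = dotp (La x) (La id).
Proof. by move=> Nx; rewrite L2_dotp// ?adj_id//; exact: vn_id. Qed.

Lemma L2_effect a : N a -> op_pos a -> op_le a id -> nr (La a) ^+ 2 <= re (nu a).
Proof.
move=> Na pa a1; have la := vn_linear hN Na; rewrite L2_sqr//.
apply: (st_leR hN hnu) => //; first exact: vn_sqr.
apply: qf_op_le => //; first by apply: op_pos_sqr; exact: vn_bop Na.
move=> u; rewrite {1}/qf /= adj_dotp'; last exact: vn_bop Na.
by rewrite re_dotpxx; exact: effect_sqr.
Qed.

(** Commutation with the left actions, tested on the dense image of [La] and thus stated without the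
    representation of [N] on [K]. *)
Definition intertwiner (T : K -> H) :=
  bop T /\ forall x y, N x -> N y -> T (La (x \o y)) = x (T (La y)).

(** [T] is the adjoint of [x eta |-> La (x c)], bounded by domination. Both sides of the
    intertwining relation lie in the closure of [N eta], so it is enough to compare them against the
    vectors [z eta]. *)
Lemma dominated_intertwiner c eta : N c -> op_pos c -> dominated N nu c eta ->
  exists2 T, intertwiner T & forall x k, N x -> dotp (x eta) (T k) = dotp (La (x \o c)) k.
Proof.
move=> Nc pc dc; have ac : adj c = c by apply: pos_adj => //; exact: vn_linear Nc.
have iL (a : C) x y : N x -> N y -> (a *: x + y) eta = a *: x eta + y eta by [].
have gL (a : C) x y : N x -> N y -> La ((a *: x + y) \o c) = a *: La (x \o c) + La (y \o c).
  move=> Nx Ny; rewrite -LaL//; exact: (vn_comp hN).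
have hb x : N x -> nr (La (x \o c)) <= 1 * nr (x eta).
  move=> Nx; have bx := vn_bop hN Nx; rewrite mul1r -(@ler_pXn2r _ 2) ?nnegrE ?nr_ge0//.
  rewrite L2_sqr; last exact: vn_comp.
  rewrite adj_comp ?ac//; last exact: vn_bop Nc.
  have := dc _ (vn_sqr hN Nx) (op_pos_sqr bx).
  by rewrite {1}/qf /= adj_dotp'// re_dotpxx.
have [T [lT bT aT hT]] := riesz_op (vn_lsub hN) iL gL hb ler01.
exists T; last by move=> x k Nx; rewrite hT.
split; first by split=> //; exists 1.
move=> x y Nx Ny; have bx := vn_bop hN Nx; have Nx' := vn_adj hN Nx.
apply: (adh_image_uniq (vn_lsub hN) iL) => //.
  move=> e e0; have [_ [r r0 hr]] := bx.
  have e1 : 0 < e / (r + 1) by rewrite divr_gt0//; lra.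
  have [_ [z Nz <-] hz] := aT (La y) _ e1.
  exists (x (z eta)); first by exists (x \o z) => //; exact: vn_comp.
  rewrite -linBE; last exact: bx.1.
  apply: le_lt_trans (hr _) _; move: hz; rewrite ltr_pdivlMr; last lra.
  by have := nr_ge0 (T (La y) - z eta); nra.
move=> z Nz; rewrite -hT// -(adj_dotp' _ _ bx).
rewrite -[adj x (z eta)]/((adj x \o z) eta) -hT; last exact: vn_comp.
by rewrite dotpC L2_comp//; [rewrite -dotpC|exact: vn_comp].
Qed.

(** Exhaustion: take a maximal effect [a] such that [k] is orthogonal to [La (N a)]. If [a] were not
    [id], [exists_dominated] would give [c <= id - a] with an intertwiner [T]; then [T k = 0] says
    that [k] is orthogonal to [La (N c)], and [a + c] contradicts maximality. Hence [k] is
    orthogonal to all of [La N]. *)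
Lemma intertwiner_kernel k : (forall T, intertwiner T -> T k = 0) -> k = 0.
Proof.
move=> hk.
pose A : set (H -> H) := [set a | [/\ N a, op_pos a, op_le a id &
  forall x, N x -> dotp (La (x \o a)) k = 0]].
have [|||a [Na pa a1 ka] amax] := zorn_effects hN (A := A).
- by move=> a [].
- split; [exact: vn0|exact: op_pos0|exact/op_le0/op_pos_id|move=> x Nx].
  rewrite (_ : x \o 0 = 0) ?L2_0 ?dotp0l//.
  by apply/funext => u /=; exact: lin0 (vn_linear hN Nx).
(* Closure under suprema rests on normality of [nu]: [|La (s - d)|^2 <= nu (s - d)] becomes
   arbitrarily small. *)
- move=> D s DA hs; case: (hs) => -[[d0 Dd0] DN] _ [Ns ub] lub.
  have [Nd0 pd0] := DN _ Dd0; have ps := op_le_pos pd0 (ub _ Dd0).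
  have s1 : op_le s id by apply: lub; [exact: vn_id|move=> d /DA[]].
  split=> // x Nx; apply: nr_le_eq0 => e e0.
  have [r r0 hr] := (vn_bop hN Nx).2.
  have kr0 : 0 < r * nr k + 1 by have := mulr_ge0 r0 (nr_ge0 k); lra.
  have e1 : 0 < (e / (r * nr k + 1)) ^+ 2 by rewrite exprn_gt0// divr_gt0.
  have [d Dd hd] := st_sup hnu hs e1.
  have [Nd pd d1 hdk] := DA _ Dd; have Nsd : N (s - d) by exact: vnB.
  have sd1 : op_le (s - d) id.
    by rewrite /op_le opprB addrCA addrC; apply: op_posD.
  have h := L2_effect Nsd (ub _ Dd) sd1.
  have h2 : nr (La (s - d)) < e / (r * nr k + 1).
    rewrite -(@ltr_pXn2r _ 2) ?nnegrE ?nr_ge0 ?divr_ge0 ?ltW//.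
    by apply: le_lt_trans h _; rewrite (stB hN hnu)// reD reN; lra.
  have -> : dotp (La (x \o s)) k = dotp (La (x \o (s - d))) k.
    rewrite (_ : x \o (s - d) = (x \o s) - (x \o d)); last first.
      by apply/funext => u; rewrite /= !fctE (linBE _ _ (vn_linear hN Nx)).
    rewrite L2B; [|exact: vn_comp|exact: vn_comp].
    by rewrite dotpBl hdk// subr0.
  apply: le_trans (dotp_CS _ _) _.
  have := L2_comp_bound Nx Nsd r0 hr.
  move: h2; rewrite ltr_pdivlMr// => h2 h3.
  have := nr_ge0 (La (s - d)); have := nr_ge0 k; have := nr_ge0 (La (x \o (s - d))).
  nra.
have ida : a = id.
  apply: contrapT => na; have Ne : N (id - a) by apply: vnB => //; exact: vn_id.
  have ne0 : id - a <> 0.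
    by move=> /eqP; rewrite subr_eq0 => /eqP e; apply: na.
  have e1 : op_le (id - a) id by rewrite /op_le opprB addrC subrK.
  have [c [eta [Nc pc ce c0 dc]]] := exists_dominated hN hnu Ne a1 e1 ne0.
  have [T iT hT] := dominated_intertwiner Nc pc dc.
  have : A (a + c).
    split; [exact: vnD|exact: op_posD|by rewrite /op_le opprD addrA|move=> x Nx].
    rewrite (_ : x \o (a + c) = (x \o a) + (x \o c)); last first.
      by apply/funext => u; rewrite /= !fctE (linDE _ _ (vn_linear hN Nx)).
    rewrite L2D; [|exact: vn_comp|exact: vn_comp].
    by rewrite dotpDl ka// -hT// hk// dotp0r addr0.
  move=> /amax h'; have : a + c = a by apply: h'; rewrite /op_le addrC addKr.
  by move=> /eqP; rewrite -subr_eq0 addrC addKr => /eqP.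
have : dotp k k = 0.
  apply: (adh_dotp0 (L2_dense k)) => _ [x Nx <-].
  by rewrite -[x]/(x \o id) -ida ka.
by move/(congr1 re); rewrite re_dotpxx/= => /eqP; rewrite sqrf_eq0 => /eqP/nr0_eq0.
Qed.

(** The projection [B] onto the closure of these vectors commutes with the set whose commutant is
    [N], hence lies in [N]. Every intertwiner [T] maps [La (id - B)] to [(id - B) (T (La id)) = 0],
    so [id - B = 0] by [intertwiner_kernel] and faithfulness. *)
Lemma intertwiner_dense xi :
  adh [set v | exists2 T, intertwiner T & v = T (La id)] xi.
Proof.
set D := [set v | _].
have hD : lsub D.
  split; first by exists (fun=> 0) => //; split; [exact: bop0|move=> x y Nx Ny; rewrite lin0//; exact: vn_linear Nx].
  move=> a _ _ [S [bS iS] ->] [T [bT iT] ->]; exists (a *: S + T) => //.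
  split; first exact: bop_lin.
  by move=> x y Nx Ny; rewrite !fctE iS// iT// (vn_linear hN Nx).
have iL (a : C) (u v : H) : D u -> D v -> id (a *: u + v) = a *: id u + id v by [].
have hb (v : H) : D v -> nr (id v) <= 1 * nr (id v) by rewrite mul1r.
have [B [lB bB aB hB]] := riesz_op hD iL iL hb ler01.
rewrite image_id in aB.
have Bv v : D v -> B v = v.
  move=> Dv; apply: (adh_image_uniq hD iL); rewrite ?image_id//; first exact: adh_sub.
  by move=> u Du; rewrite -hB.
have NB : N B.
  have [[S hS SN] _] := hN.
  have bB' : bop B by split=> //; exists 1.
  rewrite -SN; split; first exact/bop_bounded.
  move=> y Sy; have by_ := hS _ Sy; have [y' by' yy'] := bop_has_adjoint by_.
  have yc x : N x -> y \o x = x \o y by rewrite -SN => -[_ /(_ _ Sy)].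
  (* As [N] is closed under adjoints, [y'] commutes with [N] too. So [D] is invariant under [y] and
     under its adjoint, which makes the projection commute with [y]. *)
  have yc' x : N x -> y' \o x = x \o y'.
    move=> Nx; have bx := vn_bop hN Nx.
    have := yc _ (vn_adj hN Nx) => h.
    apply: (bop_unique_adj (A := y \o adj x)) => u v /=.
      by rewrite -[y (adj x u)]/((y \o adj x) u) h /= adj_dotp'// yy'.
    by rewrite yy' adj_dotp'.
  have Dinv z : bop z -> (forall x, N x -> z \o x = x \o z) -> forall v, D v -> D (z v).
    move=> bz zc _ [T [bT iT] ->]; exists (z \o T) => //; split; first exact: bop_comp.
    move=> u v Nu Nv; rewrite /= iT//.
    by rewrite -[z (u _)]/((z \o u) _) zc.
  apply/funext => z /=.
  apply: (adh_image_uniq hD iL); rewrite ?image_id//.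
    move=> e e0; have [_ [r r0 hr]] := by_.
    have e1 : 0 < e / (r + 1) by rewrite divr_gt0//; lra.
    have [v Dv hv] := aB z _ e1; exists (y v); first exact: Dinv.
    rewrite -linBE; last exact: by_.1.
    apply: le_lt_trans (hr _) _; move: hv; rewrite ltr_pdivlMr; last lra.
    by have := nr_ge0 (B z - v); nra.
  have yy'' u w : dotp (y' w) u = dotp w (y u) by rewrite dotpC -yy' -dotpC.
  by move=> v Dv; rewrite -hB// -!yy'' -hB//; exact: Dinv.
have Np : N (id - B) by apply: vnB => //; exact: vn_id.
have p0 : id - B = 0.
  apply: L2_eq0 => //; apply: intertwiner_kernel => T iT.
  rewrite -[id - B]/((id - B) \o id) iT.2//; last exact: vn_id.
  by rewrite !fctE Bv ?subrr//; exists T.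
have -> : xi = B xi.
  by have /(congr1 (@^~ xi)) /eqP := p0; rewrite !fctE subr_eq0 => /eqP.
exact: aB.
Qed.

(* The unit ball of [N] is complete for the [L2]-norm, which there dominates the
   strong operator topology. *)
Lemma L2_ball_complete (T : Type) (F : set_system T) {FF : ProperFilter F}
    (f : T -> H -> H) (r : R) (k : K) : 0 <= r ->
  (forall t, N (f t)) -> (forall t u, nr (f t u) <= r * nr u) ->
  La (f t) @[t --> F] --> k ->
  exists x, [/\ N x, La x = k & forall u, f t u @[t --> F] --> x u].
Proof.
move=> r0 Nf hr fk.
(* At the dense set of vectors [S (La id)] one has [f t (S (La id)) = S (La (f t))], which
   converges; the uniform bound [r] extends convergence to all of [H]. *)
have cvD S : intertwiner S -> f t (S (La id)) @[t --> F] --> S k.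
  move=> [bS iS]; apply: cvg_trans (bop_cvg bS fk).
  apply: near_eq_cvg; apply: filterE => t /=.
  by rewrite -iS//; exact: vn_id.
have [x hx] : exists x : H -> H, forall u, f t u @[t --> F] --> x u.
  suff cv u : exists l : H, f t u @[t --> F] --> l.
    by have [x hx] := choice cv; exists x.
  apply: cauchy_nr => e e0.
  have e1 : 0 < e / (4 * (r + 1)) by rewrite divr_gt0//; lra.
  have [_ [S iS ->] huv] := intertwiner_dense u e1.
  set v := S (La id) in huv.
  have e2 : 0 < e / 4 by rewrite divr_gt0.
  exists [set t | nr (S k - f t v) < e / 4]; first exact: cvg_nr (cvD _ iS) e2.
  have hh t : nr (f t u - f t v) <= e / 4.
    rewrite -linBE; last exact: vn_linear (Nf t).
    apply: le_trans (hr _ _) _; move: huv; rewrite ltr_pdivlMr; last lra.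
    have := nr_ge0 (u - v); nra.
  move=> s t hs ht.
  apply: le_lt_trans (nr_tri _ (f s v) _) _.
  have h3 := nr_tri (f s v) (S k) (f t u).
  have h4 := nr_tri (S k) (f t v) (f t u).
  have := hh s; have := hh t; rewrite (nrC (f t u)) => h1 h2.
  rewrite (nrC _ (S k)) in h3.
  by move: hs ht => /=; lra.
have bx : bop x.
  split; last first.
    exists r => // u; apply: (cvg_nr_le (hx u)).
    by apply: filterE => t; exact: hr.
  move=> a u v; apply: (cvg_nr_uniq (hx (a *: u + v))).
  have h : a *: f t u + f t v @[t --> F] --> a *: x u + x v.
    by apply: cvgD; [apply: cvgZl_tmp|]; exact: hx.
  apply: cvg_trans h; apply: near_eq_cvg; apply: filterE => t.
  by rewrite (vn_linear hN (Nf t)).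
have Nx : N x by apply: (vn_lim hN bx _ hx); exact: filterE.
exists x; split=> //; apply/eqP; rewrite eq_sym -subr_eq0; apply/eqP.
(* Every intertwiner sends both [La x] and [k] to the limit of [f t (S (La id))]. *)
apply: intertwiner_kernel => S iS; rewrite linBE; last exact: iS.1.1.
rewrite -[X in La X]/(x \o id) iS.2//; last exact: vn_id.
by rewrite (cvg_nr_uniq (cvD _ iS) (hx _)) subrr.
Qed.

End GNS.

(** * Hilbert direct sums *)

Section FiniteSums.
Variables (I : choiceType).

(** Unordered summation: limits are taken along the finite subsets, directed by inclusion. *)
Definition fin_filter : set_system {fset I} :=
  filter_from setT (fun A : {fset I} => [set F : {fset I} | {subset A <= F}]).

Lemma fin_filter_proper : ProperFilter fin_filter.
Proof.
apply: filter_from_proper; last by move=> A _; exists A.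
apply: filter_from_filter; first by exists fset0.
move=> A B _ _; exists (A `|` B)%fset => // F h; split=> x xA; apply: h;
  by rewrite inE xA ?orbT.
Qed.

Lemma fin_filter_ge (A : {fset I}) : fin_filter [set F : {fset I} | {subset A <= F}].
Proof. by exists A. Qed.

Lemma sum_fsetD (V : nmodType) (A B : {fset I}) (F : I -> V) : {subset A <= B} ->
  \sum_(i <- B) F i = \sum_(i <- A) F i + \sum_(i <- (B `\` A)%fset) F i.
Proof.
move=> AB; rewrite (big_fsetID _ (mem A))/=; congr (_ + _); apply: eq_fbigl => i.
  by rewrite !inE/= andb_idl// => /AB.
by rewrite !inE/= andbC.
Qed.

Lemma sum_delta (V : nmodType) (A : {fset I}) (F : I -> V) j :
  \sum_(i <- A) (if i == j then F i else 0) = if j \in A then F j else 0.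
Proof.
case: ifP => jA; last first.
  by apply: big1_fset => i iA _; case: eqP => // ij; rewrite -ij iA in jA.
rewrite (big_fsetD1 j jA)/= eqxx big1_fset ?addr0// => i.
by rewrite !inE => /andP[/negPf -> _].
Qed.

Lemma ler_sum_fset (R : realType) (A B : {fset I}) (F : I -> R) : {subset A <= B} ->
  (forall i, 0 <= F i) -> \sum_(i <- A) F i <= \sum_(i <- B) F i.
Proof. by move=> AB F0; rewrite (sum_fsetD _ AB) lerDl sumr_ge0. Qed.

Lemma sum_fset_cvg (R : realType) (b : I -> R) (B : R) : (forall i, 0 <= b i) ->
  (forall A : {fset I}, \sum_(i <- A) b i <= B) ->
  exists2 s : R, (forall A : {fset I}, \sum_(i <- A) b i <= s) &
    forall e, 0 < e -> exists2 A : {fset I}, s - e < \sum_(i <- A) b i &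
      forall A' : {fset I}, (forall i, i \in A' -> i \notin A) -> \sum_(i <- A') b i < e.
Proof.
move=> b0 hB; pose S := [set \sum_(i <- A) b i | A in [set: {fset I}]].
have S0 : has_sup S.
  by split; [exists (\sum_(i <- fset0) b i), fset0|exists B => _ [A _ <-]].
have ub (A : {fset I}) : \sum_(i <- A) b i <= sup S by apply: (ub_le_sup S0.2); exists A.
exists (sup S) => // e e0; have [_ [A _ <-] hA] := sup_adherent e0 S0.
exists A => // A' hA'; have := ub (A `|` A')%fset.
rewrite (@sum_fsetD _ A); last by move=> i iA; rewrite inE iA.
suff -> : \sum_(i <- ((A `|` A') `\` A)%fset) b i = \sum_(i <- A') b i by lra.
apply: eq_fbigl => i; rewrite !inE; case: (boolP (i \in A)) => //= iA.
by apply/esym/negP => /hA'; rewrite iA.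
Qed.

(** Sums over finite sets disjoint from a large one are small, being controlled by the tails of the
    summable family [b]. *)
Lemma summable_cvg (R : realType) (K : hilbertType R) (u : I -> K) (b : I -> R) (B c : R) :
  (forall i, 0 <= b i) -> (forall A : {fset I}, \sum_(i <- A) b i <= B) -> 0 <= c ->
  (forall A : {fset I}, nr (\sum_(i <- A) u i) ^+ 2 <= c * \sum_(i <- A) b i) ->
  exists l : K, (fun A : {fset I} => \sum_(i <- A) u i) @ fin_filter --> l.
Proof.
move=> b0 hB c0 hu; have FF := fin_filter_proper.
have [s _ hs] := sum_fset_cvg b0 hB.
apply: cauchy_nr => e e0.
have e1 : 0 < e ^+ 2 / (4 * (c + 1)) by rewrite divr_gt0 ?exprn_gt0//; lra.
have [A0 _ hA0] := hs _ e1.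
have hh (A : {fset I}) : {subset A0 <= A} ->
    nr (\sum_(i <- A) u i - \sum_(i <- A0) u i) < e / 2.
  move=> AA0; rewrite (sum_fsetD _ AA0) addrC addKr.
  rewrite -(@ltr_pXn2r _ 2) ?nnegrE ?nr_ge0//; last lra.
  apply: le_lt_trans (hu _) _.
  have := hA0 (A `\` A0)%fset; rewrite ltr_pdivlMr; last lra.
  set w := \sum_(i <- _) _; have w0 : 0 <= w by exact: sumr_ge0.
  have hA : forall i, i \in (A `\` A0)%fset -> i \notin A0 by move=> i; rewrite inE => /andP[].
  move=> /(_ hA); rewrite exprMn exprVn; nra.
exists [set A : {fset I} | {subset A0 <= A}]; first exact: fin_filter_ge.
move=> A A' h h'; apply: le_lt_trans (nr_tri _ (\sum_(i <- A0) u i) _) _.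
by rewrite (nrC (\sum_(i <- A0) _)); have := hh _ h; have := hh _ h'; lra.
Qed.

End FiniteSums.

Section HilbertSum.
Variables (R : realType) (I : choiceType) (H L : hilbertType R) (delta : I -> H -> L).
Local Notation C := R[i].
Local Notation re := (@complex.Re R).
Local Notation "x %:C" := (real_complex _ x) : ring_scope.

(** [is_l2] over an arbitrary index set, so that it also covers finite matrices and the space
    [l2(G, L2(M))]. *)
Definition hilbert_sum :=
  [/\ forall g, linear (delta g),
      forall g h xi eta,
        dotp (delta g xi) (delta h eta) = if g == h then dotp xi eta else 0
    & dense [set v | exists n (g : 'I_n -> I) (xi : 'I_n -> H),
                       v = \sum_(i < n) delta (g i) (xi i)]].

Hypothesis hd : hilbert_sum.
Implicit Types (g h : I) (xi eta : H) (u v : L) (A F : {fset I}).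

Lemma hs_lin g : linear (delta g). Proof. by case: hd. Qed.
Lemma hs_dotp g h xi eta :
  dotp (delta g xi) (delta h eta) = if g == h then dotp xi eta else 0.
Proof. by case: hd. Qed.

Lemma hs_nr g xi : nr (delta g xi) = nr xi.
Proof.
by apply/eqP; rewrite -(@eqrXn2 _ 2) ?nr_ge0// -!re_dotpxx hs_dotp eqxx.
Qed.

Lemma hs_bop g : bop (delta g).
Proof. by split; [exact: hs_lin|exists 1 => // x; rewrite hs_nr mul1r]. Qed.

Definition coord g : L -> H :=
  xget (fun=> 0) [set B | bop B /\ forall x y, dotp (delta g x) y = dotp x (B y)].

Lemma coordP g : bop (coord g) /\ forall x y, dotp (delta g x) y = dotp x (coord g y).
Proof.
apply: (@xgetPex _ (fun=> 0) [set B | bop B /\ forall x y, dotp (delta g x) y = dotp x (B y)]).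
by have [B bB hB] := bop_has_adjoint (hs_bop g); exists B.
Qed.

Lemma coord_bop g : bop (coord g). Proof. by case: (coordP g). Qed.
Lemma coord_lin g : linear (coord g). Proof. by case: (coord_bop g). Qed.
Lemma coord_dotpr g x y : dotp (delta g x) y = dotp x (coord g y).
Proof. by case: (coordP g). Qed.
Lemma coord_dotpl g x y : dotp y (delta g x) = dotp (coord g y) x.
Proof. by rewrite dotpC coord_dotpr -dotpC. Qed.

Lemma coord_delta g h xi : coord g (delta h xi) = if g == h then xi else 0.
Proof.
apply: dotp_inj => z; rewrite -coord_dotpl hs_dotp eq_sym.
by case: ifP => // _; rewrite dotp0l.
Qed.

Definition trunc F v : L := \sum_(g <- F) delta g (coord g v).

Lemma hs_sum_dotp F (x y : I -> H) :
  dotp (\sum_(g <- F) delta g (x g)) (\sum_(g <- F) delta g (y g)) =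
  \sum_(g <- F) dotp (x g) (y g).
Proof.
rewrite dotp_suml big_seq [RHS]big_seq; apply: eq_bigr => g gF.
rewrite dotp_sumr; transitivity (\sum_(h <- F) (if h == g then dotp (x g) (y h) else 0)).
  by apply: eq_bigr => h _; rewrite hs_dotp eq_sym.
by rewrite sum_delta gF.
Qed.

Lemma hs_sum_nr F (x : I -> H) :
  nr (\sum_(g <- F) delta g (x g)) ^+ 2 = \sum_(g <- F) nr (x g) ^+ 2.
Proof.
rewrite -re_dotpxx hs_sum_dotp re_sum; apply: eq_bigr => g _; exact: re_dotpxx.
Qed.

Lemma coord_trunc F g v : coord g (trunc F v) = if g \in F then coord g v else 0.
Proof.
rewrite /trunc lin_sum; last exact: coord_lin.
rewrite -(sum_delta F (fun h => coord h v)); apply: eq_bigr => h _.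
by rewrite coord_delta eq_sym; case: eqP => [->|].
Qed.

Lemma trunc_dotp F u v : dotp (trunc F u) v = \sum_(g <- F) dotp (coord g u) (coord g v).
Proof. by rewrite dotp_suml; apply: eq_bigr => g _; rewrite coord_dotpr. Qed.

Lemma trunc_nr F v : nr (trunc F v) ^+ 2 = \sum_(g <- F) nr (coord g v) ^+ 2.
Proof. exact: hs_sum_nr. Qed.

Lemma trunc_le F v : nr (trunc F v) <= nr v.
Proof.
have [->|h0] := eqVneq (nr (trunc F v)) 0; first exact: nr_ge0.
have h1 : 0 < nr (trunc F v) by rewrite lt_def h0 nr_ge0.
rewrite -(ler_pM2l h1) -expr2.
have -> : nr (trunc F v) ^+ 2 = re (dotp (trunc F v) v).
  rewrite trunc_dotp re_sum trunc_nr; apply: eq_bigr => g _.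
  by rewrite re_dotpxx.
exact: le_trans (re_le _) (dotp_CS _ _).
Qed.

Lemma bessel F v : \sum_(g <- F) nr (coord g v) ^+ 2 <= nr v ^+ 2.
Proof. by rewrite -trunc_nr ler_pXn2r ?nnegrE ?nr_ge0// trunc_le. Qed.

Lemma trunc_lin F : linear (trunc F).
Proof.
move=> a u v; rewrite /trunc scaler_sumr -big_split/=; apply: eq_bigr => g _.
by rewrite coord_lin hs_lin.
Qed.

Lemma trunc_cvg v : trunc F v @[F --> @fin_filter I] --> v.
Proof.
have FF := fin_filter_proper I.
apply/cvg_nrP => e e0.
have [_ _ /dense_adh /(_ v) dv] := hd; have e2 : 0 < e / 2 by rewrite divr_gt0.
have [w [n [g [xi wE]]] hw] := dv _ e2.
apply: filterS (fin_filter_ge [fset g i | i : 'I_n]%fset) => F hF.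
have -> : v - trunc F v = (v - w) - trunc F (v - w).
  rewrite (linBE _ _ (trunc_lin F)); suff -> : trunc F w = w by rewrite opprB addrA subrK.
  rewrite wE (lin_sum _ _ _ (trunc_lin F)); apply: eq_bigr => i _.
  rewrite /trunc; have gF : g i \in F by apply: hF; apply/imfsetP; exists i.
  under eq_bigr do rewrite coord_delta.
  rewrite (eq_bigr (fun h => if h == g i then delta h (xi i) else 0)) ?sum_delta ?gF//.
  by move=> h _; case: ifP => // _; exact: lin0 (hs_lin h).
by apply: le_lt_trans (nrB _ _) _; have := trunc_le F (v - w); lra.
Qed.

Lemma parseval u v : (fun F : {fset I} => \sum_(g <- F) dotp (coord g u) (coord g v)) @ @fin_filter I
  --> (dotp u v : C^o).
Proof.
have FF := fin_filter_proper I.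
have -> : (fun F : {fset I} => \sum_(g <- F) dotp (coord g u) (coord g v)) =
    (fun F => dotp (trunc F u) v) by apply/funext => F; rewrite trunc_dotp.
by apply: cvg_dotpl; exact: trunc_cvg.
Qed.

Lemma coord_inj u v : (forall g, coord g u = coord g v) -> u = v.
Proof.
move=> h; have FF := fin_filter_proper I; apply: (cvg_nr_uniq (trunc_cvg (v := u))).
have -> : trunc^~ u = trunc^~ v by apply/funext => F; apply: eq_bigr => g _; rewrite h.
exact: trunc_cvg.
Qed.

Lemma nr_le_trunc v (c : R) : (forall F, nr (trunc F v) <= c) -> nr v <= c.
Proof.
move=> h; have FF := fin_filter_proper I.
by apply: (cvg_nr_le (trunc_cvg (v := v))); exact: filterE.
Qed.

Lemma hs_synth (x : I -> H) (B : R) : (forall F, \sum_(g <- F) nr (x g) ^+ 2 <= B) ->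
  exists v, forall g, coord g v = x g.
Proof.
move=> hB; have FF := fin_filter_proper I.
have [||v hv] := @summable_cvg I R L (fun g => delta g (x g)) _ B 1 _ hB ler01.
- by move=> g; exact: sqr_ge0.
- by move=> F; rewrite hs_sum_nr mul1r.
exists v => g; apply: (cvg_nr_uniq (bop_cvg (coord_bop g) hv)).
apply: cvg_near_cst; apply: filterS (fin_filter_ge [fset g]%fset) => F hF.
have gF : g \in F by apply: hF; rewrite inE.
rewrite lin_sum; last exact: coord_lin.
rewrite (eq_bigr (fun h => if h == g then x h else 0)) ?sum_delta ?gF//.
by move=> h _; rewrite coord_delta eq_sym.
Qed.

Lemma hs_operator (K : hilbertType R) (T : I -> H -> K) (c : R) : 0 <= c ->
  (forall g, linear (T g)) ->
  (forall F (x : I -> H), nr (\sum_(g <- F) T g (x g)) ^+ 2 <= c ^+ 2 * \sum_(g <- F) nr (x g) ^+ 2) ->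
  exists A : L -> K, [/\ linear A, forall v, nr (A v) <= c * nr v &
    forall g xi, A (delta g xi) = T g xi].
Proof.
move=> c0 lT hT; have FF := fin_filter_proper I.
have cv v : exists l : K, (fun F : {fset I} => \sum_(g <- F) T g (coord g v)) @ @fin_filter I --> l.
  apply: (@summable_cvg I R K _ (fun g => nr (coord g v) ^+ 2) (nr v ^+ 2) (c ^+ 2)).
  - by move=> g; exact: sqr_ge0.
  - by move=> F; exact: bessel.
  - exact: sqr_ge0.
  - by move=> F; exact: hT.
have [A hA] := choice cv; exists A; split.
- move=> a u v; apply: (cvg_nr_uniq (hA (a *: u + v))).
  have h : (fun F : {fset I} => a *: (\sum_(g <- F) T g (coord g u)) + \sum_(g <- F) T g (coord g v))
      @ @fin_filter I --> a *: A u + A v.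
    by apply: cvgD; [apply: cvgZl_tmp|]; exact: hA.
  apply: cvg_trans h; apply: near_eq_cvg; apply: filterE => F.
  rewrite scaler_sumr -big_split/=; apply: eq_bigr => g _.
  by rewrite coord_lin lT.
- move=> v; apply: (cvg_nr_le (hA v)); apply: filterE => F.
  rewrite -(@ler_pXn2r _ 2) ?nnegrE ?mulr_ge0 ?nr_ge0// exprMn.
  apply: le_trans (hT F (coord^~ v)) _; rewrite ler_wpM2l ?sqr_ge0//; exact: bessel.
- move=> g xi; apply: (cvg_nr_uniq (hA (delta g xi))).
  apply: cvg_near_cst; apply: filterS (fin_filter_ge [fset g]%fset) => F hF.
  have gF : g \in F by apply: hF; rewrite inE.
  rewrite (eq_bigr (fun h => if h == g then T h xi else 0)) ?sum_delta ?gF//.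
  by move=> h _; rewrite coord_delta; case: ifP => // _; exact: lin0 (lT h).
Qed.

Lemma hs_bop_ext (K : hilbertType R) (A B : L -> K) : bop A -> bop B ->
  (forall g xi, A (delta g xi) = B (delta g xi)) -> A = B.
Proof.
move=> bA bB h; have [_ _ /dense_adh dd] := hd.
apply: (bop_ext bA bB dd) => _ [n [g [xi ->]]].
rewrite (lin_sum _ _ _ bA.1) (lin_sum _ _ _ bB.1).
by apply: eq_bigr => i _; exact: h.
Qed.

End HilbertSum.

(** * The Hilbert space of square-summable families *)

Section SquareSummable.
Variables (R : realType) (I : choiceType) (K : hilbertType R).
Local Notation C := R[i].
Local Notation re := (@complex.Re R).
Local Notation "x %:C" := (real_complex _ x) : ring_scope.
Implicit Types (f h : I -> K) (F : {fset I}).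

Let B F f h : C := \sum_(i <- F) dotp (f i) (h i).

Let B_sesq F : sesq [set: I -> K] (B F).
Proof.
split=> a x y z _ _ _; rewrite /B big_distrr -big_split/=; apply: eq_bigr => i _.
  by rewrite !fctE dotpPl.
by rewrite !fctE dotpDr dotpZr.
Qed.

Let re_B F f : re (B F f f) = \sum_(i <- F) nr (f i) ^+ 2.
Proof. by rewrite re_sum; apply: eq_bigr => i _; exact: re_dotpxx. Qed.

Let B_ge0 F f : 0 <= B F f f.
Proof. by apply: sumr_ge0 => i _; exact: dotp_ge0. Qed.

Let n2 F f : R := \sum_(i <- F) nr (f i) ^+ 2.

Let n2_ge0 F f : 0 <= n2 F f. Proof. by apply: sumr_ge0 => i _; exact: sqr_ge0. Qed.

Let n2D F f h : Num.sqrt (n2 F (f + h)) <= Num.sqrt (n2 F f) + Num.sqrt (n2 F h).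
Proof.
rewrite -(@ler_pXn2r _ 2) ?nnegrE ?addr_ge0 ?sqrtr_ge0// sqr_sqrtr// sqrrD !sqr_sqrtr//.
rewrite /n2 -!re_B (sesqDl (B_sesq F))// !(sesqDr (B_sesq F))//.
rewrite (sesq_herm (lsubT _) (B_sesq F) (fun u _ => B_ge0 F u) (x := f) (y := h))//.
rewrite !reD re_conj.
have : re (B F f h) <= Num.sqrt (re (B F f f)) * Num.sqrt (re (B F h h)).
  apply: le_trans (re_le _) _.
  rewrite -(@ler_pXn2r _ 2) ?nnegrE ?nr_ge0 ?mulr_ge0 ?sqrtr_ge0//.
  rewrite exprMn !sqr_sqrtr ?re_B ?n2_ge0// -!re_B.
  by apply: (cauchy_schwarz (lsubT _) (B_sesq F)) => // u _; exact: B_ge0.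
lra.
Qed.

Let n2Z F (a : C) f : n2 F (a *: f) = nr a ^+ 2 * n2 F f.
Proof. by rewrite /n2 mulr_sumr; apply: eq_bigr => i _; rewrite !fctE nrZ exprMn. Qed.

Definition sq_summable : {pred (I -> K)} :=
  fun f => `[< exists c : R, forall F, \sum_(i <- F) nr (f i) ^+ 2 <= c >].

Lemma sq_summableP f :
  reflect (exists c : R, forall F, \sum_(i <- F) nr (f i) ^+ 2 <= c) (f \in sq_summable).
Proof. exact: asboolP. Qed.

Fact sq_summable_closed : submod_closed sq_summable.
Proof.
split; first by apply/sq_summableP; exists 0 => F; rewrite big1// => i _; rewrite nr0 expr0n.
move=> a f h /sq_summableP[c hc] /sq_summableP[d hd]; apply/sq_summableP.
exists ((nr a * Num.sqrt c + Num.sqrt d) ^+ 2) => F.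
rewrite -/(n2 F (a *: f + h)) -[leLHS]sqr_sqrtr ?n2_ge0//.
rewrite ler_pXn2r ?nnegrE ?sqrtr_ge0 ?addr_ge0 ?mulr_ge0 ?nr_ge0 ?sqrtr_ge0//.
apply: le_trans (n2D _ _ _) _; apply: lerD; last first.
  by rewrite ler_sqrt; [exact: hd|exact: le_trans (n2_ge0 F h) (hd F)].
rewrite n2Z sqrtrM ?sqr_ge0// sqrtr_sqr ger0_norm ?nr_ge0// ler_wpM2l ?nr_ge0//.
by rewrite ler_sqrt; [exact: hc|exact: le_trans (n2_ge0 F f) (hc F)].
Qed.

HB.instance Definition _ :=
  GRing.isSubmodClosed.Build C (I -> K) sq_summable sq_summable_closed.

Record l2 := L2Fun { l2_fun :> I -> K; _ : l2_fun \in sq_summable }.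
HB.instance Definition _ := [isSub for l2_fun].
HB.instance Definition _ := [Choice of l2 by <:].
HB.instance Definition _ := [SubChoice_isSubLmodule of l2 by <:].

Implicit Types (u v w : l2).

Lemma l2P u : exists c : R, forall F, n2 F u <= c.
Proof. exact/sq_summableP/(valP u). Qed.

Definition l2_sup u : R := sup [set n2 F u | F in [set: {fset I}]].

Let sup_has u : has_sup [set n2 F u | F in [set: {fset I}]].
Proof.
have [c hc] := l2P u; split; first by exists (n2 fset0 u), fset0.
by exists c => _ [F _ <-].
Qed.

Lemma l2_sup_ub F u : n2 F u <= l2_sup u.
Proof. by apply: (ub_le_sup (sup_has u).2); exists F. Qed.

Lemma l2_sup_le u c : (forall F, n2 F u <= c) -> l2_sup u <= c.
Proof. by move=> h; apply: ge_sup; [case: (sup_has u)|move=> _ [F _ <-]]. Qed.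

Lemma l2_sup_ge0 u : 0 <= l2_sup u.
Proof. exact: le_trans (n2_ge0 fset0 u) (l2_sup_ub _ _). Qed.

Definition l2_nr u : R := Num.sqrt (l2_sup u).

Lemma l2_nr_le u c : 0 <= c -> (forall F, n2 F u <= c ^+ 2) -> l2_nr u <= c.
Proof.
move=> c0 h; rewrite /l2_nr -(ger0_norm c0) -sqrtr_sqr ler_sqrt ?sqr_ge0//.
exact: l2_sup_le.
Qed.

Lemma l2_nr_ub F u : Num.sqrt (n2 F u) <= l2_nr u.
Proof. by rewrite ler_sqrt ?l2_sup_ge0// l2_sup_ub. Qed.

Lemma l2_nr_coord i u : nr (u i) <= l2_nr u.
Proof.
apply: le_trans (l2_nr_ub [fset i]%fset u).
by rewrite /n2 big_seq_fset1 sqrtr_sqr ger0_norm ?nr_ge0.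
Qed.

Definition l2_norm u : C := (l2_nr u)%:C.

Fact l2_normD u v : l2_norm (u + v) <= l2_norm u + l2_norm v.
Proof.
rewrite -rmorphD lecR; apply: l2_nr_le; first by rewrite addr_ge0 ?sqrtr_ge0.
move=> F; rewrite -[leLHS]sqr_sqrtr ?n2_ge0// ler_pXn2r ?nnegrE ?addr_ge0 ?sqrtr_ge0//.
by apply: le_trans (n2D F u v) _; apply: lerD; exact: l2_nr_ub.
Qed.

Fact l2_normZ (a : C) u : l2_norm (a *: u) = `|a| * l2_norm u.
Proof.
rewrite nrE -rmorphM; congr (_%:C).
have le (b : C) w : l2_nr (b *: w) <= nr b * l2_nr w.
  apply: l2_nr_le; first by rewrite mulr_ge0 ?nr_ge0 ?sqrtr_ge0.
  move=> F; rewrite (n2Z F b w) exprMn ler_wpM2l ?sqr_ge0// sqr_sqrtr ?l2_sup_ge0//.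
  exact: l2_sup_ub.
apply/eqP; rewrite eq_le le/=.
have [->|a0] := eqVneq a 0; first by rewrite nr0 mul0r sqrtr_ge0.
have na : 0 < nr a by rewrite lt_def nr_ge0 andbT; apply: contra a0 => /eqP/nr0_eq0/eqP.
have := le a^-1 (a *: u); rewrite scalerA mulVf// scale1r.
have -> : nr a^-1 = (nr a)^-1.
  by apply: (mulfI (lt0r_neq0 na)); rewrite divff ?gt_eqF// -nrM divff// nr_real normr1.
by rewrite mulrC ler_pdivlMr// mulrC.
Qed.

Fact l2_norm_eq0 u : l2_norm u = 0 -> u = 0.
Proof.
move=> /complexI h; apply/val_inj/funext => i; apply: nr0_eq0.
by apply/eqP; rewrite eq_le nr_ge0 -[leRHS]h l2_nr_coord.
Qed.

HB.instance Definition _ := @Lmodule_isNormed.Build C l2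
  l2_norm l2_normD l2_normZ l2_norm_eq0.

Lemma nr_l2 u : nr u = l2_nr u. Proof. by []. Qed.

Fact l2_complete (F : set_system l2) : ProperFilter F -> cauchy F -> cvg F.
Proof.
move=> FF /cauchy_ballP cF.
have cauF (e : R) : 0 < e -> exists2 A, F A & forall u v, A u -> A v -> l2_nr (u - v) < e.
  move=> e0; have [|[A B'] [/= FA FB] h] := cF e%:C; first by rewrite ltcR.
  exists (A `&` B'); first exact: filterI.
  move=> u v [Au _] [_ Bv]; have := h (u, v) (conj Au Bv).
  by rewrite -ball_normE /= nrE ltcR.
have cv i : exists l : K, (fun u : l2 => u i) @ F --> l.
  apply: cauchy_nr => e /cauF[A FA hA]; exists A => // u v Au Av.
  exact: le_lt_trans (l2_nr_coord i (u - v)) (hA _ _ Au Av).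
have [f hf] := choice cv.
(* On a finite set [G] of coordinates the bound passes to the pointwise limit [f]; its uniformity in
   [G] yields both summability of [f] and convergence in norm. *)
have tail_le (A : set l2) (e : R) u G : F A -> (forall v w, A v -> A w -> l2_nr (v - w) < e) ->
    A u -> n2 G (val u - f) <= e ^+ 2.
  move=> FA hA Au.
  have e0 : 0 <= e by apply: ltW; have := hA _ _ Au Au; apply: le_lt_trans; exact: sqrtr_ge0.
  have hG : (fun v : l2 => \sum_(i <- G) dotp (u i - v i) (u i - v i)) @ F -->
      ((\sum_(i <- G) dotp (u i - f i) (u i - f i) : C) : C^o).
    apply: cvgC_sum => i.
    by apply: cvg_dotp; (apply: cvgB; [exact: cvg_cst|exact: hf]).
  apply/ler_addgt0Pl => d d0.
  have [v [Av hv]] := filter_ex (filterI FA (cvg_re hG d0)).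
  have h1 : n2 G (val u - val v) <= e ^+ 2.
    rewrite -[leLHS]sqr_sqrtr ?n2_ge0// ler_pXn2r ?nnegrE ?sqrtr_ge0//.
    by apply: le_trans (ltW (hA _ _ Au Av)); exact: (l2_nr_ub G (u - v)).
  move: hv; have -> : re (\sum_(i <- G) dotp (u i - f i) (u i - f i)) = n2 G (val u - f).
    exact: (re_B G (val u - f)).
  have -> : re (\sum_(i <- G) dotp (u i - v i) (u i - v i)) = n2 G (val u - val v).
    exact: (re_B G (val u - val v)).
  by rewrite ltr_norml => /andP[]; lra.
have fS : f \in sq_summable.
  have [A FA hA] := cauF 1 ltr01; have [u Au] := filter_ex FA.
  have uf : (val u - f) \in sq_summable.
    by apply/sq_summableP; exists (1 ^+ 2) => G; exact: tail_le hA Au.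
  by rewrite -[f](subKr (val u)) rpredB// (valP u).
apply/cvg_ex; exists (L2Fun fS); apply/cvg_nrP => e e0.
have e2 : 0 < e / 2 by rewrite divr_gt0.
have [A FA hA] := cauF _ e2; apply: (filterS _ FA) => u Au.
rewrite nrC nr_l2; apply: (@le_lt_trans _ _ (e / 2)); last lra.
by apply: l2_nr_le; [exact: ltW|move=> G; exact: (tail_le A) hA Au].
Qed.

HB.instance Definition _ := Uniform_isComplete.Build l2 l2_complete.

(** Polarisation of the squared norm, so that no limit enters the definition; [l2_dotp_cvg] then
    identifies it with the sum of the coordinatewise inner products, from which its properties
    follow. *)
Definition l2_dotp u v : C :=
  4^-1 * ((l2_sup (u + v))%:C - (l2_sup (u - v))%:C
    + iu R * ((l2_sup (u + iu R *: v))%:C - (l2_sup (u - iu R *: v))%:C)).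

Let sup_cvg u : (fun F => B F u u) @ @fin_filter I --> ((l2_sup u)%:C : C^o).
Proof.
have FF := fin_filter_proper I; apply/cvgC_nrP => e e0.
have [_ [A _ <-] hA] := sup_adherent e0 (sup_has u).
apply: filterS (fin_filter_ge A) => F AF.
rewrite (cge0E (B_ge0 F u)) re_B -rmorphB nr_real.
rewrite ger0_norm ?subr_ge0; last exact: l2_sup_ub.
have := @ler_sum_fset I R A F (fun i => nr (u i) ^+ 2) AF (fun i => sqr_ge0 _).
by rewrite /n2 in hA; rewrite /l2_sup; lra.
Qed.

Lemma l2_dotp_cvg u v : (fun F : {fset I} => \sum_(i <- F) dotp (u i) (v i)) @ @fin_filter I
  --> (l2_dotp u v : C^o).
Proof.
have FF := fin_filter_proper I.
have -> : (fun F : {fset I} => \sum_(i <- F) dotp (u i) (v i)) = fun F =>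
    4^-1 * (B F (u + v) (u + v) - B F (u - v) (u - v)
    + iu R * (B F (u + iu R *: v) (u + iu R *: v) - B F (u - iu R *: v) (u - iu R *: v))).
  apply/funext => F; rewrite -(polarization (lsubT _) (B_sesq F) (x := u) (y := v))//.
  by rewrite mulKf// pnatr_eq0.
apply: cvgCM; apply: cvgCD; first by apply: cvgCB; exact: sup_cvg.
by apply: cvgCM; apply: cvgCB; exact: sup_cvg.
Qed.
Arguments l2_dotp_cvg : clear implicits.

Fact l2_dotpPl (a : C) u v w : l2_dotp (a *: u + v) w = a * l2_dotp u w + l2_dotp v w.
Proof.
have FF := fin_filter_proper I.
apply: (cvgC_uniq (l2_dotp_cvg (a *: u + v) w)).
have -> : (fun F : {fset I} => \sum_(i <- F) dotp ((a *: u + v : l2) i) (w i)) =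
   fun F : {fset I} => a * \sum_(i <- F) dotp (u i) (w i) + \sum_(i <- F) dotp (v i) (w i).
  apply/funext => F; rewrite mulr_sumr -big_split/=; apply: eq_bigr => i _.
  exact: dotpPl.
by apply: cvgCD; [apply: cvgCM|]; exact: l2_dotp_cvg.
Qed.

Fact l2_dotpC u v : l2_dotp v u = (l2_dotp u v)^*.
Proof.
have FF := fin_filter_proper I.
apply: (cvgC_uniq (l2_dotp_cvg v u)); apply/cvgC_nrP => e e0.
apply: filterS (cvgC_nr (l2_dotp_cvg u v) e0) => F.
rewrite -nr_conj rmorphB rmorph_sum/=.
by under [X in nr (_ - X) < _ -> _]eq_bigr do rewrite -dotpC.
Qed.

Fact l2_dotpE u : l2_dotp u u = `|u| ^+ 2.
Proof.
have FF := fin_filter_proper I.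
apply: (cvgC_uniq (l2_dotp_cvg u u)).
suff -> : `|u| ^+ 2 = (l2_sup u)%:C by exact: sup_cvg.
by rewrite nrE -rmorphXn nr_l2 sqr_sqrtr// l2_sup_ge0.
Qed.

HB.instance Definition _ :=
  CompleteNormedModule_isHilbert.Build R l2 l2_dotpPl l2_dotpC l2_dotpE.

Definition l2_single (j : I) (x : K) : I -> K := fun i => if i == j then x else 0.

Fact l2_single_summable j x : l2_single j x \in sq_summable.
Proof.
apply/sq_summableP; exists (nr x ^+ 2) => F.
rewrite (eq_bigr (fun i => if i == j then nr x ^+ 2 else 0)).
  by rewrite sum_delta; case: ifP => // _; exact: sqr_ge0.
by move=> i _; rewrite /l2_single; case: ifP => // _; rewrite nr0 expr0n.
Qed.

Definition l2_delta j x : l2 := L2Fun (l2_single_summable j x).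

Lemma l2_hilbert_sum : hilbert_sum (L := l2) l2_delta.
Proof.
have FF := fin_filter_proper I.
split.
- move=> j a x y; apply/val_inj/funext => i /=; rewrite /l2_single.
  by rewrite !fctE /= /l2_single; case: ifP => //; rewrite scaler0 addr0.
- move=> g h x y; apply: (cvgC_uniq (l2_dotp_cvg _ _)); apply/cvgC_nrP => e e0.
  apply: filterS (fin_filter_ge [fset g]%fset) => F hF.
  have gF : g \in F by apply: hF; rewrite inE.
  rewrite (eq_bigr (fun i => if i == g then (if i == h then dotp x y else 0) else 0)).
    by rewrite sum_delta gF subrr nr0.
  move=> i _; rewrite /= /l2_single.
  by case: (i == g); case: (i == h); rewrite ?dotp0l ?dotp0r.
- apply/dense_adh => u e e0.
  have e1 : 0 < (e / 2) ^+ 2 by rewrite exprn_gt0// divr_gt0.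
  have [_ [A _ <-] hA] := sup_adherent e1 (sup_has u).
  pose w : l2 := \sum_(i <- A) l2_delta i (u i).
  have wE i : w i = if i \in A then u i else 0.
    rewrite -(sum_delta A (fun j => u j)).
    have -> : w i = \sum_(j <- A) l2_delta j (u j) i.
      by rewrite /w; elim/big_rec2 : _ => // j y1 y2 _ <-.
    by apply: eq_bigr => j _; rewrite /= /l2_single eq_sym.
  exists w.
    exists (size (enum_fset A)), (fun k => tnth (in_tuple (enum_fset A)) k).
    exists (fun k => u (tnth (in_tuple (enum_fset A)) k)).
    by rewrite /w big_tnth.
  apply: (@le_lt_trans _ _ (e / 2)); last lra.
  rewrite nr_l2; apply: l2_nr_le; first by rewrite ltW// divr_gt0.
  move=> F; have h := l2_sup_ub (A `|` F)%fset u.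
  rewrite /n2 (@sum_fsetD _ _ A) in h; last by move=> i iA; rewrite inE iA.
  have h2 : n2 F (val (u - w)) <= \sum_(i <- ((A `|` F) `\` A)%fset) nr (u i) ^+ 2.
    have -> : n2 F (val (u - w)) = \sum_(i <- F) (if i \in A then 0 else nr (u i) ^+ 2).
      apply: eq_bigr => i _; have -> : val (u - w) i = u i - w i by [].
      by rewrite wE; case: ifP => _; rewrite ?subr0// subrr nr0 expr0n.
    rewrite (big_fsetID _ (mem A))/= big1_fset ?add0r; last first.
      by move=> i; rewrite !inE => /andP[_ ->].
    rewrite le_eqVlt; apply/orP; left; apply/eqP; apply: eq_fbig => [i|i].
      by rewrite !inE; case: (i \in A); rewrite ?andbF ?andbT.
    by rewrite !inE => /andP[_ /negPf ->].
  apply: le_trans h2 _; move: hA; rewrite -/(l2_sup u) /n2; lra.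
Qed.

End SquareSummable.

(** * Completely positive maps *)

Section MatrixPositivity.
Variables (R : realType) (H : hilbertType R).
Local Notation C := R[i].
Local Notation re := (@complex.Re R).
Local Notation "x %:C" := (real_complex _ x) : ring_scope.

(** General finite index types, because blocks are later indexed by pairs of a matrix index and a
    group element. *)
Definition mpos (T : finType) (x : T -> T -> H -> H) : Prop :=
  forall xi : T -> H, 0 <= \sum_i \sum_j dotp (x i j (xi j)) (xi i).

Lemma matrix_posE n (x : 'I_n -> 'I_n -> H -> H) : matrix_pos x <-> mpos x.
Proof.
have e (xi : 'I_n -> H) : \sum_(i < n) dotp (\sum_(j < n) x i j (xi j)) (xi i) =
    \sum_i \sum_j dotp (x i j (xi j)) (xi i).
  by apply: eq_bigr => i _; rewrite dotp_suml.
by split=> h xi; [rewrite -e|rewrite e].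
Qed.

Lemma mpos_reindex (S T : finType) (f : S -> T) (x : T -> T -> H -> H) :
  bijective f -> mpos (fun i j => x (f i) (f j)) -> mpos x.
Proof.
move=> [f' fK f'K] h xi; have := h (xi \o f); congr (_ <= _).
rewrite [RHS](reindex f) /=; last by exists f' => ? _; [exact: fK|exact: f'K].
apply: eq_bigr => i _; rewrite [RHS](reindex f) //=.
by exists f' => ? _; [exact: fK|exact: f'K].
Qed.

Lemma cp_mpos (N : set (H -> H)) psi (T : finType) (x : T -> T -> H -> H) :
  completely_positive N psi -> (forall i j, N (x i j)) -> mpos x ->
  mpos (fun i j => psi (x i j)).
Proof.
move=> cp Nx px; have b : bijective (@enum_val T xpredT).
  by exists enum_rank; [exact: enum_valK|exact: enum_rankK].
apply: (mpos_reindex b); apply/matrix_posE; apply: cp => [i j|]; first exact: Nx.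
apply/matrix_posE; apply: (mpos_reindex (f := enum_rank)).
  by exists enum_val; [exact: enum_rankK|exact: enum_valK].
move=> xi; have := px xi; congr (_ <= _).
by apply: eq_bigr => i _; apply: eq_bigr => j _; rewrite !enum_rankK.
Qed.

(** Normality is treated separately: [ucp_normal] restores it for state-preserving maps. *)
Definition ucp (N : set (H -> H)) (psi : (H -> H) -> (H -> H)) :=
  [/\ forall x, N x -> N (psi x), linear_on N psi, psi id = id & completely_positive N psi].

Lemma normal_ucp_ucp N psi : normal_ucp N psi -> ucp N psi.
Proof. by case. Qed.

Section Ucp.
Variables (N : set (H -> H)) (hN : vn_alg N).
Variables (psi : (H -> H) -> (H -> H)) (hpsi : ucp N psi).
Implicit Types x y : H -> H.

Lemma ucp_in x : N x -> N (psi x). Proof. by case: hpsi => + _ _ _; apply. Qed.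
Lemma ucpL (a : C) x y : N x -> N y -> psi (a *: x + y) = a *: psi x + psi y.
Proof. by case: hpsi => _ + _ _; apply. Qed.
Lemma ucp_id : psi id = id. Proof. by case: hpsi. Qed.
Lemma ucp0 : psi 0 = 0.
Proof. by have := ucpL (-1) (vn0 hN) (vn0 hN); rewrite scaleN1r addNr scaleN1r addNr. Qed.
Lemma ucpD x y : N x -> N y -> psi (x + y) = psi x + psi y.
Proof. by move=> *; rewrite -[x in LHS]scale1r ucpL// scale1r. Qed.
Lemma ucpZ (a : C) x : N x -> psi (a *: x) = a *: psi x.
Proof. by move=> *; rewrite -[_ *: _ in LHS]addr0 ucpL ?ucp0 ?addr0//; exact: vn0. Qed.
Lemma ucpN x : N x -> psi (- x) = - psi x.
Proof. by move=> *; rewrite -scaleN1r ucpZ// scaleN1r. Qed.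
Lemma ucpB x y : N x -> N y -> psi (x - y) = psi x - psi y.
Proof. by move=> *; rewrite ucpD ?ucpN//; exact: vnN. Qed.

Lemma ucp_cp (T : finType) (x : T -> T -> H -> H) :
  (forall i j, N (x i j)) -> mpos x -> mpos (fun i j => psi (x i j)).
Proof. by case: hpsi => _ _ _; exact: cp_mpos. Qed.

Lemma ucp_pos x : N x -> op_pos x -> op_pos (psi x).
Proof.
move=> Nx px u; have := @ucp_cp unit (fun _ _ => x) (fun _ _ => Nx).
have e (y : H -> H) (v : H) :
    \sum_(i : unit) \sum_(j : unit) dotp (y v) v = dotp (y v) v.
  by rewrite big_const card_unit/= addr0 big_const card_unit/= addr0.
move=> /(_ _ (fun=> u)); rewrite e; apply=> xi.
rewrite (eq_bigr (fun i : unit => \sum_(j : unit) dotp (x (xi tt)) (xi tt))).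
  by rewrite e.
by move=> [] _; apply: eq_bigr => -[] _.
Qed.

Lemma ucp_le x y : N x -> N y -> op_le x y -> op_le (psi x) (psi y).
Proof. by move=> Nx Ny h; rewrite /op_le -ucpB//; apply: ucp_pos => //; exact: vnB. Qed.

(* The matrix [[1, x], [x^*, x^* x]] is positive. *)
Lemma ucp_matrix x u v : N x ->
  0 <= dotp u u + dotp (psi x v) u + (dotp (psi (adj x) u) v + dotp (psi (adj x \o x) v) v).
Proof.
move=> Nx; have bx := vn_bop hN Nx; have Nx' := vn_adj hN Nx.
pose X (i j : bool) : H -> H := if i then (if j then id else x)
   else (if j then adj x else adj x \o x).
have := @ucp_cp _ X; have XN : forall i j, N (X i j).
  by case; case=> //=; [exact: vn_id|exact: vn_sqr].
have XP : mpos X.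
  move=> xi; rewrite !big_bool /= !adj_dotp'//.
  rewrite -!(addrA, dotpDr) -!dotpDl.
  rewrite (_ : _ + _ = dotp (xi true + x (xi false)) (xi true + x (xi false))); first exact: dotp_ge0.
  by rewrite !dotpDl !dotpDr !addrA (addrAC (dotp (xi true) (xi true))).
move=> /(_ XN XP (fun b => if b then u else v)).
by rewrite !big_bool /= ucp_id.
Qed.

(** The quantity in [ucp_matrix] is real at [u] and at [i u]; the two vanishing imaginary parts give
    the two components of the identity. *)
Lemma ucp_adjoint x u v : N x -> dotp (psi (adj x) u) v = dotp u (psi x v).
Proof.
move=> Nx; rewrite (dotpC (psi x v)).
have h w : 0 <= dotp w w + dotp (psi x v) w + (dotp (psi (adj x) w) v + dotp (psi (adj x \o x) v) v).
  exact: ucp_matrix.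
have p2 : op_pos (psi (adj x \o x)).
  by apply: ucp_pos; [exact: vn_sqr|apply: op_pos_sqr; exact: vn_bop Nx].
have lp : linear (psi (adj x)) by apply: (vn_linear hN); apply: ucp_in; exact: vn_adj.
have /cge0P[_ h1] := h u; have /cge0P[_ h2] := h (iu R *: u).
have /cge0P[_ h3] := p2 v.
move: h1 h2; rewrite linZE// !dotpxx !dotpZl !dotpZr !imD !imreal h3 !reimE => h1 h2.
by apply: complex_eq; rewrite !reimE; lra.
Qed.

Lemma ucp_adj x : N x -> psi (adj x) = adj (psi x).
Proof.
move=> Nx; symmetry; apply: adj_uniq => u v.
by rewrite (dotpC (psi _ v)) ucp_adjoint// -dotpC.
Qed.

(** Kadison's inequality, obtained from [ucp_matrix] at the vectors [- psi x u] and [u]. *)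
Lemma ucp_schwarz x u : N x -> nr (psi x u) ^+ 2 <= qf (psi (adj x \o x)) u.
Proof.
move=> Nx; have := ucp_matrix (- psi x u) u Nx; rewrite ucp_adjoint//.
rewrite !dotpNl !dotpNr opprK => /cge0P[+ _].
by rewrite !reD !reN re_dotpxx /qf; lra.
Qed.

Lemma ucp_bound x (r : R) : N x -> 0 <= r -> (forall u, nr (x u) <= r * nr u) ->
  forall u, nr (psi x u) <= r * nr u.
Proof.
move=> Nx r0 hr u; have bx := vn_bop hN Nx.
rewrite -(@ler_pXn2r _ 2) ?nnegrE ?mulr_ge0 ?nr_ge0// exprMn.
apply: le_trans (ucp_schwarz u Nx) _.
have le : op_le (adj x \o x) ((r ^+ 2)%:C *: id).
  apply: qf_op_le; [exact: op_pos_sqr|by apply: op_posZ; [exact: sqr_ge0|exact: op_pos_id]|].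
  move=> v; rewrite qfZ qf_id /qf /= adj_dotp'// re_dotpxx -exprMn.
  by rewrite ler_pXn2r ?nnegrE ?mulr_ge0 ?nr_ge0.
have := op_le_qf u (ucp_le (vn_sqr hN Nx) (vnZ hN _ (vn_id hN)) le).
by rewrite ucpZ ?ucp_id ?qfZ ?qf_id//; exact: vn_id.
Qed.

End Ucp.

Section StatePreserving.
Variables (N : set (H -> H)) (nu : (H -> H) -> C).
Hypotheses (hN : vn_alg N) (hnu : faithful_normal_state N nu).
Variables (psi : (H -> H) -> (H -> H)).
Hypotheses (hpsi : ucp N psi) (hst : forall x, N x -> nu (psi x) = nu x).

(** Let [t] be the supremum of the image of [D], so that [t <= psi s]. Invariance and normality of
    [nu] give [nu (psi s) = nu s <= nu t], and faithfulness forces [psi s = t]. *)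
Lemma ucp_normal : normal_map N psi.
Proof.
move=> D s hs; case: (hs) => -[D0 DN] dirD [Ns ub] lub.
have dirD' : directed (psi @` D).
  split; first by have [d Dd] := D0; exists (psi d), d.
  move=> _ _ [x Dx <-] [y Dy <-]; have [z [Dz xz yz]] := dirD _ _ Dx Dy.
  have [[Nx _] [Ny _] [Nz _]] := And3 (DN _ Dx) (DN _ Dy) (DN _ Dz).
  by exists (psi z); split; [exists z|exact: ucp_le hpsi _ _ Nx Nz xz|exact: ucp_le hpsi _ _ Ny Nz yz].
have DN' : psi @` D `<=` N `&` op_pos (H := H).
  by move=> _ [x /DN[Nx px] <-]; split; [exact: ucp_in hpsi _ Nx|exact: ucp_pos hpsi _ Nx px].
have Ns' := ucp_in hpsi Ns.
have ub' d : (psi @` D) d -> op_le d (psi s).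
  by move=> [x Dx <-]; have [Nx _] := DN _ Dx; apply: (ucp_le hN hpsi) => //; exact: ub.
have [t ht [_ le]] := directed_sup hN dirD' DN' (vn_bop hN Ns') ub'.
suff -> : psi s = t by [].
case: (ht) => _ _ [Nt tub] _.
apply/eqP; rewrite -subr_eq0; apply/eqP; apply: (st_eq0 hnu) => //; first exact: vnB.
have Nst : N (psi s - t) by exact: vnB.
have /cge0P[p1 p2] := st_ge0 hnu Nst le.
apply: complex_eq => //; apply/eqP; rewrite eq_le p1 andbT.
rewrite (stB hN hnu)// reD reN hst// subr_le0; apply/ler_addgt0Pl => e e0.
have [d Dd hd] := st_sup hnu hs e0; have [Nd _] := DN _ Dd.
have : re (nu (psi d)) <= re (nu t).
  by apply: (st_leR hN hnu); [exact: ucp_in hpsi _ Nd|by []|apply: tub; exists d].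
by rewrite hst//; lra.
Qed.

(** Kadison's inequality, evaluated in the invariant state. *)
Lemma ucp_L2 (K : hilbertType R) (La : (H -> H) -> K) x : is_L2 N nu La -> N x ->
  nr (La (psi x)) <= nr (La x).
Proof.
move=> hLa Nx; have Np := ucp_in hpsi Nx; have Nxx := vn_sqr hN Nx.
rewrite -(@ler_pXn2r _ 2) ?nnegrE ?nr_ge0// !(L2_sqr hLa)// -(hst Nxx).
apply: (st_leR hN hnu); [exact: vn_sqr|exact: ucp_in hpsi _ Nxx|].
apply: qf_op_le.
- by apply: op_pos_sqr; exact: vn_bop Np.
- by apply: (ucp_pos hpsi) => //; apply: op_pos_sqr; exact: vn_bop Nx.
- move=> u; rewrite {1}/qf /= adj_dotp'; last exact: vn_bop Np.
  by rewrite re_dotpxx; exact: (ucp_schwarz hN hpsi).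
Qed.

End StatePreserving.
End MatrixPositivity.

(** * Automorphisms *)

Section NumericalRange.
Variables (R : realType) (H : hilbertType R).
Local Notation C := R[i].
Local Notation re := (@complex.Re R).
Local Notation im := (@complex.Im R).
Local Notation "x %:C" := (real_complex _ x) : ring_scope.

Lemma bop_sum (H1 H2 : hilbertType R) (J : Type) (r : seq J) (F : J -> H1 -> H2) :
  (forall j, bop (F j)) -> bop (\sum_(j <- r) F j).
Proof.
move=> hF; elim/big_ind : _ => [|x y bx by_|//]; first exact: bop0.
by rewrite -[x]scale1r; exact: bop_lin.
Qed.

(* The spectrum of a self-adjoint operator reaches the infimum of its numerical range. *)
Lemma sym_pos_of_inverse (A : H -> H) : bop A ->
  (forall x y, dotp (A x) y = dotp x (A y)) ->
  (forall e : R, 0 < e -> exists2 Q : H -> H, bop Q & forall u, Q (A u + e%:C *: u) = u) ->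
  op_pos A.
Proof.
move=> bA sA hQ; have [c c0 hc] := bop_qf_bound bA; have lA := bA.1.
have imA u : im (dotp (A u) u) = 0.
  by have := congr1 im (dotpC (A u) u); rewrite -sA im_conj; lra.
pose S := [set qf A u | u in [set u : H | nr u = 1]].
have Slb : has_lbound S.
  have [_ [d d0 hd]] := bA; exists (- d) => _ [u /= u1 <-].
  have := re_abs (dotp (A u) u); rewrite ler_norml => /andP[+ _].
  by have := dotp_CS (A u) u; have := hd u; rewrite /qf u1; lra.
have unit (u : H) : nr u != 0 -> nr ((nr u)^-1%:C *: u) = 1.
  by move=> u0; rewrite nr_real_scale ?invr_ge0 ?nr_ge0// mulVf.
have qfZ2 (s : R) u : qf A (s%:C *: u) = s ^+ 2 * qf A u.
  rewrite /qf linZE// dotpZl dotpZr !reimE; ring.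
have Sle (u : H) : inf S * nr u ^+ 2 <= qf A u.
  have [u0|u0] := eqVneq (nr u) 0.
    by rewrite (nr0_eq0 u0) nr0 expr0n mulr0 /qf lin0// dotp0l.
  have := ge_inf Slb (imageP (qf A) (unit _ u0)).
  rewrite qfZ2 exprVn mulrC ler_pdivlMr// exprn_gt0// lt_def u0 nr_ge0//.
move=> u; apply/cge0P; split=> //; rewrite leNgt; apply/negP => hneg.
have S0 : has_inf S.
  split=> //; have u0 : nr u != 0.
    apply/eqP => /nr0_eq0 u0; move: hneg; rewrite u0 lin0// dotp0l/= ltxx//.
  by exists (qf A ((nr u)^-1%:C *: u)), ((nr u)^-1%:C *: u) => //; exact: unit.
have s0 : inf S < 0.
  rewrite ltNge; apply/negP => s0; have := Sle u; have := sqr_ge0 (nr u).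
  by rewrite /qf; nra.
have e0 : 0 < - inf S by rewrite oppr_gt0.
have [Q [lQ [b b0 hb]] QE] := hQ _ e0.
(* [A] shifted by the infimum of its numerical range: [k] is positive, and its form takes
   arbitrarily small values at unit vectors. *)
pose k : H -> H := A + (- inf S)%:C *: id.
have kE v : k v = A v + (- inf S)%:C *: v by [].
have bk : bop k by rewrite /k addrC; apply: bop_lin => //; exact: bop_id.
have qk v : qf k v = qf A v - inf S * nr v ^+ 2 by rewrite qfD qfZ qf_id mulNr.
have pk : op_pos k.
  move=> v; apply/cge0P; split; first by rewrite -/(qf k v) qk subr_ge0.
  by rewrite kE dotpDl imD imA dotpZl imM dotpxx !reimE; ring.
have [d d0 hd] := bop_qf_bound bk.
(* The left inverse bounds [|k v|] from below, and [pos_sqr] turns this into a lower bound for the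
   form of [k] at unit vectors, contrary to the choice of the shift. *)
have low (v : H) : nr v = 1 -> 1 <= (b ^+ 2 * d) * (qf A v - inf S).
  move=> v1; have := hb (k v); rewrite kE QE -kE v1 => h1.
  have := pos_sqr v bk.1 pk d0 hd; rewrite qk v1 expr1n mulr1 => h2.
  have := nr_ge0 (k v) => n0.
  have : 1 <= b ^+ 2 * nr (k v) ^+ 2 by rewrite -exprMn -{1}[1](expr1n _ 2) ler_pXn2r ?nnegrE ?mulr_ge0.
  move=> /le_trans; apply; rewrite -mulrA ler_wpM2l ?sqr_ge0//.
have p0 : 0 < (b ^+ 2 * d + 1)^-1.
  by rewrite invr_gt0; have := mulr_ge0 (sqr_ge0 b) d0; lra.
have [_ [v /= v1 <-]] := inf_adherent p0 S0.
have := low v v1; have := Sle v; rewrite v1 expr1n mulr1.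
set m := b ^+ 2 * d; have m0 : 0 <= m by rewrite mulr_ge0 ?sqr_ge0.
move=> h1 h2; rewrite -ltrBlDl -[X in _ < X]mul1r ltr_pdivlMr; last lra.
nra.
Qed.

End NumericalRange.

Section Automorphisms.
Variables (R : realType) (H : hilbertType R).
Local Notation C := R[i].
Local Notation re := (@complex.Re R).
Local Notation im := (@complex.Im R).
Local Notation "x %:C" := (real_complex _ x) : ring_scope.

Section Matrices.
Variables (n : nat).
Let Hn : hilbertType R := l2 'I_n H.
Let dl : 'I_n -> H -> Hn := @l2_delta R 'I_n H.
Let hd : hilbert_sum dl := l2_hilbert_sum 'I_n H.
Local Notation co := (coord dl).
Implicit Types (X Y : 'I_n -> 'I_n -> H -> H).

Definition mx_op X : l2 'I_n H -> l2 'I_n H :=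
  \sum_i \sum_j (l2_delta i \o X i j \o coord (@l2_delta R 'I_n H) j).

Lemma mx_opE X u : mx_op X u = \sum_i \sum_j dl i (X i j (co j u)).
Proof. by rewrite /mx_op fct_sum; apply: eq_bigr => i _; rewrite fct_sum. Qed.

Lemma mx_op_bop X : (forall i j, bop (X i j)) -> bop (mx_op X).
Proof.
move=> bX; apply: bop_sum => i; apply: bop_sum => j.
by apply: bop_comp (coord_bop hd j); apply: bop_comp (bX _ _); exact: hs_bop hd i.
Qed.

Lemma coord_sum_delta i (xi : 'I_n -> H) : co i (\sum_j dl j (xi j)) = xi i.
Proof.
rewrite (lin_sum _ _ _ (coord_lin hd i)) (bigD1 i)//= big1 ?addr0.
  by rewrite (coord_delta hd) eqxx.
by move=> k ki; rewrite (coord_delta hd) eq_sym (negPf ki).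
Qed.

Lemma coord_mx_op X i u : co i (mx_op X u) = \sum_j X i j (co j u).
Proof.
rewrite mx_opE -[RHS](coord_sum_delta i (fun i => \sum_j X i j (co j u))).
by congr (co i _); apply: eq_bigr => k _; rewrite (lin_sum _ _ _ (hs_lin hd k)).
Qed.

Lemma dotp_coord u v : dotp u v = \sum_i dotp (co i u) (co i v) :> C.
Proof.
have -> : u = \sum_i dl i (co i u).
  by apply: (coord_inj hd) => i; rewrite coord_sum_delta.
rewrite dotp_suml; apply: eq_bigr => i _; rewrite coord_sum_delta.
exact: (coord_dotpr hd).
Qed.

Lemma mx_op_dotp X u v :
  dotp (mx_op X u) v = \sum_i \sum_j dotp (X i j (co j u)) (co i v) :> C.
Proof.
by rewrite dotp_coord; apply: eq_bigr => i _; rewrite coord_mx_op dotp_suml.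
Qed.

Lemma mx_op_pos X : mpos X <-> op_pos (mx_op X).
Proof.
split=> [h u|h xi]; first by rewrite mx_op_dotp; exact: h (co^~ u).
have := h (\sum_j dl j (xi j)); rewrite mx_op_dotp.
by under eq_bigr do under eq_bigr do rewrite !coord_sum_delta.
Qed.

End Matrices.

Variables (M : set (H -> H)) (nu : (H -> H) -> C) (hM : vn_alg M).
Variable theta : vn_aut M nu.
Implicit Types x y : H -> H.

Lemma aut_in x : M x -> M (theta x).
Proof. by case: (vn_aut_bij theta) => h _ _; exact: h. Qed.
Lemma autL (a : C) x y : M x -> M y -> theta (a *: x + y) = a *: theta x + theta y.
Proof. exact: vn_aut_linear. Qed.
Lemma autM x y : M x -> M y -> theta (x \o y) = theta x \o theta y.
Proof. exact: vn_aut_comp. Qed.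
Lemma aut_inj x y : M x -> M y -> theta x = theta y -> x = y.
Proof. by case: (vn_aut_bij theta) => _ h _ Mx My; apply: h; rewrite inE. Qed.
Lemma aut_id : theta id = id.
Proof.
case: (vn_aut_bij theta) => _ _ /(_ _ (vn_id hM))[x Mx xE].
have h : theta x = theta id \o theta x := autM (vn_id hM) Mx.
by rewrite xE in h; exact: (esym h).
Qed.
Lemma aut0 : theta 0 = 0.
Proof. by have := autL (-1) (vn0 hM) (vn0 hM); rewrite scaleN1r addNr scaleN1r addNr. Qed.
Lemma autD x y : M x -> M y -> theta (x + y) = theta x + theta y.
Proof. by move=> *; rewrite -[x in LHS]scale1r autL// scale1r. Qed.
Lemma autZ (a : C) x : M x -> theta (a *: x) = a *: theta x.
Proof. by move=> *; rewrite -[_ *: _ in LHS]addr0 autL ?aut0 ?addr0//; exact: vn0. Qed.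
Lemma aut_sum (I : Type) (r : seq I) (F : I -> H -> H) :
  (forall i, M (F i)) -> theta (\sum_(i <- r) F i) = \sum_(i <- r) theta (F i).
Proof.
move=> hF; elim: r => [|i r IH]; first by rewrite !big_nil aut0.
by rewrite !big_cons autD ?IH//; apply: (vn_sum hM) => j _.
Qed.

(* [theta] preserves the invertibility of [h + e] for positive matrices [h]. *)
Lemma aut_cp : completely_positive M theta.
Proof.
move=> n x Mx /matrix_posE px; apply/matrix_posE.
set y := fun i j => theta (x i j).
have My i j : M (y i j) by exact: aut_in.
have bx i j := vn_bop hM (Mx i j); have by_ i j := vn_bop hM (My i j).
set dl := @l2_delta R 'I_n H; have hd : hilbert_sum dl := l2_hilbert_sum 'I_n H.
have bX := mx_op_bop bx; have bY := mx_op_bop by_.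
have pX : op_pos (mx_op x) by apply/mx_op_pos.
have xadj i j : adj (x i j) = x j i.
  apply: adj_uniq => u v.
  have := pos_sym (dl j u) (dl i v) bX.1 pX.
  by rewrite (coord_dotpl hd) (coord_dotpr hd) !coord_mx_op (bigD1 j)//= big1 ?addr0;
    [rewrite (bigD1 i)//= big1 ?addr0 ?(coord_delta hd) ?eqxx//|];
    move=> k ki; rewrite (coord_delta hd) (negPf ki) lin0//; exact: (bx _ _).1.
have yadj i j : adj (y i j) = y j i by rewrite -vn_aut_adj// xadj.
have sY u v : dotp (mx_op y u) v = dotp u (mx_op y v).
  rewrite mx_op_dotp (dotpC (mx_op y v)) mx_op_dotp rmorph_sum exchange_big /=.
  apply: eq_bigr => i _; rewrite rmorph_sum; apply: eq_bigr => j _.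
  by rewrite -[RHS]dotpC -(yadj j i) -adj_dotp.
apply/mx_op_pos; apply: sym_pos_of_inverse => // e e0.
have bXe : bop (mx_op x + e%:C *: id) by rewrite addrC; apply: bop_lin => //; exact: bop_id.
have pXe : op_pos (mx_op x + e%:C *: id).
  exact: (op_posD pX (op_posZ (ltW e0) (@op_pos_id R (l2 'I_n H)))).
have low u : e * nr u <= nr ((mx_op x + e%:C *: id) u).
  have [->|u0] := eqVneq (nr u) 0; first by rewrite mulr0 nr_ge0.
  have up : 0 < nr u by rewrite lt_def u0 nr_ge0.
  rewrite -(ler_pM2r up) -mulrA -expr2.
  apply: le_trans (le_trans (re_le _) (dotp_CS _ _)).
  by rewrite -/(qf _ _) qfD qfZ qf_id lerDr qf_ge0.
have [Q bQ [QX XQ]] := sym_inverse bXe (fun u v => pos_sym u v bXe.1 pXe) e0 low.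
(* The entries of the inverse [Q] lie in [M], because [Q] commutes with the diagonal amplification
   of each operator [z] in the set whose commutant is [M]. *)
pose q i j := coord dl i \o Q \o dl j.
have Mq i j : M (q i j).
  have bq : bop (q i j).
    by apply: bop_comp (hs_bop hd j); apply: bop_comp (coord_bop hd i) bQ.
  have [[S hS SM] _] := hM; rewrite -SM; split; first exact/bop_bounded.
  move=> z Sz; have bz := hS _ Sz.
  pose D := mx_op (fun i j : 'I_n => if i == j then z else 0).
  have cD k u : coord dl k (D u) = z (coord dl k u).
    rewrite coord_mx_op (bigD1 k)//= eqxx big1 ?addr0// => l lk.
    by rewrite eq_sym (negPf lk).
  have Dd k v : D (dl k v) = dl k (z v).
    apply: (coord_inj hd) => l; rewrite cD !(coord_delta hd).
    by case: ifP => // _; exact: lin0 bz.1.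
  have DX u : D ((mx_op x + e%:C *: id) u) = (mx_op x + e%:C *: id) (D u).
    apply: (coord_inj hd) => k; rewrite cD !fctE !(linDE _ _ (coord_lin hd k)).
    rewrite !(linZE _ _ (coord_lin hd k)) cD (linDE _ _ bz.1) (linZE _ _ bz.1).
    congr (_ + _); rewrite !coord_mx_op (lin_sum _ _ _ bz.1); apply: eq_bigr => l _.
    rewrite cD; have : M (x k l) by [].
    by rewrite -SM => -[_ /(_ _ Sz)] /(congr1 (@^~ (coord dl l u))).
  have DQ u : D (Q u) = Q (D u) by rewrite -{2}(XQ u) DX QX.
  by apply/funext => u; rewrite /q /= -cD DQ Dd.
(* The entries of [Q (X + e) = 1] are algebraic identities in [M], which [theta] preserves. Their
   images exhibit a left inverse of [Y + e], as [sym_pos_of_inverse] asks. *)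
have qE i j : \sum_k (q i k \o x k j) + e%:C *: q i j = (if i == j then id else 0 : H -> H).
  apply/funext => u.
  have := congr1 (coord dl i) (QX (dl j u)).
  rewrite (coord_delta hd) !fctE (linDE _ _ bQ.1) (linZE _ _ bQ.1).
  rewrite (linDE _ _ (coord_lin hd i)) (linZE _ _ (coord_lin hd i)) => h.
  transitivity (if i == j then u else 0); last by case: ifP.
  rewrite -h; congr (_ + _).
  have -> : mx_op x (dl j u) = \sum_k dl k (x k j u).
    apply: (coord_inj hd) => k; rewrite coord_mx_op coord_sum_delta.
    rewrite (bigD1 j)//= (coord_delta hd) eqxx big1 ?addr0// => l lj.
    by rewrite (coord_delta hd) (negPf lj) lin0//; case: (bx k l).
  by rewrite (lin_sum _ _ _ bQ.1) (lin_sum _ _ _ (coord_lin hd i)).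
have q'E i j : \sum_k (theta (q i k) \o y k j) + e%:C *: theta (q i j) =
    (if i == j then id else 0 : H -> H).
  have Mqx k : M (q i k \o x k j) by exact: (vn_comp hM).
  have := congr1 theta (qE i j); rewrite autD; last 2 first.
  - by apply: (vn_sum hM) => k _; exact: Mqx.
  - exact: vnZ.
  rewrite autZ// aut_sum// => h; rewrite (eq_bigr (fun k => theta (q i k \o x k j))).
    by rewrite h; case: ifP => _; [exact: aut_id|exact: aut0].
  by move=> k _; rewrite autM.
exists (mx_op (fun i j => theta (q i j))).
  by apply: mx_op_bop => i j; apply: (vn_bop hM); exact: aut_in.
have lq i j : linear (theta (q i j)) by apply: (vn_linear hM); exact: aut_in.
move=> u; apply: (coord_inj hd) => i; rewrite coord_mx_op.
transitivity (\sum_j (if i == j then id else 0 : H -> H) (coord dl j u)); last first.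
  rewrite (bigD1 i)//= eqxx big1 ?addr0// => j ji.
  by rewrite eq_sym (negPf ji).
under [RHS]eq_bigr => j _ do rewrite -q'E fctD fct_sum.
rewrite big_split /= exchange_big /= -big_split /=; apply: eq_bigr => j _.
rewrite (linDE _ _ (coord_lin hd j)) (linZE _ _ (coord_lin hd j)) (linDE _ _ (lq _ _)).
rewrite coord_mx_op (lin_sum _ _ _ (lq _ _)); congr (_ + _).
by rewrite (linZE _ _ (lq _ _)).
Qed.

Lemma aut_ucp : ucp M theta.
Proof. by split; [exact: aut_in|exact: vn_aut_linear|exact: aut_id|exact: aut_cp]. Qed.

Lemma aut_bound x (r : R) : M x -> 0 <= r -> (forall u, nr (x u) <= r * nr u) ->
  forall u, nr (theta x u) <= r * nr u.
Proof. by move=> Mx r0 hr; exact: (ucp_bound hM aut_ucp Mx r0 hr). Qed.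

Lemma aut_L2 (K : hilbertType R) (La : (H -> H) -> K) x : is_L2 M nu La -> M x ->
  nr (La (theta x)) = nr (La x).
Proof.
move=> hLa Mx; apply/eqP; rewrite -(@eqrXn2 _ 2) ?nr_ge0//.
rewrite !(L2_sqr hLa)//; last exact: aut_in.
rewrite -(vn_aut_adj theta)// -autM//; last exact: vn_adj.
by rewrite vn_aut_state//; exact: vn_sqr.
Qed.

End Automorphisms.

(** * Intertwiners between a representation and its twist by an automorphism *)

Section Twisted.
Variables (R : realType) (H : hilbertType R) (M : set (H -> H)) (nu : (H -> H) -> R[i]).
Local Notation C := R[i].
Hypotheses (hM : vn_alg M) (hnu : faithful_normal_state M nu).
Variables (K : hilbertType R) (La : (H -> H) -> K) (hLa : is_L2 M nu La).
Implicit Types x y z w : H -> H.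

Lemma gns_rep m : M m -> exists2 p : K -> K, bop p & forall x, M x -> p (La x) = La (m \o x).
Proof.
move=> Mm; have [_ [r r0 hr]] := vn_bop hM Mm.
have gL (a : C) x y : M x -> M y -> La (m \o (a *: x + y)) = a *: La (m \o x) + La (m \o y).
  move=> Mx My; have Mmx := vn_comp hM Mm Mx; have Mmy := vn_comp hM Mm My.
  rewrite -(L2_lin hLa)//; congr La; apply/funext => u.
  by rewrite /= !fctE (vn_linear hM Mm).
have [p [lp bp pE]] := extension (vn_lsub hM) (fun a x y Mx My => L2_lin hLa a Mx My) gL
  (fun x Mx => L2_comp_bound hM hnu hLa Mm Mx r0 hr) r0 (L2_dense hLa).
by exists p => //; split=> //; exists r.
Qed.

Variable theta : vn_aut M nu.

(** Invariance of [nu] makes [La (theta x) |-> La x] isometric, and surjectivity of [theta] makes it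
    densely defined. *)
Lemma gns_aut_inv : exists U : K -> K,
  [/\ bop U, forall x, M x -> U (La (theta x)) = La x & forall v, nr (U v) = nr v].
Proof.
have iL (a : C) x y : M x -> M y ->
    La (theta (a *: x + y)) = a *: La (theta x) + La (theta y).
  by move=> Mx My; rewrite (autL theta)// (L2_lin hLa)//; exact: aut_in.
have gc x : M x -> nr (La x) <= 1 * nr (La (theta x)).
  by move=> Mx; rewrite mul1r (aut_L2 hM theta hLa).
have dT v : adh ((La \o theta) @` M) v.
  move=> e /(L2_dense hLa v)[_ [x Mx <-] h]; exists (La x) => //.
  by case: (vn_aut_bij theta) => _ _ /(_ _ Mx)[y My <-]; exists y.
have [U [lU bU UE]] := extension (vn_lsub hM) iL (fun a x y Mx My => L2_lin hLa a Mx My) gc ler01 dT.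
exists U; split=> //; first by split=> //; exists 1.
move=> v; apply/eqP; rewrite eq_le -[X in _ <= X]mul1r bU/=.
apply/ler_addgt0Pl => e e0; have e2 : 0 < e / 2 by rewrite divr_gt0.
have [_ [x Mx <-] h] := dT v _ e2.
have h1 := nr_tri v (La (theta x)) 0; have h2 := nr_tri (La x) (U v) 0.
rewrite !subr0 in h1 h2.
have h3 := bU (v - La (theta x)); rewrite linBE// UE// mul1r nrC in h3.
have := aut_L2 hM theta hLa Mx; rewrite /= in h *; lra.
Qed.

(* The intertwiners of the identity representation and [theta] are of the form
   [T1 U T2^*], where [T1], [T2] are intertwiners [L2(M) -> H]. *)
Lemma twisted_separating z : M z ->
  (forall w, bop w -> (forall m, M m -> m \o w = w \o theta m) -> w \o z = 0) -> z = 0.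
Proof.
move=> Mz hz; have [U [bU UE Unr]] := gns_aut_inv; have bz := vn_bop hM Mz.
have Mid := vn_id hM.
have piT T m p : intertwiner M La T -> M m -> bop p ->
    (forall x, M x -> p (La x) = La (m \o x)) -> T \o p = m \o T.
  move=> [bT iT] Mm bp pE; have bm := vn_bop hM Mm.
  apply: (bop_ext (bop_comp bT bp) (bop_comp bm bT) (L2_dense hLa)) => _ [x Mx <-].
  by rewrite /= pE// iT.
apply/funext => xi; rewrite (_ : (0 : H -> H) xi = 0)//.
apply: nr_le_eq0 => e e0.
have [_ [T2 iT2 ->] h2] := intertwiner_dense hM hnu hLa (z xi) e0.
have [T2' bT2' T2E] := bop_has_adjoint iT2.1.
have k0 : T2' (z xi) = 0.
  apply: nr0_eq0; rewrite -Unr; suff -> : U (T2' (z xi)) = 0 by rewrite nr0.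
  apply: (intertwiner_kernel hM hnu hLa) => T1 iT1.
  (* [T2'] carries [theta m] to its action [q] on [K], [U] turns [q] into the action [p] of [m], and
     [T1] brings [p] back to [m] on [H]. So the composite satisfies the twisted relation. *)
  have bw : bop (T1 \o U \o T2').
    by apply: bop_comp => //; apply: bop_comp => //; exact: iT1.1.
  have := hz _ bw _ => /(_ _)/(congr1 (@^~ xi)); apply=> m Mm.
  have Mtm := aut_in theta Mm; have Mtm' := vn_adj hM Mtm.
  have [p bp pE] := gns_rep Mm; have [q bq qE] := gns_rep Mtm.
  have [q' bq' q'E] := gns_rep Mtm'.
  have Uq : U \o q = p \o U.
    apply: (bop_ext (bop_comp bU bq) (bop_comp bp bU) (D := (La \o theta) @` M)).
      move=> v e' /(L2_dense hLa v)[_ [x Mx <-] h]; exists (La x) => //.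
      by case: (vn_aut_bij theta) => _ _ /(_ _ Mx)[y My <-]; exists y.
    move=> _ [x Mx <-] /=; rewrite qE; last exact: aut_in.
    by rewrite -(autM theta)// !UE// ?pE//; exact: (vn_comp hM).
  have qq' u v : dotp (q u) v = dotp u (q' v).
    have [q2 bq2 q2E] := bop_has_adjoint bq; rewrite q2E; congr (dotp _ (_ v)).
    apply: (bop_ext bq2 bq' (L2_dense hLa)) => _ [x Mx <-].
    rewrite q'E//; apply: dotp_inj => w; rewrite dotpC -q2E.
    have [f hf fw] := adh_cvg (L2_dense hLa w).
    have f1 : (fun n => dotp (q (f n)) (La x)) @ \oo --> (dotp (q w) (La x) : C^o).
      by apply: cvg_dotpl; exact: bop_cvg.
    have f2 : (fun n => dotp (f n) (La (adj (theta m) \o x))) @ \oo -->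
        (dotp w (La (adj (theta m) \o x)) : C^o) by exact: cvg_dotpl.
    rewrite (dotpC w); apply: (congr1 (fun t : C => t^* )).
    apply: (cvgC_uniq f1); suff -> : (fun n => dotp (q (f n)) (La x)) =
      (fun n => dotp (f n) (La (adj (theta m) \o x))) by [].
    apply/funext => n; have [y My <-] := hf n.
    by rewrite qE// (L2_comp hM hLa).
  have T2q : T2' \o theta m = q \o T2'.
    apply/funext => u; apply: dotp_inj => v /=.
    rewrite qq' dotpC -T2E (dotpC (q' v)) -T2E; apply: (congr1 (fun t : C => t^* )).
    have := piT _ _ _ iT2 Mtm' bq' q'E => /(congr1 (@^~ v)) /= ->.
    by rewrite adj_dotp'//; exact: (vn_bop hM).
  apply/funext => u /=; have /(congr1 (@^~ u))/= -> := T2q.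
  have /(congr1 (@^~ (T2' u)))/= -> := Uq.
  by have /(congr1 (@^~ (U (T2' u))))/= -> := piT _ _ _ iT1 Mm bp pE.
(* [z xi] is orthogonal to a vector at distance less than [e] from it, so its own norm is at most
   [e]. *)
have : dotp (z xi) (T2 (La id)) = 0 by rewrite dotpC T2E k0 dotp0r rmorph0.
move=> h0; have := nr_sqrB (z xi) (T2 (La id)); rewrite h0 mulr0 subr0 => h.
have := nr_ge0 (z xi); have := nr_ge0 (z xi - T2 (La id)); have := sqr_ge0 (nr (T2 (La id))).
by move: h2; nra.
Qed.

End Twisted.

Section Reindexing.
Variables (R : realType) (I : choiceType) (H L : hilbertType R) (delta : I -> H -> L).
Local Notation C := R[i].
Hypothesis hd : hilbert_sum delta.

(** One construction for the generators of the crossed product and for the commutant elements made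
    from translations and amplifications. *)
Lemma hs_perm_op (s : I -> I) (w : I -> H -> H) (c : R) : injective s -> 0 <= c ->
  (forall g, linear (w g)) -> (forall g xi, nr (w g xi) <= c * nr xi) ->
  exists2 A : L -> L, bop A & forall g xi, A (delta g xi) = delta (s g) (w g xi).
Proof.
move=> sI c0 lw hw.
have lT g : linear (fun xi => delta (s g) (w g xi)).
  by move=> a x y; rewrite lw (hs_lin hd).
have hT (F : {fset I}) (x : I -> H) :
    nr (\sum_(g <- F) delta (s g) (w g (x g))) ^+ 2 <= c ^+ 2 * \sum_(g <- F) nr (x g) ^+ 2.
  have -> : nr (\sum_(g <- F) delta (s g) (w g (x g))) ^+ 2 = \sum_(g <- F) nr (w g (x g)) ^+ 2.
    rewrite -re_dotpxx dotp_suml re_sum big_seq [RHS]big_seq; apply: eq_bigr => g gF.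
    rewrite dotp_sumr re_sum -re_dotpxx.
    transitivity (\sum_(h <- F)
        (if h == g then complex.Re (dotp (w g (x g)) (w h (x h))) else 0)).
      by apply: eq_bigr => h _; rewrite (hs_dotp hd) (inj_eq sI) eq_sym; case: ifP.
    by rewrite sum_delta gF.
  rewrite mulr_sumr; apply: ler_sum => g _; rewrite -exprMn.
  by rewrite ler_pXn2r ?nnegrE ?mulr_ge0 ?nr_ge0.
have [A [lA bA AE]] := hs_operator hd c0 lT hT.
by exists A => //; split=> //; exists c.
Qed.

Lemma fin_sum_reindex (s s' : I -> I) (f f' : I -> C) (l l' : C) :
  cancel s s' -> cancel s' s -> (forall k, f' (s k) = f k) ->
  (fun F : {fset I} => \sum_(k <- F) f k) @ @fin_filter I --> (l : C^o) ->
  (fun F : {fset I} => \sum_(k <- F) f' k) @ @fin_filter I --> (l' : C^o) -> l = l'.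
Proof.
move=> sK s'K ff' hl hl'; have FF := fin_filter_proper I.
apply: (cvgC_uniq (F := @fin_filter I) (f := fun F : {fset I} => \sum_(k <- F) f' k)) hl'.
apply/cvgC_nrP => e e0; have [A _ hA] := cvgC_nr hl e0.
apply: filterS (fin_filter_ge [fset s k | k in A]%fset) => F hF /=.
have -> : \sum_(k <- F) f' k = \sum_(k <- [fset s' k | k in F]%fset) f k.
  rewrite big_imfset /=; last by move=> x y _ _; exact: (can_inj s'K).
  by apply: eq_bigr => k _; rewrite -ff' s'K.
apply: hA => k kA; apply/imfsetP; exists (s k); last by rewrite sK.
by apply: hF; apply/imfsetP; exists k.
Qed.

End Reindexing.

(** * The crossed product *)

Section CrossedProduct.
Variables (R : realType) (H : hilbertType R) (M : set (H -> H)) (nu : (H -> H) -> R[i]).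
Variables (G : groupType) (alpha : G -> vn_aut M nu) (L : hilbertType R) (delta : G -> H -> L).
Local Notation C := R[i].
Hypotheses (M_vn : von_neumann M) (hnu : faithful_normal_state M nu).
Hypotheses (alpha_action : is_action alpha) (hd : hilbert_sum (I := G) delta).
Variables (K : hilbertType R) (La : (H -> H) -> K) (hLa : is_L2 M nu La).
Let hM : vn_alg M := von_neumann_alg M_vn.
Local Notation co := (coord delta).
Local Notation N := (crossed_product delta alpha).
Implicit Types (g h k : G) (m : H -> H) (x y : L -> L) (xi eta : H).

Lemma alphaM g h m : M m -> alpha (g * h)%g m = alpha g (alpha h m).
Proof. exact: alpha_action. Qed.

(** On [M], [alpha 1] is idempotent and injective. *)
Lemma alpha1 m : M m -> alpha 1%g m = m.
Proof.
move=> Mm; apply: (aut_inj (theta := alpha 1%g)) => //; first exact: aut_in.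
by rewrite -alphaM// mul1g.
Qed.

Lemma alphaK g m : M m -> alpha g^-1%g (alpha g m) = m.
Proof. by move=> Mm; rewrite -alphaM// mulVg alpha1. Qed.

Lemma alphaVK g m : M m -> alpha g (alpha g^-1%g m) = m.
Proof. by move=> Mm; rewrite -alphaM// mulgV alpha1. Qed.

Definition entry x g h : H -> H := co g \o x \o delta h.

Definition covariant x := [/\ bop x, forall g h, M (entry x g h) &
  forall g h k, entry x (g * k)%g (h * k)%g = alpha k^-1%g (entry x g h)].

Lemma entry_bop x g h : bop x -> bop (entry x g h).
Proof.
by move=> bx; apply: bop_comp (hs_bop hd h); apply: bop_comp (coord_bop hd g) bx.
Qed.

Lemma entry_dotp x g h xi eta : dotp (entry x g h xi) eta = dotp (x (delta h xi)) (delta g eta).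
Proof. by rewrite (coord_dotpl hd). Qed.

Lemma entry_ext x y : bop x -> bop y -> (forall g h, entry x g h = entry y g h) -> x = y.
Proof.
move=> bx by_ e; apply: (hs_bop_ext hd bx by_) => g xi; apply: (coord_inj hd) => h.
by have /(congr1 (@^~ xi)) := e h g.
Qed.

Lemma entry_adj x g h : bop x -> entry (adj x) g h = adj (entry x h g).
Proof.
move=> bx; symmetry; apply: adj_uniq => xi eta.
by rewrite entry_dotp [RHS]dotpC entry_dotp adj_dotp'// -dotpC.
Qed.

Definition pi_op m : L -> L := xget (fun=> 0) [set T | is_pi delta alpha m T].

Lemma pi_opP m : M m -> is_pi delta alpha m (pi_op m).
Proof.
move=> Mm; have [_ [r r0 hr]] := vn_bop hM Mm.
have la g : linear (alpha g^-1%g m) by apply: (vn_linear hM); exact: aut_in.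
have ba g xi : nr (alpha g^-1%g m xi) <= r * nr xi by exact: aut_bound.
have [A bA AE] := hs_perm_op hd (@inj_id G) r0 la ba.
apply: (@xgetPex _ (fun=> 0) [set T | is_pi delta alpha m T]); exists A.
by split=> //; exact/bop_bounded.
Qed.

Lemma pi_bop m : M m -> bop (pi_op m).
Proof. by case/pi_opP => /bop_bounded. Qed.

Lemma pi_delta m g xi : M m -> pi_op m (delta g xi) = delta g (alpha g^-1%g m xi).
Proof. by case/pi_opP. Qed.

Lemma coord_pi m g v : M m -> co g (pi_op m v) = alpha g^-1%g m (co g v).
Proof.
move=> Mm; have Mgm : M (alpha g^-1%g m) by exact: aut_in.
have := @hs_bop_ext _ _ _ _ _ hd _ (co g \o pi_op m) (alpha g^-1%g m \o co g).
move=> /(_ _ _ _)/(congr1 (@^~ v)); apply.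
- exact: bop_comp (coord_bop hd g) (pi_bop Mm).
- exact: bop_comp (vn_bop hM Mgm) (coord_bop hd g).
move=> h xi /=; rewrite pi_delta// !(coord_delta hd).
by case: eqP => [->//|_]; rewrite lin0//; exact: vn_linear Mgm.
Qed.

Definition lam_op h : L -> L := xget (fun=> 0) [set T | is_lambda delta h T].

Lemma lam_opP h : is_lambda delta h (lam_op h).
Proof.
have [A bA AE] := hs_perm_op hd (mulgI h) ler01
  (fun g => (bop_id H).1) (fun g xi => eq_ind_r (fun t => nr xi <= t) (lexx _) (mul1r (nr xi))).
apply: (@xgetPex _ (fun=> 0) [set T | is_lambda delta h T]); exists A.
by split=> //; exact/bop_bounded.
Qed.

Lemma lam_bop h : bop (lam_op h).
Proof. by case: (lam_opP h) => /bop_bounded. Qed.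

Lemma lam_delta h g xi : lam_op h (delta g xi) = delta (h * g)%g xi.
Proof. by case: (lam_opP h). Qed.

Lemma coord_lam h g v : co g (lam_op h v) = co (h^-1 * g)%g v.
Proof.
have := @hs_bop_ext _ _ _ _ _ hd _ (co g \o lam_op h) (co (h^-1 * g)%g).
move=> /(_ _ _ _)/(congr1 (@^~ v)); apply.
- exact: bop_comp (coord_bop hd g) (lam_bop h).
- exact: coord_bop.
move=> k xi /=; rewrite lam_delta !(coord_delta hd).
by rewrite -(inj_eq (mulgI h) (h^-1 * g)%g) mulVKg.
Qed.

Local Notation S := ([set T | exists2 m, M m & is_pi delta alpha m T] `|`
     [set T | exists h, is_lambda delta h T]).

Lemma pi_comm y m : commutant S y -> M m -> pi_op m \o y = y \o pi_op m.
Proof. by move=> [_ hy] Mm; apply: hy; left; exists m => //; exact: pi_opP. Qed.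

Lemma lam_comm y h : commutant S y -> lam_op h \o y = y \o lam_op h.
Proof. by move=> [_ hy]; apply: hy; right; exists h; exact: lam_opP. Qed.

(** The two conditions are commutation with the left translations and with the copy of [M], read on
    entries; this is how commutant elements are recognised below. *)
Lemma commutant_entry y : bop y ->
  (forall g h k, entry y (k * g)%g (k * h)%g = entry y g h) ->
  (forall m g h, M m -> alpha g^-1%g m \o entry y g h = entry y g h \o alpha h^-1%g m) ->
  commutant S y.
Proof.
move=> by_ yl yp; split; first exact/bop_bounded.
move=> T [[m Mm hT]|[k hT]].
  have bT : bop T by case: hT => /bop_bounded.
  have -> : T = pi_op m.
    apply: (hs_bop_ext hd bT (pi_bop Mm)) => g xi; rewrite pi_delta//.
    by case: hT.
  have bpi := pi_bop Mm.
  apply: (hs_bop_ext hd (bop_comp bpi by_) (bop_comp by_ bpi)) => h xi.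
  apply: (coord_inj hd) => g /=; rewrite coord_pi// pi_delta//.
  by have /(congr1 (@^~ xi)) := yp m g h Mm.
have bT : bop T by case: hT => /bop_bounded.
have -> : T = lam_op k.
  apply: (hs_bop_ext hd bT (lam_bop k)) => g xi; rewrite lam_delta.
  by case: hT.
have bl := lam_bop k.
apply: (hs_bop_ext hd (bop_comp bl by_) (bop_comp by_ bl)) => h xi.
apply: (coord_inj hd) => g /=; rewrite coord_lam lam_delta.
by have /(congr1 (@^~ xi)) := yl (k^-1 * g)%g h k; rewrite mulVKg => /esym.
Qed.

Lemma comm_entry_pi y m g h : commutant S y -> M m ->
  alpha g^-1%g m \o entry y g h = entry y g h \o alpha h^-1%g m.
Proof.
move=> hy Mm; apply/funext => xi; have /(congr1 (@^~ (delta h xi)))/= := pi_comm hy Mm.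
by move=> /(congr1 (co g)); rewrite coord_pi// pi_delta.
Qed.

Lemma comm_entry_lam y g h k : commutant S y -> entry y (k * g)%g (k * h)%g = entry y g h.
Proof.
move=> hy; apply/funext => xi; have /(congr1 (@^~ (delta h xi)))/= := lam_comm k hy.
by move=> /(congr1 (co (k * g)%g)); rewrite coord_lam lam_delta mulKg => /esym.
Qed.

(* Termwise, [x_(g,k) y_(k,h) = y_(g,k') x_(k',h)] for [k' = g k^-1 h]. *)
Lemma covariant_crossed x : covariant x -> N x.
Proof.
move=> [bx Mx cx]; split; first exact/bop_bounded.
move=> y hy; have by_ : bop y by case: (hy) => /bop_bounded.
have bx' := bop_adj bx; have by' := bop_adj by_.
apply: entry_ext; [exact: bop_comp|exact: bop_comp|] => g h.
apply/funext => xi; apply: dotp_inj => eta; rewrite !entry_dotp /=.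
have e1 := parseval hd (u := x (delta h xi)) (v := adj y (delta g eta)).
have e2 := parseval hd (u := y (delta h xi)) (v := adj x (delta g eta)).
rewrite -adj_dotp// in e1; rewrite -adj_dotp// in e2.
apply: esym; apply: (fin_sum_reindex (s := fun k => (g * k^-1 * h)%g)
  (s' := fun k => (h * k^-1 * g)%g) _ _ _ e2 e1).
- by move=> k; rewrite !invgM invgK !mulgA mulgV mul1g mulgVK.
- by move=> k; rewrite !invgM invgK !mulgA mulgV mul1g mulgVK.
move=> k /=; set k' := (g * k^-1 * h)%g.
have xadj u l v w : dotp (co l v) (co l (adj u (delta g w))) = dotp (co l v) (entry (adj u) l g w) by [].
rewrite -[co k' (x _)]/(entry x k' h xi) -[co k' (adj y _)]/(entry (adj y) k' g eta).
rewrite -[co k (y _)]/(entry y k h xi) -[co k (adj x _)]/(entry (adj x) k g eta).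
rewrite !entry_adj// -!adj_dotp; [|exact: entry_bop|exact: entry_bop].
congr (dotp _ _).
have -> : entry y g k' = entry y k h.
  have := comm_entry_lam k h (g * k^-1)%g hy; rewrite mulgVK => <-.
  by rewrite /k'.
have -> : entry x k' h = alpha h^-1%g (entry x (g * k^-1)%g 1%g).
  by rewrite -cx mul1g.
have -> : entry x g k = alpha k^-1%g (entry x (g * k^-1)%g 1%g).
  by rewrite -cx mul1g mulgVK.
by have /(congr1 (@^~ xi)) := comm_entry_pi k h hy (Mx (g * k^-1)%g 1%g).
Qed.

(** [x] is tested against two kinds of commutant elements. Diagonal amplifications of operators
    commuting with [M] put the entries of [x] into the bicommutant of [M]. Right translations by
    [k^-1] combined with an operator [w] such that [m w = w (alpha k^-1 m)] give
    [x_(g,h) w = w x_(gk,hk)], and [twisted_separating] says that such [w] detect the difference of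
    the two sides of the covariance relation. *)
Lemma crossed_covariant x : N x -> covariant x.
Proof.
move=> [/bop_bounded bx hx]; have be g h := entry_bop g h bx.
have Mx g h : M (entry x g h).
  have [_ _ <-] := M_vn; split; first exact/bop_bounded.
  move=> y [/bop_bounded by_ hy]; have [_ [r r0 hr]] := by_.
  have [Y bY YE] := hs_perm_op hd (@inj_id G) r0 (fun=> by_.1) (fun=> hr).
  have cY k v : co k (Y v) = y (co k v).
    have := @hs_bop_ext _ _ _ _ _ hd _ (co k \o Y) (y \o co k).
    move=> /(_ _ _ _)/(congr1 (@^~ v)); apply.
    - exact: bop_comp (coord_bop hd k) bY.
    - exact: bop_comp by_ (coord_bop hd k).
    move=> l xi /=; rewrite YE !(coord_delta hd).
    by case: eqP => // _; rewrite lin0//; exact: by_.1.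
  have sY : commutant S Y.
    apply: commutant_entry => // [k l j|m k l Mm].
      apply/funext => xi; rewrite /entry /= !YE !(coord_delta hd).
      by rewrite (inj_eq (mulgI j)).
    apply/funext => xi; rewrite /entry /= !YE !(coord_delta hd).
    case: eqP => [->|_]; last by rewrite lin0//; apply: (vn_linear hM); exact: aut_in.
    by have /(congr1 (@^~ xi))/= := hy _ (aut_in (alpha l^-1%g) Mm).
  apply/funext => xi; have /(congr1 (@^~ (delta h xi)))/= := hx _ sY.
  by rewrite YE => /(congr1 (co g)); rewrite cY => ->.
split=> // g h k.
have Mk : M (alpha k^-1%g (entry x g h)) by exact: aut_in.
apply/eqP; rewrite -subr_eq0; apply/eqP.
apply: (twisted_separating hM hnu hLa (theta := alpha k^-1%g)); first exact: vnB.
move=> w bw hw; have [_ [r r0 hr]] := bw.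
(* [Y] sends [delta g xi] to [delta (g k^-1) (w xi)]. Right translation commutes with left
   translations, and the twist in [w] compensates for its effect on the copy of [M]. *)
have [Y bY YE] := hs_perm_op hd (mulIg k^-1%g) r0 (fun=> bw.1) (fun=> hr).
have cY l v : co l (Y v) = w (co (l * k)%g v).
  have := @hs_bop_ext _ _ _ _ _ hd _ (co l \o Y) (w \o co (l * k)%g).
  move=> /(_ _ _ _)/(congr1 (@^~ v)); apply.
  - exact: bop_comp (coord_bop hd l) bY.
  - exact: bop_comp bw (coord_bop hd _).
  move=> j xi /=; rewrite YE !(coord_delta hd).
  rewrite -[((l * k)%g == j)](inj_eq (mulIg k^-1%g)) mulgK.
  by case: eqP => // _; rewrite lin0//; exact: bw.1.
have sY : commutant S Y.
  apply: commutant_entry => // [j l i|m j l Mm].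
    apply/funext => xi; rewrite /entry /= !YE !(coord_delta hd) -mulgA.
    by rewrite (inj_eq (mulgI i)).
  apply/funext => xi; rewrite /entry /= !YE !(coord_delta hd).
  case: eqP => [->|_]; last by rewrite lin0//; apply: (vn_linear hM); exact: aut_in.
  have Mm' : M (alpha (l / k)^-1%g m) by exact: aut_in.
  have /(congr1 (@^~ xi))/= -> := hw _ Mm'.
  by rewrite -alphaM// -invgM mulgVK.
have e1 xi : entry x g h (w xi) = w (entry x (g * k)%g (h * k)%g xi).
  have /(congr1 (@^~ (delta (h * k)%g xi)))/(congr1 (co g)) := hx _ sY.
  by rewrite /= YE cY mulgK => e; exact: (esym e).
apply/funext => xi; rewrite /= (linBE _ _ bw.1) -e1.
have /(congr1 (@^~ xi))/= <- := hw _ (Mx g h).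
by rewrite subrr.
Qed.

(** Closure under adjoints is read off from the matrix description, since the adjoint of a covariant
    matrix is covariant. *)
Lemma crossed_vn_alg : vn_alg N.
Proof.
split; first by exists (commutant S) => // y [/bop_bounded].
move=> x Nx; have [bx Mx cx] := crossed_covariant Nx.
apply: covariant_crossed; split; first exact: bop_adj.
  by move=> g h; rewrite entry_adj//; exact: vn_adj.
by move=> g h k; rewrite !entry_adj// cx vn_aut_adj.
Qed.

Lemma pi_crossed m : M m -> N (pi_op m).
Proof.
move=> Mm; split; first by apply/bop_bounded; exact: pi_bop.
by move=> y hy; rewrite pi_comm.
Qed.

Lemma lam_crossed h : N (lam_op h).
Proof.
split; first by apply/bop_bounded; exact: lam_bop.
by move=> y hy; rewrite lam_comm.
Qed.

End CrossedProduct.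

(** * The dual state *)

Section DualState.
Variables (R : realType) (H : hilbertType R) (M : set (H -> H)) (nu : (H -> H) -> R[i]).
Variables (G : groupType) (alpha : G -> vn_aut M nu) (L : hilbertType R) (delta : G -> H -> L).
Local Notation C := R[i].
Local Notation re := (@complex.Re R).
Local Notation "x %:C" := (real_complex _ x) : ring_scope.
Hypotheses (M_vn : von_neumann M) (hnu : faithful_normal_state M nu).
Hypotheses (alpha_action : is_action alpha) (hd : hilbert_sum (I := G) delta).
Variables (K : hilbertType R) (La : (H -> H) -> K) (hLa : is_L2 M nu La).
Let hM : vn_alg M := von_neumann_alg M_vn.
Local Notation co := (coord delta).
Local Notation N := (crossed_product delta alpha).
Implicit Types (g h k : G) (m : H -> H) (x y : L -> L) (xi eta : H).

Let hN : vn_alg N := crossed_vn_alg M_vn hnu alpha_action hd hLa.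
Let Ncov : forall x, N x -> covariant alpha delta x := crossed_covariant M_vn hnu alpha_action hd hLa.

Lemma entry_lin (a : C) x y g h : entry delta (a *: x + y) g h = a *: entry delta x g h + entry delta y g h.
Proof. by apply/funext => xi; rewrite /entry /= !fctE (coord_lin hd g). Qed.

Lemma crossed_entry x g h : N x -> M (entry delta x g h).
Proof. by case/Ncov. Qed.

Lemma qf_entry x g xi : qf (entry delta x g g) xi = qf x (delta g xi).
Proof. by rewrite /qf (entry_dotp hd). Qed.

Lemma entry_pos x g : op_pos x -> op_pos (entry delta x g g).
Proof. by move=> px xi; rewrite (entry_dotp hd). Qed.

(** [nu] composed with the canonical conditional expectation of the crossed product onto [M]. *)
Definition dual_state x : C := nu (entry delta x 1%g 1%g).
Local Notation nuh := dual_state.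

Lemma entry_id g h : entry delta id g h = if g == h then id else 0.
Proof.
by apply/funext => xi; rewrite /entry /= (coord_delta hd); case: ifP.
Qed.

Lemma entryB x y g h : entry delta (x - y) g h = entry delta x g h - entry delta y g h.
Proof. by rewrite -scaleN1r addrC entry_lin scaleN1r addrC. Qed.

Lemma entry_increasing_sup D s : increasing_sup N D s ->
  increasing_sup M ((fun x => entry delta x 1%g 1%g) @` D) (entry delta s 1%g 1%g).
Proof.
move=> hs; case: (hs) => -[D0 DN] dirD [Ns ub] _.
have le x y : op_le x y -> op_le (entry delta x 1%g 1%g) (entry delta y 1%g 1%g).
  by move=> h; rewrite /op_le -entryB; exact: entry_pos.
apply: sot_increasing_sup.
- split; first by have [d Dd] := D0; exists (entry delta d 1%g 1%g), d.
  move=> _ _ [x Dx <-] [y Dy <-]; have [z [Dz xz yz]] := dirD _ _ Dx Dy.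
  by exists (entry delta z 1%g 1%g); split; [exists z|exact: le|exact: le].
- by move=> _ [x /DN[Nx px] <-]; split; [exact: crossed_entry|exact: entry_pos].
- exact: crossed_entry.
- by move=> _ [x Dx <-]; apply: le; exact: ub.
- move=> u e e0; have [d Dd hdd] := increasing_sup_qf hN (delta 1%g u) hs e0.
  by exists (entry delta d 1%g 1%g); [exists d|rewrite !qf_entry].
Qed.

(** Faithfulness: if the first diagonal entry of a positive [x] vanishes, covariance makes all of
    them vanish, and a positive operator kills every vector at which its form is zero. Normality: a
    diagonal entry is a compression, which preserves increasing suprema. *)
Lemma dual_state_faithful_normal : faithful_normal_state N nuh.
Proof.
split.
- move=> a x y Nx Ny; rewrite /nuh entry_lin (stL hnu)//; exact: crossed_entry.
- split; last by rewrite /nuh entry_id eqxx (st_id hnu).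
  by move=> x Nx px; apply: (st_ge0 hnu); [exact: crossed_entry|exact: entry_pos].
- move=> x Nx px h0; have bx := vn_bop hN Nx; have [_ Mx cx] := Ncov Nx.
  have e0 : entry delta x 1%g 1%g = 0.
    by apply: (st_eq0 hnu) => //; exact: entry_pos.
  apply: (hs_bop_ext hd bx (bop0 _ _)) => g xi.
  apply: pos_qf0 => //; rewrite -qf_entry.
  have := cx 1%g 1%g g; rewrite mul1g e0 => ->.
  by rewrite (aut0 hM) qf0.
- move=> D s /entry_increasing_sup hs; case: hnu => _ _ _ /(_ _ _ hs).
  by rewrite image_comp.
Qed.

Lemma entry_sqr x xi : N x ->
  qf (entry delta (adj x \o x) 1%g 1%g) xi = nr (x (delta 1%g xi)) ^+ 2.
Proof.
move=> Nx; have bx := vn_bop hN Nx.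
by rewrite qf_entry /qf /= adj_dotp'// re_dotpxx.
Qed.

(* [(x^* x)_(1,1)] is the supremum of the finite sums of [x_(g,1)^* x_(g,1)]. *)
Lemma dual_state_sqr x : N x ->
  (forall F : {fset G}, \sum_(g <- F) nr (La (entry delta x g 1%g)) ^+ 2 <= re (nuh (adj x \o x))) /\
  (forall e, 0 < e -> exists F : {fset G},
    re (nuh (adj x \o x)) - e < \sum_(g <- F) nr (La (entry delta x g 1%g)) ^+ 2).
Proof.
move=> Nx; have bx := vn_bop hN Nx; have Nxx : N (adj x \o x) by exact: vn_sqr.
have Mx g : M (entry delta x g 1%g) by exact: crossed_entry.
pose t g := adj (entry delta x g 1%g) \o entry delta x g 1%g.
have Mt g : M (t g) by exact: (vn_sqr hM).
have bt g : op_pos (t g) by apply: op_pos_sqr; exact: vn_bop (Mx g).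
pose s (F : {fset G}) := \sum_(g <- F) t g.
have Ms F : M (s F) by apply: (vn_sum hM) => g _.
have ps F : op_pos (s F).
  rewrite /s; elim/big_ind : _ => [|? ? ? ?|g _]; [exact: op_pos0|exact: op_posD|exact: bt].
have qs F u : qf (s F) u = \sum_(g <- F) nr (co g (x (delta 1%g u))) ^+ 2.
  rewrite /qf /s fct_sum dotp_suml re_sum; apply: eq_bigr => g _.
  by rewrite /t /= adj_dotp' ?re_dotpxx//; exact: vn_bop (Mx g).
have ns F : re (nu (s F)) = \sum_(g <- F) nr (La (entry delta x g 1%g)) ^+ 2.
  rewrite (st_sum hM hnu)// re_sum; apply: eq_bigr => g _.
  by rewrite -(L2_sqr hLa).
have Ma : M (entry delta (adj x \o x) 1%g 1%g) by exact: crossed_entry.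
have pa : op_pos (entry delta (adj x \o x) 1%g 1%g) by apply: entry_pos; exact: op_pos_sqr.
have sa F : op_le (s F) (entry delta (adj x \o x) 1%g 1%g).
  by apply: qf_op_le => // u; rewrite qs entry_sqr//; exact: bessel.
split; first by move=> F; rewrite -ns; exact: (st_leR hM hnu).
move=> e e0.
(* By Parseval the finite sums increase to the first diagonal entry of [x^* x]; normality of [nu]
   transfers this to sums of squared norms. *)
have hs : increasing_sup M (s @` setT) (entry delta (adj x \o x) 1%g 1%g).
  apply: sot_increasing_sup => //.
  - split; first by exists (s fset0), fset0.
    move=> _ _ [F _ <-] [F' _ <-]; exists (s (F `|` F')%fset).
    split; first by exists (F `|` F')%fset.
      apply: qf_op_le => // u; rewrite !qs; apply: ler_sum_fset => [g gF|g].
        by rewrite inE gF.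
      exact: sqr_ge0.
    apply: qf_op_le => // u; rewrite !qs; apply: ler_sum_fset => [g gF|g].
      by rewrite inE gF orbT.
    exact: sqr_ge0.
  - by move=> _ [F _ <-].
  - by move=> _ [F _ <-].
  - move=> u d d0; have FF := fin_filter_proper G.
    have h : \forall F \near (@fin_filter G : set_system {fset G}),
        `|re (dotp (x (delta 1%g u)) (x (delta 1%g u))) -
          re (\sum_(g <- (F : {fset G})) dotp (co g (x (delta 1%g u))) (co g (x (delta 1%g u))))| < d.
      by apply: cvg_re d0; exact: (parseval hd).
    have [F hF] := filter_ex h; exists (s F); first by exists F.
    move: hF; rewrite entry_sqr// qs re_dotpxx re_sum.
    under eq_bigr do rewrite re_dotpxx.
    by rewrite ltr_norml => /andP[_]; lra.
have [_ [F _ <-] hF] := st_sup hnu hs e0; exists F; rewrite -ns; exact: hF.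
Qed.

Variables (Lh : hilbertType R) (dh : G -> K -> Lh) (hdh : hilbert_sum (I := G) dh).

(** The GNS map of the dual state. Only the first column of [x] is recorded, since covariance
    determines the others; [dual_state_sqr] and [hs_synth] provide the vector. *)
Definition dual_La x : Lh :=
  xget 0 [set v | forall g, coord dh g v = La (entry delta x g 1%g)].
Local Notation Lah := dual_La.

Lemma coord_dual_La x g : N x -> coord dh g (Lah x) = La (entry delta x g 1%g).
Proof.
move=> Nx; have [h _] := dual_state_sqr Nx.
have [v hv] := hs_synth hdh h.
by have := @xgetPex _ 0 [set v | forall g, coord dh g v = La (entry delta x g 1%g)] (ex_intro _ v hv); apply.
Qed.

Lemma dual_La_nr x : N x -> nr (Lah x) ^+ 2 = re (nuh (adj x \o x)).
Proof.
move=> Nx; have [h1 h2] := dual_state_sqr Nx; apply/eqP; rewrite eq_le; apply/andP; split.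
  have n0 : 0 <= re (nuh (adj x \o x)) by have := h1 fset0; rewrite big_seq_fset0.
  rewrite -[leRHS]sqr_sqrtr// ler_pXn2r ?nnegrE ?nr_ge0 ?sqrtr_ge0//.
  apply: (nr_le_trunc hdh) => F.
  rewrite -(@ler_pXn2r _ 2) ?nnegrE ?nr_ge0 ?sqrtr_ge0// sqr_sqrtr// (trunc_nr hdh).
  by under eq_bigr do rewrite coord_dual_La//; exact: h1.
apply/ler_addgt0Pl => e e0; have [F hF] := h2 e e0.
have := bessel hdh F (Lah x).
under eq_bigr do rewrite coord_dual_La//.
lra.
Qed.

Lemma dual_La_lin : linear_on N Lah.
Proof.
move=> a x y Nx Ny; apply: (coord_inj hdh) => g.
rewrite (coord_lin hdh) !coord_dual_La//; last exact: vn_lin.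
by rewrite entry_lin (L2_lin hLa)//; exact: crossed_entry.
Qed.

(** Elements whose first column has a single entry; their images span a dense subspace of [Lh]. *)
Lemma dual_La_single g m : M m -> Lah (lam_op delta g \o pi_op alpha delta m) = dh g (La m).
Proof.
move=> Mm; have Np := pi_crossed alpha M_vn hd Mm.
have Nl := lam_crossed alpha hd g.
apply: (coord_inj hdh) => k; rewrite coord_dual_La; last exact: (vn_comp hN).
rewrite (coord_delta hdh).
have -> : entry delta (lam_op delta g \o pi_op alpha delta m) k 1%g = if k == g then m else 0.
  apply/funext => xi; rewrite /entry /= (pi_delta alpha M_vn hd)// invg1 (alpha1 alpha_action)//.
  by rewrite (lam_delta hd) mulg1 (coord_delta hd); case: ifP.
by case: ifP => // _; exact: (L2_0 hM hLa).
Qed.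

Lemma dual_La_dense v : adh (Lah @` N) v.
Proof.
have Lin (a : C) x y : N x -> N y -> Lah (a *: x + y) = a *: Lah x + Lah y.
  exact: dual_La_lin.
have cl a u w : adh (Lah @` N) u -> adh (Lah @` N) w -> adh (Lah @` N) (a *: u + w).
  exact: (adh_image_lin (vn_lsub hN) Lin).
have A0 : adh (Lah @` N) 0.
  apply: adh_sub; exists 0; first exact: vn0.
  by have := Lin (-1) _ _ (vn0 hN) (vn0 hN); rewrite scaleN1r addNr scaleN1r addNr.
have Ad g w : adh (Lah @` N) (dh g w).
  move=> e e0; have [_ [m Mm <-] hm] := L2_dense hLa w e0.
  exists (dh g (La m)).
    exists (lam_op delta g \o pi_op alpha delta m); last exact: dual_La_single.
    apply: (vn_comp hN); [exact: (lam_crossed alpha hd)|exact: (pi_crossed alpha M_vn hd Mm)].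
  by rewrite -(linBE _ _ (hs_lin hdh g)) (hs_nr hdh).
move=> e e0; have e2 : 0 < e / 2 by rewrite divr_gt0.
have [_ _ /dense_adh /(_ v _ e2) [w [n [g [xi wE]]] hw]] := hdh.
have Aw : adh (Lah @` N) w.
  rewrite wE; elim/big_ind : _ => [|x y hx hy|i _]; [exact: A0| |exact: Ad].
  by rewrite -[x]scale1r; exact: cl.
have [z Az hz] := Aw _ e2; exists z => //; apply: le_lt_trans (nr_tri _ w _) _; lra.
Qed.

(** Inner products are recovered from the norm identity [dual_La_nr] by polarisation. *)
Lemma dual_La_L2 : is_L2 N nuh Lah.
Proof.
split; [exact: dual_La_lin| |by apply/dense_adh; exact: dual_La_dense].
move=> x y Nx Ny; have hnuh := dual_state_faithful_normal.
have s1 : sesq N (fun x y => dotp (Lah x) (Lah y)).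
  split=> a u v w Nu Nv Nw; rewrite dual_La_lin//; first by rewrite dotpPl.
  by rewrite dotpDr dotpZr.
have s2 : sesq N (fun x y => nuh (adj y \o x)).
  split=> a u v w Nu Nv Nw; have [bu bv bw] := And3 (vn_bop hN Nu) (vn_bop hN Nv) (vn_bop hN Nw).
    have -> : adj w \o (a *: u + v) = a *: (adj w \o u) + (adj w \o v).
      by apply/funext => z; rewrite /= !fctE (bop_adj bw).1.
    by rewrite (stL hnuh)//; apply: (vn_comp hN) => //; exact: vn_adj.
  rewrite adj_lin//.
  have -> : (a^* *: adj v + adj w) \o u = a^* *: (adj v \o u) + (adj w \o u) by [].
  by rewrite (stL hnuh)//; apply: (vn_comp hN) => //; exact: vn_adj.
apply: (sesq_ext (vn_lsub hN) s1 s2) => // z Nz; rewrite dotpxx dual_La_nr//.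
have p0 : 0 <= nuh (adj z \o z).
  by apply: (st_ge0 hnuh); [exact: vn_sqr|apply: op_pos_sqr; exact: vn_bop Nz].
by rewrite [RHS](cge0E p0).
Qed.

End DualState.

(** * Schur multipliers on the crossed product *)

Section SchurProduct.
Variables (R : realType) (T : finType).
Local Notation C := R[i].
Local Notation re := (@complex.Re R).
Local Notation "x %:C" := (real_complex _ x) : ring_scope.
Implicit Types (k : T -> T -> C).

Definition psd k := forall c : T -> C, 0 <= \sum_i \sum_j (c i)^* * c j * k i j.

Let B k (c d : T -> C^o) : C := \sum_i \sum_j (d i)^* * c j * k i j.

Let B_sesq k : sesq [set: T -> C^o] (B k).
Proof.
split=> a x y z _ _ _; rewrite /B mulr_sumr -big_split/=; apply: eq_bigr => i _;
  rewrite mulr_sumr -big_split/=; apply: eq_bigr => j _; rewrite !fctE.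
  by rewrite /GRing.scale/=; ring.
by rewrite rmorphD rmorphM /=; ring.
Qed.

Let e (i : T) : T -> C^o := fun j => if j == i then 1 else 0.

Let sum_e (F : T -> C) i : \sum_j (if j == i then F j else 0) = F i.
Proof. by rewrite (bigD1 i)//= eqxx big1 ?addr0// => j /negPf ->. Qed.

Let Be k c i : B k c (e i) = \sum_j c j * k i j.
Proof.
rewrite -[RHS](sum_e (fun i => \sum_j c j * k i j)); apply: eq_bigr => l _.
rewrite /e; case: eqP => _; first by apply: eq_bigr => j _; rewrite rmorph1 mul1r.
by apply: big1 => j _; rewrite rmorph0 !mul0r.
Qed.

Let Bee k i j : B k (e j) (e i) = k i j.
Proof.
rewrite Be -[RHS](sum_e (k i)); apply: eq_bigr => l _.
by rewrite /e; case: eqP => _; rewrite ?mul1r ?mul0r.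
Qed.

Lemma psd_herm k i j : psd k -> k j i = (k i j)^*.
Proof.
move=> hk; rewrite -!Bee.
by apply: (sesq_herm (lsubT _) (B_sesq k)) => // c _; exact: hk.
Qed.

Lemma psd_diag k i : psd k -> 0 <= k i i.
Proof. by move=> hk; rewrite -Bee; exact: hk. Qed.

Lemma psd_CS k i j : psd k -> nr (k i j) ^+ 2 <= re (k i i) * re (k j j).
Proof.
move=> hk; rewrite -!Bee [leRHS]mulrC.
by apply: (cauchy_schwarz (lsubT _) (B_sesq k)) => // c _; exact: hk.
Qed.

Lemma psd_diag0 k i j : psd k -> k i i = 0 -> k i j = 0.
Proof.
move=> hk h; have := psd_CS i j hk; rewrite h mul0r => h'.
by apply: nr0_eq0; apply/eqP; rewrite -sqrf_eq0 eq_le h' sqr_ge0.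
Qed.

(** The Schur complement at [a]; its positivity is Cauchy-Schwarz for the form of [k] at [c] and at
    the unit vector of index [a]. *)
Lemma psd_pivot k a : psd k -> k a a != 0 ->
  psd (fun i j => k i j - k i a * k a j / k a a).
Proof.
move=> hk a0 c; have haa := psd_diag a hk.
have raa : 0 < re (k a a).
  rewrite lt_def; have /cge0P[-> _] := haa; rewrite andbT.
  by apply: contra a0 => /eqP h; rewrite (cge0E haa) h.
have := cauchy_schwarz (lsubT _) (B_sesq k) (fun c _ => hk c) (x := c) (y := e a) I I.
rewrite Bee Be -ler_pdivrMr// => h.
set z := \sum_j _ in h.
have -> : \sum_i \sum_j (c i)^* * c j * (k i j - k i a * k a j / k a a) =
    B k c c - (nr z ^+ 2 / re (k a a))%:C.
  have -> : (nr z ^+ 2 / re (k a a))%:C = z^* * z / k a a.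
    by rewrite [z^* * z]mulrC mulcJ [k a a in RHS](cge0E haa) rmorphM fmorphV.
  rewrite {1}/z rmorph_sum mulr_suml mulr_suml /B -sumrB; apply: eq_bigr => i _.
  rewrite /z mulr_sumr mulr_suml -sumrB; apply: eq_bigr => j _ /=.
  rewrite rmorphM /= -(psd_herm a i hk); ring.
have bkk : 0 <= B k c c := hk c.
by rewrite subr_ge0 (cge0E bkk) lecR; exact: h.
Qed.

(* Gaussian elimination: subtracting a rank one kernel kills a diagonal entry. *)
Lemma schur_product (H : hilbertType R) k (A : T -> T -> H -> H) : psd k ->
  (forall i j, linear (A i j)) -> mpos A -> mpos (fun i j => k i j *: A i j).
Proof.
move=> + lA pA; move: {2}#|[set i | k i i != 0]%SET| (leqnn #|[set i | k i i != 0]%SET|) => n.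
(* Induction on a bound for the number of non-zero diagonal entries; when there are none,
   Cauchy-Schwarz makes the whole kernel zero. *)
elim: n k => [|n IH] k.
  rewrite leqn0 cards_eq0 => /eqP k0 hk xi; rewrite big1// => i _; rewrite big1// => j _.
  rewrite psd_diag0 ?scale0r ?(dotp0l (xi i))//.
  by apply/eqP; have := finset.in_set0 i; rewrite -k0 inE => /negbFE.
move=> kn hk; have [k0|[a]] := set_0Vmem [set i | k i i != 0]%SET.
  by apply: IH => //; rewrite k0 cards0.
rewrite inE => a0; pose k' i j := k i j - k i a * k a j / k a a.
have hk' : psd k' by exact: psd_pivot.
have := IH k' _ hk' => /(_ _) IHk'.
have {}IHk' : mpos (fun i j => k' i j *: A i j).
  apply: IHk'; rewrite -ltnS; apply: leq_trans kn; apply: proper_card.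
  apply/properP; split.
    apply/fintype.subsetP => i; rewrite !inE; apply: contra => /eqP ki.
    by rewrite /k' ki (psd_diag0 a hk ki) !mul0r subrr.
  by exists a; rewrite inE// negbK /k' mulfK// subrr.
move=> xi; have haa := psd_diag a hk.
(* The rank one part that was removed only rescales the vectors, so it inherits positivity from
   [A]. *)
have -> : \sum_i \sum_j dotp ((k i j *: A i j) (xi j)) (xi i) =
  \sum_i \sum_j dotp ((k' i j *: A i j) (xi j)) (xi i) +
  (k a a)^-1 * \sum_i \sum_j dotp (A i j (k a j *: xi j)) (k a i *: xi i).
  rewrite mulr_sumr -big_split /=; apply: eq_bigr => i _.
  rewrite mulr_sumr -big_split /=; apply: eq_bigr => j _.
  rewrite !fctE linZE// !dotpZl dotpZr -(psd_herm a i hk) /k'; ring.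
by apply: addr_ge0 => //; apply: mulr_ge0; [rewrite invr_ge0|exact: pA].
Qed.

End SchurProduct.

(** Positive definiteness is stated for [g_i^-1 g_j], so it is applied at the inverses of the
    points. *)
Lemma positive_definite_psd (R : realType) (G : groupType) (phi : G -> R[i]) (T : finType)
    (f : T -> G) : positive_definite phi -> psd (fun i j => phi (f i * (f j)^-1)%g).
Proof.
move=> hphi c.
have := hphi #|T| (fun i => (f (enum_val i))^-1%g) (fun i => c (enum_val i)).
congr (_ <= _); rewrite [RHS](reindex (@enum_val T xpredT)) /=; last first.
  by exists enum_rank => ? _; [exact: enum_valK|exact: enum_rankK].
apply: eq_bigr => i _; rewrite [RHS](reindex (@enum_val T xpredT)) /=; last first.
  by exists enum_rank => ? _; [exact: enum_valK|exact: enum_rankK].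
by apply: eq_bigr => j _; rewrite invgK.
Qed.

Section MatrixOperator.
Variables (R : realType) (G : choiceType) (H L : hilbertType R) (delta : G -> H -> L).
Local Notation C := R[i].
Local Notation re := (@complex.Re R).
Local Notation "x %:C" := (real_complex _ x) : ring_scope.
Hypothesis hd : hilbert_sum delta.
Local Notation co := (coord delta).

(** An infinite matrix with uniformly bounded finite sections defines an operator. The bound is
    asked for sesquilinear forms, because that is what a positivity argument delivers. *)
Lemma hs_matrix_operator (b : G -> G -> H -> H) (c : R) : 0 <= c ->
  (forall g h, linear (b g h)) ->
  (forall (F : {fset G}) (u v : G -> H),
     nr (\sum_(g <- F) \sum_(h <- F) dotp (b g h (v h)) (u g)) ^+ 2 <=
     c ^+ 2 * (\sum_(g <- F) nr (v g) ^+ 2) * (\sum_(g <- F) nr (u g) ^+ 2)) ->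
  exists2 A : L -> L, bop A & forall g h xi, co g (A (delta h xi)) = b g h xi.
Proof.
move=> c0 lb hb.
have restr (F F' : {fset G}) (V : nmodType) (f : G -> V) : {subset F <= F'} ->
    \sum_(g <- F') (if g \in F then f g else 0) = \sum_(g <- F) f g.
  move=> FF'; rewrite (sum_fsetD _ FF') [X in _ + X]big1_fset ?addr0.
    by rewrite big_seq [RHS]big_seq; apply: eq_bigr => g ->.
  by move=> g; rewrite inE => /andP[/negPf ->].
(* Testing the form against the image vector itself turns the form bound into a norm bound. Rows
   [F'] and columns [F] are enlarged to one common section, with zeros outside. *)
have key (F F' : {fset G}) (v : G -> H) :
    \sum_(g <- F') nr (\sum_(h <- F) b g h (v h)) ^+ 2 <= c ^+ 2 * \sum_(h <- F) nr (v h) ^+ 2.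
  set w := fun g => \sum_(h <- F) b g h (v h).
  pose E := (F `|` F')%fset.
  have FE : {subset F <= E} by move=> g gF; rewrite inE gF.
  have F'E : {subset F' <= E} by move=> g gF; rewrite inE gF orbT.
  have := hb E (fun g => if g \in F' then w g else 0) (fun g => if g \in F then v g else 0).
  have -> : \sum_(g <- E) \sum_(h <- E) dotp (b g h (if h \in F then v h else 0))
      (if g \in F' then w g else 0) = (\sum_(g <- F') nr (w g) ^+ 2)%:C.
    transitivity (\sum_(g <- E) if g \in F' then dotp (w g) (w g) else 0).
      apply: eq_bigr => g _; case: ifP => _; last by rewrite big1// => h _; rewrite dotp0r.
      rewrite -dotp_suml; congr (dotp _ _); rewrite /w -(restr F E)//.
      by apply: eq_bigr => h _; case: ifP => // _; exact: lin0.
    by rewrite restr// rmorph_sum; apply: eq_bigr => g _; rewrite dotpxx.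
  have -> : \sum_(g <- E) nr (if g \in F then v g else 0) ^+ 2 = \sum_(g <- F) nr (v g) ^+ 2.
    by rewrite -(restr F E)//; apply: eq_bigr => g _; case: ifP => // _; rewrite nr0 expr0n.
  have -> : \sum_(g <- E) nr (if g \in F' then w g else 0) ^+ 2 = \sum_(g <- F') nr (w g) ^+ 2.
    by rewrite -(restr F' E)//; apply: eq_bigr => g _; case: ifP => // _; rewrite nr0 expr0n.
  set W := \sum_(g <- F') _; have W0 : 0 <= W by apply: sumr_ge0 => g _; exact: sqr_ge0.
  rewrite nr_real ger0_norm// expr2; have [->|Wn] := eqVneq W 0.
    by move=> _; rewrite mulr_ge0 ?sqr_ge0// sumr_ge0// => g _; exact: sqr_ge0.
  by rewrite ler_pM2r// lt_def Wn.
have colE h xi : exists T : L, forall g, co g T = b g h xi.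
  apply: (hs_synth hd (B := c ^+ 2 * nr xi ^+ 2)) => F.
  by have := key [fset h]%fset F (fun=> xi); under eq_bigr do rewrite big_seq_fset1;
    rewrite big_seq_fset1.
have /choice[T hT] : forall h, exists T : H -> L, forall xi g, co g (T xi) = b g h xi.
  by move=> h; have [T hT] := choice (colE h); exists T.
have lT h : linear (T h).
  by move=> a x y; apply: (coord_inj hd) => g; rewrite (coord_lin hd) !hT lb.
have bT (F : {fset G}) (x : G -> H) :
    nr (\sum_(g <- F) T g (x g)) ^+ 2 <= c ^+ 2 * \sum_(g <- F) nr (x g) ^+ 2.
  set S := c ^+ 2 * _; have S0 : 0 <= S.
    by rewrite mulr_ge0 ?sqr_ge0// sumr_ge0// => g _; exact: sqr_ge0.
  rewrite -[leRHS]sqr_sqrtr// ler_pXn2r ?nnegrE ?nr_ge0 ?sqrtr_ge0//.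
  apply: (nr_le_trunc hd) => F'.
  rewrite -(@ler_pXn2r _ 2) ?nnegrE ?nr_ge0 ?sqrtr_ge0// sqr_sqrtr// (trunc_nr hd).
  apply: le_trans (key F F' x); rewrite le_eqVlt; apply/orP; left; apply/eqP.
  apply: eq_bigr => g _; rewrite (lin_sum _ _ _ (coord_lin hd g)).
  by congr (nr _ ^+ 2); apply: eq_bigr => h _; rewrite hT.
have [A [lA bA AE]] := hs_operator hd c0 lT bT.
exists A; first by split=> //; exists c.
by move=> g h xi; rewrite AE hT.
Qed.

End MatrixOperator.

Section Multiplier.
Variables (R : realType) (H : hilbertType R) (M : set (H -> H)) (nu : (H -> H) -> R[i]).
Variables (G : groupType) (alpha : G -> vn_aut M nu) (L : hilbertType R) (delta : G -> H -> L).
Local Notation C := R[i].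
Local Notation re := (@complex.Re R).
Local Notation "x %:C" := (real_complex _ x) : ring_scope.
Hypotheses (M_vn : von_neumann M) (hnu : faithful_normal_state M nu).
Hypotheses (alpha_action : is_action alpha) (hd : hilbert_sum (I := G) delta).
Variables (K : hilbertType R) (La : (H -> H) -> K) (hLa : is_L2 M nu La).
Let hM : vn_alg M := von_neumann_alg M_vn.
Local Notation co := (coord delta).
Local Notation N := (crossed_product delta alpha).
Let hN : vn_alg N := crossed_vn_alg M_vn hnu alpha_action hd hLa.
Let Ncov : forall x, N x -> covariant alpha delta x := crossed_covariant M_vn hnu alpha_action hd hLa.
Variables (phi : G -> C) (hphi : positive_definite phi) (phi1 : phi 1%g = 1).
Variables (psi : (H -> H) -> (H -> H)) (hpsi : ucp M psi).
Hypothesis psi_equiv : forall g m, M m -> psi (alpha g m) = alpha g (psi m).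
Implicit Types (g h k : G) (m : H -> H) (x y : L -> L) (xi eta : H) (F : {fset G}).

Let Mx x g h : N x -> M (entry delta x g h).
Proof. exact: (crossed_entry M_vn hnu alpha_action hd hLa). Qed.

(** A matrix over the crossed product, restricted to finitely supported vectors, becomes a matrix
    over [M] indexed by pairs: [p] gives the block and [f] the group element. *)
Let matrix_sum (T : finType) (E : finType) (f : T -> G) (p : T -> E)
    (x : E -> E -> L -> L) (xi : T -> H) : (forall i j, linear (x i j)) ->
  \sum_s \sum_t dotp (entry delta (x (p s) (p t)) (f s) (f t) (xi t)) (xi s) =
  \sum_i \sum_j dotp (x i j (\sum_(t | p t == j) delta (f t) (xi t)))
                     (\sum_(s | p s == i) delta (f s) (xi s)).
Proof.
move=> lx; rewrite (partition_big p xpredT)//=; apply: eq_bigr => i _.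
transitivity (\sum_(s | p s == i) \sum_j \sum_(t | p t == j)
    dotp (entry delta (x i j) (f s) (f t) (xi t)) (xi s)).
  apply: eq_bigr => s /eqP <-; rewrite (partition_big p xpredT)//=.
  by apply: eq_bigr => j _; apply: eq_bigr => t /eqP <-.
rewrite exchange_big /=; apply: eq_bigr => j _.
rewrite dotp_sumr; apply: eq_bigr => s _; rewrite (lin_sum _ _ _ (lx i j)) dotp_suml.
by apply: eq_bigr => t _; rewrite (entry_dotp hd).
Qed.

Let multiplier_mpos (T : finType) (f : T -> G) (A : T -> T -> H -> H) :
  (forall i j, M (A i j)) -> mpos A ->
  mpos (fun i j => phi (f i * (f j)^-1)%g *: psi (A i j)).
Proof.
move=> MA pA; apply: schur_product.
- exact: positive_definite_psd.
- by move=> i j; apply: (vn_linear hM); exact: (ucp_in hpsi).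
- exact: (ucp_cp hpsi).
Qed.

Let phiV g : phi g^-1%g = (phi g)^*.
Proof.
have := psd_herm true false (positive_definite_psd (fun b : bool => if b then g else 1%g) hphi).
by rewrite /= invg1 mulg1 mul1g.
Qed.

Let b x g h := phi (g * h^-1)%g *: psi (entry delta x g h).

Let b_linear x g h : N x -> linear (b x g h).
Proof.
move=> Nx; apply: (vn_linear hM); apply: (vnZ hM); apply: (ucp_in hpsi); exact: Mx.
Qed.

Let b_adj x g h xi eta : N x -> dotp (b (adj x) g h xi) eta = (dotp (b x h g eta) xi)^*.
Proof.
move=> Nx; have bx := vn_bop hN Nx.
rewrite /b !fctE !dotpZl (entry_adj hd)// (ucp_adj hM hpsi); last exact: Mx.
rewrite rmorphM/= -phiV invgM invgK -[(dotp _ xi)^*]dotpC adj_dotp'//.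
by apply: (vn_bop hM); apply: (ucp_in hpsi); exact: Mx.
Qed.

(* The entrywise image of [[c, x], [x^*, c]], which is positive if [|x| <= c]. *)
Let b_form x (c : R) F (u v : G -> H) : N x -> 0 <= c -> (forall w, nr (x w) <= c * nr w) ->
  0 <= c * (\sum_(g <- F) nr (u g) ^+ 2 + \sum_(g <- F) nr (v g) ^+ 2) +
     2 * re (\sum_(g <- F) \sum_(h <- F) dotp (b x g h (v h)) (u g)).
Proof.
move=> Nx c0 hc; have bx := vn_bop hN Nx; have Nx' := vn_adj hN Nx.
pose X (s t : bool) : L -> L :=
  if s then (if t then c%:C *: id else x) else (if t then adj x else c%:C *: id).
have NX s t : N (X s t).
  by case: s; case: t => //=; apply: (vnZ hN); exact: vn_id.
pose T : finType := (bool * F)%type.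
pose f (s : T) : G := val s.2; pose p (s : T) : bool := s.1.
pose A (s t : T) := entry delta (X (p s) (p t)) (f s) (f t).
have pA : mpos A.
  move=> xi; rewrite /A matrix_sum; last by move=> i j; exact: vn_linear (NX i j).
  rewrite !big_bool /=; set U := \sum_(s | s.1 == true) _; set V := \sum_(s | s.1 == false) _.
  rewrite !fctE !dotpZl adj_dotp'// !dotpxx.
  rewrite (dotpC (x V) U).
  apply/cge0P; split.
    rewrite !reimE; have := re_abs (dotp (x V) U).
    rewrite ler_norml => /andP[+ _]; have := dotp_CS (x V) U; have := hc V.
    have := nr_ge0 U; have := nr_ge0 V; have := nr_ge0 (x V).
    move: (nr (dotp (x V) U)) (re _) (nr (x V)) (nr U) (nr V) => q r n nU nV n0 V0 U0 h1 h2 h3.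
    have : n * nU <= c * nV * nU by rewrite ler_wpM2r.
    have := mulr_ge0 c0 (sqr_ge0 (nU - nV)); nra.
  by rewrite !reimE; ring.
have MA s t : M (A s t) by exact: Mx.
have sumT (f1 : bool -> G -> C) : \sum_(s : T) f1 s.1 (val s.2) =
    \sum_(g <- F) f1 true g + \sum_(g <- F) f1 false g.
  by rewrite -(pair_big xpredT xpredT (fun s (g : F) => f1 s (val g)))/= big_bool !big_seq_fsetE.
have := multiplier_mpos f MA pA (fun s => if s.1 then u (val s.2) else v (val s.2)).
set Z := \sum_(s : T) _.
(* The form splits along the four blocks of [X]. *)
have -> : Z = \sum_(g <- F) \sum_(h <- F) dotp (phi (g * h^-1)%g *:
        psi (entry delta (c%:C *: id) g h) (u h)) (u g) +
    \sum_(g <- F) \sum_(h <- F) dotp (b x g h (v h)) (u g) +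
    (\sum_(g <- F) \sum_(h <- F) dotp (b (adj x) g h (u h)) (v g) +
    \sum_(g <- F) \sum_(h <- F) dotp (phi (g * h^-1)%g *:
        psi (entry delta (c%:C *: id) g h) (v h)) (v g)).
  rewrite /Z (eq_bigr (fun s : T => \sum_(h <- F)
      dotp (phi (val s.2 * h^-1)%g *: psi (entry delta (X s.1 true) (val s.2) h) (u h))
        (if s.1 then u (val s.2) else v (val s.2)) + \sum_(h <- F)
      dotp (phi (val s.2 * h^-1)%g *: psi (entry delta (X s.1 false) (val s.2) h) (v h))
        (if s.1 then u (val s.2) else v (val s.2)))); last first.
    move=> s _; rewrite -(sumT (fun t h =>
      dotp (phi (val s.2 * h^-1)%g *: psi (entry delta (X s.1 t) (val s.2) h)
         (if t then u h else v h)) (if s.1 then u (val s.2) else v (val s.2)))).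
    by apply: eq_bigr => -[t h] _.
  rewrite big_split /=.
  rewrite (sumT (fun t g => \sum_(h <- F) dotp (phi (g * h^-1)%g *:
     psi (entry delta (X t true) g h) (u h)) (if t then u g else v g))).
  rewrite (sumT (fun t g => \sum_(h <- F) dotp (phi (g * h^-1)%g *:
     psi (entry delta (X t false) g h) (v h)) (if t then u g else v g))) /=.
  by rewrite addrACA.
(* The diagonal blocks remain [c] times the identity because [phi 1 = 1] and [psi id = id]. *)
have diag (w : G -> H) : \sum_(g <- F) \sum_(h <- F) dotp (phi (g * h^-1)%g *:
    psi (entry delta (c%:C *: id) g h) (w h)) (w g) = (c * \sum_(g <- F) nr (w g) ^+ 2)%:C.
  rewrite mulr_sumr rmorph_sum big_seq [RHS]big_seq; apply: eq_bigr => g gF /=.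
  transitivity (\sum_(h <- F) (if h == g then (c * nr (w g) ^+ 2)%:C else 0)); last first.
    by rewrite sum_delta gF.
  have Mid := vn_id hM.
  apply: eq_bigr => h _; have -> : entry delta (c%:C *: id) g h = c%:C *: entry delta id g h.
    by apply/funext => xi; rewrite /entry /= !fctE (linZE _ _ (coord_lin hd g)).
  rewrite (entry_id hd) eq_sym; case: eqP => [->|_].
    by rewrite mulgV phi1 scale1r (ucpZ hM hpsi)// (ucp_id hpsi) !fctE dotpZl dotpxx -rmorphM.
  by rewrite scaler0 (ucp0 hM hpsi) scaler0 (dotp0l (w g)).
rewrite !diag => hZ; have /cge0P[+ _] := hZ.
have -> : \sum_(g <- F) \sum_(h <- F) dotp (b (adj x) g h (u h)) (v g) =
    (\sum_(g <- F) \sum_(h <- F) dotp (b x g h (v h)) (u g))^*.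
  rewrite rmorph_sum exchange_big /=; apply: eq_bigr => g _.
  by rewrite rmorph_sum; apply: eq_bigr => h _; rewrite b_adj.
by rewrite !reimE; lra.
Qed.

(** Replacing [u] by [- t S u] in [b_form], where [S] is the value of the form, and minimising over
    real [t] gives [|S|^2 <= c^2 U V], so the entrywise matrix is bounded. It is covariant because
    [psi] is equivariant and [phi (g h^-1)] is invariant under right translation. *)
Lemma multiplier_exists x : N x -> exists2 T, N T &
  forall g h, entry delta T g h = phi (g * h^-1)%g *: psi (entry delta x g h).
Proof.
move=> Nx; have [lx [c c0 hc]] := vn_bop hN Nx.
have [g h|F u v|T bT TE] := @hs_matrix_operator R G H L delta hd (b x) c c0.
- exact: b_linear.
- set S := \sum_(g <- F) \sum_(h <- F) _; set V := \sum_(g <- F) nr (v g) ^+ 2.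
  set U := \sum_(g <- F) nr (u g) ^+ 2.
  have U0 : 0 <= U by apply: sumr_ge0 => g _; exact: sqr_ge0.
  have V0 : 0 <= V by apply: sumr_ge0 => g _; exact: sqr_ge0.
  have key (t : R) : 0 <= c * (t ^+ 2 * nr S ^+ 2 * U + V) - 2 * t * nr S ^+ 2.
    have := b_form F (fun g => (- t%:C * S) *: u g) v Nx c0 hc.
    have -> : \sum_(g <- F) nr ((- t%:C * S) *: u g) ^+ 2 = t ^+ 2 * nr S ^+ 2 * U.
      rewrite /U mulr_sumr; apply: eq_bigr => g _.
      by rewrite nrZ nrM nrN nr_real !exprMn real_normK// num_real.
    have -> (z : C) : \sum_(g <- F) \sum_(h <- F) dotp (b x g h (v h)) (z *: u g) = z^* * S.
      rewrite /S mulr_sumr; apply: eq_bigr => g _; rewrite mulr_sumr.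
      by apply: eq_bigr => h _; rewrite dotpZr.
    have -> : re ((- t%:C * S)^* * S) = - t * nr S ^+ 2.
      by rewrite nr_sqr !reimE; ring.
    by rewrite -/V; lra.
  have := sqr_ge0 (nr S); move: (nr S ^+ 2) key => m key m0.
  have [cU|cU] := eqVneq (c * U) 0.
    have -> : c ^+ 2 * V * U = (c * U) * (c * V) by ring.
    rewrite cU mul0r; have [->//|mn] := eqVneq m 0.
    (* When [c U = 0] the bound is affine in [t], and this [t] would make it [-1]. *)
    have := key ((c * V + 1) / (2 * m)).
    have -> : c * (((c * V + 1) / (2 * m)) ^+ 2 * m * U + V) - 2 * ((c * V + 1) / (2 * m)) * m =
       (c * U) * (((c * V + 1) / (2 * m)) ^+ 2 * m) - 1 by field.
    by rewrite cU mul0r; lra.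
  have cUp : 0 < c * U by rewrite lt_def cU mulr_ge0.
  have [cn Un] : c != 0 /\ U != 0.
    by split; apply: contra cU => /eqP ->; rewrite ?mul0r ?mulr0.
  have := key (c * U)^-1.
  have -> : c * ((c * U)^-1 ^+ 2 * m * U + V) - 2 * (c * U)^-1 * m =
     (c ^+ 2 * V * U - m) / (c * U) by field; apply/andP.
  by rewrite pmulr_lge0 ?invr_gt0// subr_ge0.
have TE' g h : entry delta T g h = b x g h by apply/funext => xi; exact: TE.
exists T => //; apply: (covariant_crossed M_vn hd); split=> // [g h|g h k].
  by rewrite TE'; apply: (vnZ hM); apply: (ucp_in hpsi); exact: Mx.
have [_ _ cx] := Ncov Nx.
rewrite !TE' /b cx psi_equiv; last exact: Mx.
rewrite invgM mulgA mulgK (autZ hM)//; apply: (ucp_in hpsi); exact: Mx.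
Qed.

Definition multiplier x : L -> L := xget 0 [set T | N T /\
  forall g h, entry delta T g h = phi (g * h^-1)%g *: psi (entry delta x g h)].

Let multiplierP x : N x -> N (multiplier x) /\
  forall g h, entry delta (multiplier x) g h = phi (g * h^-1)%g *: psi (entry delta x g h).
Proof.
move=> /multiplier_exists[T NT TE]; rewrite /multiplier.
by apply: (@xgetPex _ 0 [set T | N T /\
  forall g h, entry delta T g h = phi (g * h^-1)%g *: psi (entry delta x g h)]); exists T.
Qed.

Lemma multiplier_in x : N x -> N (multiplier x).
Proof. by case/multiplierP. Qed.

Lemma multiplier_entry x g h : N x ->
  entry delta (multiplier x) g h = phi (g * h^-1)%g *: psi (entry delta x g h).
Proof. by case/multiplierP. Qed.

Let N_ext x y : N x -> N y -> (forall g h, entry delta x g h = entry delta y g h) -> x = y.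
Proof. by move=> Nx Ny; apply: (entry_ext hd); exact: (vn_bop hN). Qed.

(** Complete positivity is verified on vectors truncated to a finite [F], where the form is that of
    a finite matrix over [M], and survives the limit over [F]. *)
Lemma multiplier_ucp : ucp N multiplier.
Proof.
split; first exact: multiplier_in.
- move=> a x y Nx Ny; have Nxy := vn_lin hN a Nx Ny.
  have [nx ny nxy] := And3 (multiplier_in Nx) (multiplier_in Ny) (multiplier_in Nxy).
  apply: N_ext => //; first exact: (vn_lin hN).
  move=> g h; have [_ ex] := multiplierP Nx; have [_ ey] := multiplierP Ny.
  have [_ exy] := multiplierP Nxy; rewrite exy !(entry_lin hd) ex ey.
  rewrite (ucpL hpsi); [|exact: Mx|exact: Mx].
  by rewrite scalerDr !scalerA mulrC.
- have Nid := vn_id hN; apply: N_ext => //; first exact: multiplier_in.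
  move=> g h; rewrite multiplier_entry// (entry_id hd); case: eqP => [->|_].
    by rewrite mulgV phi1 scale1r (ucp_id hpsi).
  by rewrite (ucp0 hM hpsi) scaler0.
- move=> n x Nx /matrix_posE px; apply/matrix_posE => xi.
  have Nm i j := multiplier_in (Nx i j); have FF := fin_filter_proper G.
  have h : (fun F : {fset G} => \sum_i \sum_j
      dotp (multiplier (x i j) (trunc delta F (xi j))) (trunc delta F (xi i))) @ @fin_filter G -->
      ((\sum_i \sum_j dotp (multiplier (x i j) (xi j)) (xi i) : C) : C^o).
    apply: cvgC_sum => i; apply: cvgC_sum => j.
    apply: cvg_dotp; last exact: trunc_cvg.
    by apply: bop_cvg; [exact: vn_bop (Nm i j)|exact: trunc_cvg].
  apply: (cvg_ge0 h); apply: filterE => F.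
  pose T : finType := ('I_n * F)%type.
  pose f (s : T) : G := val s.2; pose p (s : T) : 'I_n := s.1.
  pose A (s t : T) := entry delta (x (p s) (p t)) (f s) (f t).
  have MA s t : M (A s t) by exact: Mx.
  have pA : mpos A.
    move=> eta; rewrite /A matrix_sum; last by move=> i j; exact: vn_linear (Nx i j).
    exact: px.
  have := multiplier_mpos f MA pA (fun s => coord delta (val s.2) (xi s.1)).
  rewrite (eq_bigr (fun s => \sum_t dotp
    (entry delta (multiplier (x (p s) (p t))) (f s) (f t) (coord delta (val t.2) (xi t.1)))
    (coord delta (val s.2) (xi s.1)))); last first.
    by move=> s _; apply: eq_bigr => t _; rewrite multiplier_entry.
  rewrite (matrix_sum f p (x := fun i j => multiplier (x i j)) (fun s => coord delta (val s.2) (xi s.1))); last by move=> i j; exact: vn_linear (Nm i j).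
  have e i : \sum_(s : T | p s == i) delta (f s) (coord delta (val s.2) (xi s.1)) =
      trunc delta F (xi i).
    rewrite /trunc big_seq_fsetE /=.
    rewrite -[RHS](big_pred1_eq +%R i
      (fun j => \sum_(g : F) delta (val g) (coord delta (val g) (xi j)))).
    by rewrite pair_big_dep; apply: eq_bigl => s; rewrite andbT.
  by congr (_ <= _); apply: eq_bigr => i _; apply: eq_bigr => j _; rewrite !e.
Qed.

Hypothesis psi_state : forall m, M m -> nu (psi m) = nu m.

Lemma multiplier_state x : N x -> dual_state nu delta (multiplier x) = dual_state nu delta x.
Proof.
move=> Nx; rewrite /dual_state multiplier_entry// mulgV phi1 scale1r psi_state//.
exact: Mx.
Qed.

End Multiplier.

(** * Totally bounded sets *)

Lemma ultra_bigcup (T : Type) (I : eqType) (F : set_system T) (s : seq I) (B : I -> set T) :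
  UltraFilter F -> F (\bigcup_(y in [set` s]) B y) -> exists2 y, y \in s & F (B y).
Proof.
move=> FU; have FF : ProperFilter F by exact: ultra_proper.
elim: s => [|y s IH]; first by rewrite set_nil bigcup_set0 => /filter_not_empty.
have [FB _|FB hF] := in_ultra_setVsetC (B y) FU; first by exists y => //; exact: mem_head.
have [|z zs Fz] := IH; last by exists z => //; rewrite in_cons zs orbT.
apply: filterS (filterI hF FB) => a [[z /=]]; rewrite in_cons => /orP[/eqP ->//|zs Ba _].
by exists z.
Qed.

Section TotallyBounded.
Variable R : realType.
Local Notation C := R[i].
Local Notation re := (@complex.Re R).
Local Notation "x %:C" := (real_complex _ x) : ring_scope.

Definition totally_bounded (K : hilbertType R) (A : set K) := forall e : R, 0 < e ->
  exists s : seq K, forall a, A a -> exists2 y, y \in s & nr (a - y) <= e.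

Variables K K' : hilbertType R.
Implicit Types (A B : set K) (e c : R).

Lemma totally_bounded_approx A : (forall e, 0 < e -> exists2 B, totally_bounded B &
  forall a, A a -> exists2 b, B b & nr (a - b) <= e) -> totally_bounded A.
Proof.
move=> h e e0; have e2 : 0 < e / 2 by rewrite divr_gt0.
have [B tB hB] := h _ e2; have [s hs] := tB _ e2; exists s => a /hB[b Bb ab].
have [y ys yb] := hs _ Bb; exists y => //.
by apply: le_trans (nr_tri _ b _) _; rewrite [leRHS](splitr e) lerD.
Qed.

Lemma totally_boundedD A B : totally_bounded A -> totally_bounded B ->
  totally_bounded [set z | exists a b, [/\ A a, B b & z = a + b]].
Proof.
move=> tA tB e e0; have e2 : 0 < e / 2 by rewrite divr_gt0.
have [s hs] := tA _ e2; have [t ht] := tB _ e2.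
exists [seq x + y | x <- s, y <- t] => _ [a [b [Aa Bb ->]]].
have [x xs ax] := hs _ Aa; have [y yt yb] := ht _ Bb.
exists (x + y); first exact: allpairs_f.
by rewrite opprD addrACA; apply: le_trans (nrD _ _) _; rewrite [leRHS](splitr e) lerD.
Qed.

Lemma totally_bounded_image (f : K -> K') A (c : R) : 0 <= c ->
  (forall x y, nr (f x - f y) <= c * nr (x - y)) ->
  totally_bounded A -> totally_bounded (f @` A).
Proof.
move=> c0 hf tA e e0; have c1 : 0 < c + 1 by lra.
have ec : 0 < e / (c + 1) by rewrite divr_gt0.
have [s hs] := tA _ ec; exists (map f s) => _ [a Aa <-].
have [y ys ay] := hs _ Aa; exists (f y); first exact: map_f.
apply: le_trans (hf _ _) _; rewrite ler_pdivlMr// in ay.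
by have := nr_ge0 (a - y); nra.
Qed.

Lemma totally_bounded_sub A B : A `<=` B -> totally_bounded B -> totally_bounded A.
Proof. by move=> AB tB e /tB[s hs]; exists s => a /AB /hs. Qed.

(** Compactness in its near-covering form, applied along the filter of finite sets of centres. *)
Lemma precompact_totally_bounded A : precompact A -> totally_bounded A.
Proof.
rewrite precompactE => /compact_near_coveringP cA e e0.
have FF := fin_filter_proper K.
have : \forall s \near @fin_filter K,
    closure A `<=` [set a | exists2 y, y \in s & nr (a - y) <= e].
  apply: cA => x _.
  exists ([set a | nr (x - a) < e], [set s : {fset K} | {subset [fset x]%fset <= s}]) => /=.
    split; last exact: fin_filter_ge.
    exact: (@cvg_nr _ K _ (nbhs x) _ id x e).
  move=> [a s] /= [ax xs]; exists x; first by apply: xs; rewrite inE.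
  by rewrite -nrN opprB ltW.
by move=> h; have [s hs] := @filter_ex _ _ FF _ h; exists (enum_fset s) => a Aa; apply: hs; exact: subset_closure.
Qed.

(** By completeness it suffices that an ultrafilter on the closure is Cauchy, and it contains a
    member of each finite covering by small balls. *)
Lemma totally_bounded_precompact A : totally_bounded A -> precompact A.
Proof.
move=> tA; rewrite precompactE compact_ultra => F FU FA.
have FF : ProperFilter F by exact: ultra_proper.
have [e e0|l Fl] := @cauchy_nr _ K _ F FF id.
  have e4 : 0 < e / 4 by rewrite divr_gt0.
  have [s hs] := tA _ e4.
  have e8 : 0 < e / 8 by rewrite divr_gt0.
  (* The centres serve [A] up to [e / 4]; passing to the closure costs another [e / 8]. *)
  have : F (\bigcup_(y in [set` s]) [set a | nr (a - y) <= e * 3 / 8]).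
    apply: filterS FA => a /(_ [set b | nr (a - b) < e / 8])[].
      exact: (@cvg_nr _ K _ (nbhs a) _ id a (e / 8)).
    move=> b [/hs[y ys yb] /= ab]; exists y => //=.
    by apply: le_trans (nr_tri _ b _) _; lra.
  move=> /ultra_bigcup[y _ Fy]; exists [set a | nr (a - y) <= e * 3 / 8] => // a b /= ay by_.
  by apply: le_lt_trans (nr_tri _ y _) _; rewrite -(nrN (y - b)) opprB; lra.
exists l; split=> //; apply: closed_closure => B /Fl FB.
exact: (@filter_ex _ F FF _ (filterI FA FB)).
Qed.

End TotallyBounded.

(** * Compositions, averages and limits of unital completely positive maps *)

Section UcpClosure.
Variables (R : realType) (H : hilbertType R) (M : set (H -> H)) (hM : vn_alg M).
Local Notation C := R[i].
Local Notation "x %:C" := (real_complex _ x) : ring_scope.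
Implicit Types (f g : (H -> H) -> H -> H) (x y : H -> H).

Lemma ucp_comp f g : ucp M f -> ucp M g -> ucp M (f \o g).
Proof.
move=> hf hg; split=> /=.
- by move=> x Mx; apply: (ucp_in hf); exact: (ucp_in hg).
- move=> a x y Mx My /=; rewrite (ucpL hg)// (ucpL hf)//; exact: (ucp_in hg).
- by rewrite (ucp_id hg) (ucp_id hf).
- case: hg => gM _ _ cg; case: hf => _ _ _ cf n x Mx px /=.
  by apply: cf; [move=> i j; exact: gM|exact: cg].
Qed.

Lemma ucp_average (I : Type) (s : seq I) (f : I -> (H -> H) -> H -> H) :
  (0 < size s)%N -> (forall i, ucp M (f i)) ->
  ucp M (fun x => ((size s)%:R^-1 : C) *: \sum_(i <- s) f i x).
Proof.
move=> s0 hf; set c : C := (size s)%:R^-1; have c0 : 0 <= c by rewrite invr_ge0.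
have Mf x : M x -> M (\sum_(i <- s) f i x).
  by move=> Mx; apply: (vn_sum hM) => i _; exact: (ucp_in (hf i)).
split=> [x Mx|a x y Mx My||n x Mx /matrix_posE px].
- by apply: (vnZ hM); exact: Mf.
- rewrite (eq_bigr (fun i => a *: f i x + f i y)); last by move=> i _; exact: (ucpL (hf i)).
  by rewrite big_split /= -scaler_sumr scalerDr !scalerA mulrC.
- rewrite (eq_bigr (fun=> id)); last by move=> i _; exact: (ucp_id (hf i)).
  rewrite big_const_seq count_predT iter_addr_0 -scaler_nat.
  by rewrite scalerA mulVf ?scale1r// pnatr_eq0 -lt0n.
- apply/matrix_posE => u.
  have -> : \sum_i \sum_j dotp ((c *: \sum_(k <- s) f k (x i j)) (u j)) (u i) =
      c * \sum_(k <- s) \sum_i \sum_j dotp (f k (x i j) (u j)) (u i).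
    rewrite [in RHS]exchange_big mulr_sumr; apply: eq_bigr => i _ /=.
    rewrite [in RHS]exchange_big mulr_sumr; apply: eq_bigr => j _ /=.
    by rewrite fctE dotpZl fct_sum dotp_suml.
  apply: mulr_ge0 => //; apply: sumr_ge0 => k _.
  by have := ucp_cp (hf k) (fun i j => Mx i j) px; apply.
Qed.

Lemma ucp_lim (T : Type) (F : set_system T) {FF : ProperFilter F} (f : T -> (H -> H) -> H -> H) g :
  (forall t, ucp M (f t)) -> (forall x, M x -> M (g x)) ->
  (forall x u, M x -> f t x u @[t --> F] --> g x u) -> ucp M g.
Proof.
move=> hf Mg hg; split=> //.
- move=> a x y Mx My; apply/funext => u; have Mxy := vn_lin hM a Mx My.
  apply: (cvg_nr_uniq (hg _ u Mxy)).
  have h : a *: f t x u + f t y u @[t --> F] --> a *: g x u + g y u.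
    by apply: cvgD; [apply: cvgZr; exact: hg|exact: hg].
  by rewrite (_ : (fun t => f t _ u) = (fun t => a *: f t x u + f t y u))//;
    apply/funext => t; rewrite (ucpL (hf t)).
- apply/funext => u; apply: (cvg_nr_uniq (hg _ u (vn_id hM))).
  rewrite (_ : (fun t => f t _ u) = fun=> u); first exact: cvg_cst.
  by apply/funext => t; rewrite (ucp_id (hf t)).
- move=> n x Mx /matrix_posE px; apply/matrix_posE => u.
  have h : (fun t => \sum_i \sum_j dotp (f t (x i j) (u j)) (u i)) @ F -->
      ((\sum_i \sum_j dotp (g (x i j) (u j)) (u i) : C) : C^o).
    by apply: cvgC_sum => i; apply: cvgC_sum => j; apply: cvg_dotpl; exact: hg.
  apply: (cvg_ge0 h); apply: filterE => t.
  by have := ucp_cp (hf t) (fun i j => Mx i j) px; apply.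
Qed.

End UcpClosure.

(** * Finite nets in a compact action *)

Section CompactAction.
Variables (R : realType) (H : hilbertType R) (M : set (H -> H)) (nu : (H -> H) -> R[i]).
Variables (G : groupType) (alpha : G -> vn_aut M nu).
Local Notation C := R[i].
Local Notation re := (@complex.Re R).
Local Notation "x %:C" := (real_complex _ x) : ring_scope.
Hypotheses (hM : vn_alg M) (alpha_action : is_action alpha).
Hypothesis alpha_compact : compact_action alpha.
Variables (K : hilbertType R) (La : (H -> H) -> K) (hLa : is_L2 M nu La).
Implicit Types (g h k l : G) (x y : H -> H) (e d : R).

Lemma vn_aut_ball_open (theta0 : vn_aut M nu) x (eps : C) : M x -> 0 < eps ->
  open [set theta : vn_aut M nu | norm2 nu (theta x - theta0 x) < eps].
Proof.
move=> Mx eps0; set B := [set _ | _].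
exists [set B]; last by rewrite bigcup_set1.
move=> _ ->; exists [fset B]%fset.
  by move=> A /fset1P ->; rewrite inE; exists theta0, x, eps.
by rewrite set_fset1 bigcap_set1.
Qed.

Let aL2 g x : M x -> nr (La (alpha g x)) = nr (La x).
Proof. exact: aut_L2. Qed.
Let aM g x : M x -> M (alpha g x).
Proof. exact: aut_in. Qed.

(** Each automorphism in the closure has a neighbourhood whose values at [X] stay within [e / 2] of
    its own, and this neighbourhood contains some [alpha h]; compactness leaves finitely many such
    [h]. *)
Lemma aut_net (X : seq (H -> H)) e : (forall x, x \in X -> M x) -> 0 < e ->
  exists hs : seq G, forall g, exists2 h, h \in hs &
    forall x, x \in X -> nr (La (alpha g x - alpha h x)) <= e.
Proof.
move=> XM e0; have e2 : 0 < e / 2 by rewrite divr_gt0.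
have FF := fin_filter_proper G.
pose B (theta0 : vn_aut M nu) : set (vn_aut M nu) :=
  [set theta | forall x, x \in X -> nr (La (theta x - theta0 x)) < e / 2].
have nB theta0 : nbhs theta0 (B theta0).
  rewrite /B; elim: (X) (XM) => [|x s IH] sM; first by apply: filterE => theta x; rewrite in_nil.
  have Mx : M x by apply: sM; exact: mem_head.
  have : nbhs theta0 [set theta : vn_aut M nu | norm2 nu (theta x - theta0 x) < (e / 2)%:C].
    apply: open_nbhs_nbhs; split; first by apply: vn_aut_ball_open; rewrite ?ltcR.
    by rewrite /= subrr (L2_norm2 hLa) ?(L2_0 hM hLa) ?nr0 ?ltcR//; exact: vn0.
  have /IH : forall y, y \in s -> M y by move=> y ys; apply: sM; rewrite in_cons ys orbT.
  move=> h1 h2; apply: filterS (filterI h1 h2) => theta [hs hx] y.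
  rewrite in_cons => /orP[/eqP ->|/hs//]; move: hx => /=.
  by rewrite (L2_norm2 hLa) ?ltcR//; apply: (vnB hM); exact: aut_in.
have : \forall F \near @fin_filter G, closure (range alpha) `<=`
    [set theta | exists2 h, h \in F & forall x, x \in X -> nr (La (theta x - alpha h x)) <= e].
  apply: (compact_near_coveringP _).1 => // theta0 cl.
  have [_ [[h _ <-] hB]] := cl _ (nB theta0).
  exists (B theta0, [set F : {fset G} | {subset [fset h]%fset <= F}]) => /=.
    by split; [exact: nB|exact: fin_filter_ge].
  move=> [theta F] /= [tB hF]; exists h; first by apply: hF; rewrite inE.
  move=> x xX; have Mx := XM x xX.
  have -> : theta x - alpha h x = (theta x - theta0 x) - (alpha h x - theta0 x).
    by rewrite opprB addrA subrK.
  rewrite (L2B hM hLa); [|apply: (vnB hM); exact: aut_in|apply: (vnB hM); exact: aut_in].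
  by apply: le_trans (nrB _ _) _; rewrite [leRHS](splitr e) lerD// ltW//; [exact: tB|exact: hB].
move=> hF; have [F hF'] := @filter_ex _ _ FF _ hF.
exists (enum_fset F) => g; apply: hF'; apply: subset_closure; by exists g.
Qed.

(** To be uniform in [l], replace [alpha l x] by one of finitely many [alpha h x] within [e / 3],
    take a second net for these, and use that automorphisms are isometric in [L2]. *)
Lemma bi_net (X : seq (H -> H)) e : (forall x, x \in X -> M x) -> 0 < e ->
  exists hs : seq G, forall g, exists2 h, h \in hs &
    forall l x, x \in X -> nr (La (alpha (g * l)%g x - alpha (h * l)%g x)) <= e.
Proof.
move=> XM e0; have e3 : 0 < e / 3 by rewrite divr_gt0.
have [hs hhs] := aut_net XM e3.
pose Y := [seq alpha h x | h <- hs, x <- X].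
have YM y : y \in Y -> M y.
  by move=> /allpairsP[[h x] [_ /= /XM Mx ->]]; exact: aM.
have [ks hks] := aut_net YM e3.
exists ks => g; have [k kks hk] := hks g; exists k => // l x xX; have Mx := XM x xX.
have [h hhs' hl] := hhs l; have := hk (alpha h x) (allpairs_f _ hhs' xX); have := hl x xX.
have [Mlx Mhx] := conj (aM l Mx) (aM h Mx).
rewrite !(alphaM alpha_action)//.
have MB := vnB hM Mlx Mhx.
have aB g' : nr (La (alpha g' (alpha l x)) - La (alpha g' (alpha h x))) =
    nr (La (alpha l x - alpha h x)).
  rewrite -(L2B hM hLa)//; [|exact: aM|exact: aM].
  by rewrite -(ucpB hM (aut_ucp hM (alpha g')))// aL2.
rewrite !(L2B hM hLa (aM _ _) (aM _ _))// => h1 h2.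
have := nr_tri (La (alpha g (alpha l x))) (La (alpha g (alpha h x))) (La (alpha k (alpha l x))).
have := nr_tri (La (alpha g (alpha h x))) (La (alpha k (alpha h x))) (La (alpha k (alpha l x))).
rewrite -(nrN (La (alpha k (alpha h x)) - _)) opprB !aB.
by rewrite !(L2B hM hLa (aM _ _) (aM _ _))//; lra.
Qed.

End CompactAction.

(** * Averaging over a compact action *)

Section Twist.
Variables (R : realType) (H : hilbertType R) (M : set (H -> H)) (nu : (H -> H) -> R[i]).
Variables (G : groupType) (alpha : G -> vn_aut M nu).
Local Notation C := R[i].
Local Notation re := (@complex.Re R).
Local Notation "x %:C" := (real_complex _ x) : ring_scope.
Hypotheses (hM : vn_alg M) (hnu : faithful_normal_state M nu).
Hypotheses (alpha_action : is_action alpha) (alpha_compact : compact_action alpha).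
Variables (K : hilbertType R) (La : (H -> H) -> K) (hLa : is_L2 M nu La).
Variable psi : (H -> H) -> (H -> H).
Hypotheses (hpsi : ucp M psi) (psi_state : forall x, M x -> nu (psi x) = nu x).
Implicit Types (g h k l : G) (x y : H -> H) (e d : R).

(** Compactness of the induced operator on [L2], expressed through [f] alone, so that it can be
    carried through averages and limits before that operator is available. *)
Definition L2_totally_bounded (f : (H -> H) -> H -> H) :=
  totally_bounded [set La (f x) | x in [set x | M x /\ nr (La x) <= 1]].

Variables (T : K -> K) (hT : compact_op T) (TE : forall x, M x -> T (La x) = La (psi x)).

Definition twist g x := alpha g (psi (alpha g^-1%g x)).

Let aM g x : M x -> M (alpha g x). Proof. exact: aut_in. Qed.
Let pM x : M x -> M (psi x). Proof. exact: (ucp_in hpsi). Qed.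
Let aL2 g x : M x -> nr (La (alpha g x)) = nr (La x). Proof. exact: aut_L2. Qed.
Let aB g x y : M x -> M y -> alpha g (x - y) = alpha g x - alpha g y.
Proof. exact: (ucpB hM (aut_ucp hM _)). Qed.
Let pB x y : M x -> M y -> psi (x - y) = psi x - psi y.
Proof. exact: (ucpB hM hpsi). Qed.
Let LB x y : M x -> M y -> La (x - y) = La x - La y.
Proof. exact: (L2B hM hLa). Qed.
Let psiL2 x : M x -> nr (La (psi x)) <= nr (La x).
Proof. exact: (ucp_L2 hM hnu hpsi psi_state hLa). Qed.

Lemma compact_L2_totally_bounded : L2_totally_bounded psi.
Proof.
case: hT => _ /precompact_totally_bounded; apply: totally_bounded_sub => _ [x [Mx nx] <-].
by exists (La x); [rewrite /= nrE lecR|exact: TE].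
Qed.

Lemma aut_dotp g x y : M x -> M y ->
  dotp (La (alpha g x)) (La (alpha g y)) = dotp (La x) (La y).
Proof.
move=> Mx My; rewrite !(L2_dotp hLa)//; [|exact: aM|exact: aM].
rewrite -(vn_aut_adj (alpha g))// -(vn_aut_comp (alpha g))//; last exact: vn_adj.
by rewrite vn_aut_state//; apply: (vn_comp hM) => //; exact: vn_adj.
Qed.

(* Compactness of [T] controls [T u - T], compactness of its adjoint controls [u T - T]
   for the unitary [u] of [alpha k]. *)
Lemma twist_near e : 0 < e -> exists2 X : seq (H -> H), forall x, x \in X -> M x &
  exists2 d : R, 0 < d & forall k, (forall y, y \in X -> nr (La (alpha k y - y)) <= d) ->
    forall x, M x -> nr (La (twist k x - psi x)) <= e * nr (La x).
Proof.
(* [d <= e / 10] serves [5 d <= e / 2], and [d <= e^2 / 60] serves [14 d <= (e / 2)^2]. *)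
move=> e0; pose d := Num.min (e / 10) (e ^+ 2 / 60).
have d0 : 0 < d by rewrite lt_min !divr_gt0// exprn_gt0.
have d1 : d <= e / 10 by rewrite ge_min lexx.
have d2 : d <= e ^+ 2 / 60 by rewrite ge_min lexx orbT.
have [s hs] := compact_L2_totally_bounded d0.
have bT : bop T by apply/bop_bounded; case: hT.
have [T' bT' hT'] := bop_has_adjoint bT.
have /choice[f hf] : forall z : K, exists x, M x /\ nr (z - La x) <= d.
  move=> z; have [_ [x Mx <-] h] := L2_dense hLa z d0.
  by exists x; rewrite ltW.
have [fM fd] := all_and2 hf.
(* [X1] approximates a net for the image of the unit ball under [psi], and [X2] approximates the
   image of [X1] under the adjoint [T']. *)
pose X1 := map f s; pose X2 := [seq f (T' (La y)) | y <- X1].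
have net x : M x -> nr (La x) <= 1 -> exists2 y, y \in s & nr (La (psi x) - La (f y)) <= 2 * d.
  move=> Mx nx; have [|y ys hy] := hs (La (psi x)); first by exists x.
  exists y => //; apply: le_trans (nr_tri _ y _) _; have := fd y; lra.
exists (X1 ++ X2).
  by move=> x; rewrite mem_cat => /orP[] /mapP[y _ ->]; exact: fM.
exists d => // k hk.
have hk1 (y : K) : y \in s -> nr (La (alpha k (f y) - f y)) <= d.
  by move=> ys; apply: hk; rewrite mem_cat map_f.
have hk2 (y : K) : y \in s -> nr (La (alpha k (f (T' (La (f y)))) - f (T' (La (f y))))) <= d.
  by move=> ys; apply: hk; rewrite mem_cat; apply/orP; right; apply/map_f/map_f.
have unit x : M x -> nr (La x) <= 1 -> nr (La (twist k x - psi x)) <= e.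
  move=> Mx nx; set x' := alpha k^-1%g x.
  have Mx' : M x' by exact: aM.
  have nx' : nr (La x') <= 1 by rewrite aL2.
  (* [twist k x - psi x] is the sum of [alpha k (psi w)] and [alpha k (psi x) - psi x]. The second
     term is small because [psi x] is near [X1], the first because [w] is nearly orthogonal to
     [X2]. *)
  pose w := x' - x; have Mw : M w by exact: vnB.
  have [Mp Mp'] := conj (pM Mx) (pM Mx').
  have p1 : nr (La (alpha k (psi x) - psi x)) <= 5 * d.
    have [y ys hy] := net _ Mx nx; have Mf := fM y.
    rewrite LB//; last exact: aM.
    have := nr_tri (La (alpha k (psi x))) (La (alpha k (f y))) (La (psi x)).
    have := nr_tri (La (alpha k (f y))) (La (f y)) (La (psi x)).
    rewrite -(nrN (La (f y) - La (psi x))) opprB -(LB (aM k Mp) (aM k Mf)) -aB//.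
    rewrite aL2; last exact: vnB.
    rewrite LB// -(LB (aM k Mf) Mf); have := hk1 y ys; lra.
  have p2 : nr (La (psi w)) <= e / 2.
    have Mw2 : M ((2^-1)%:C *: w) by exact: vnZ.
    have [|y ys hy] := net _ Mw2.
      rewrite (L2Z hM hLa)// nr_real_scale ?invr_ge0// ler_pdivrMl// mulr1.
      rewrite LB//; apply: le_trans (nrB _ _) _; lra.
    set a := La (psi w); set b := La (f y).
    have ab : nr (a - 2%:C *: b) <= 4 * d.
      have -> : a - 2%:C *: b = 2%:C *: (La (psi ((2^-1)%:C *: w)) - b).
        rewrite (ucpZ hM hpsi)// (L2Z hM hLa) ?scalerBr ?scalerA; last exact: pM.
        by rewrite -rmorphM mulfV ?scale1r// pnatr_eq0.
      by rewrite nr_real_scale//; lra.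
    set v := f (T' (La (f y))); have Mv : M v by exact: fM.
    (* Invariance of the inner product moves the automorphism from [x] to [v], which [alpha k]
       almost fixes. *)
    have q1 : nr (dotp (La w) (La v)) <= d.
      have -> : dotp (La w) (La v) = dotp (La x) (La (alpha k v - v)).
        rewrite /w LB// dotpBl -(aut_dotp k Mx' Mv) (alphaVK alpha_action)//.
        by rewrite -dotpBr -LB//; exact: aM.
      apply: le_trans (dotp_CS _ _) _; have := hk2 y ys; have := nr_ge0 (La (alpha k v - v)).
      have := nr_ge0 (La x); rewrite -/v; nra.
    have nw : nr (La w) <= 2 by rewrite LB//; apply: le_trans (nrB _ _) _; lra.
    have na : nr a <= 2 by apply: le_trans nw; exact: psiL2.
    have q2 : nr (dotp a b) <= 3 * d.
      rewrite /a -TE// hT' -[T' _](subrK (La v)) dotpDr.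
      apply: le_trans (nrD _ _) _; have := dotp_CS (La w) (T' b - La v).
      have := fd (T' (La (f y))); have := nr_ge0 (La w); have := nr_ge0 (T' b - La v).
      rewrite -/v -/b; nra.
    have q3 : nr a ^+ 2 <= 14 * d.
      rewrite -re_dotpxx; have -> : dotp a a = dotp a (a - 2%:C *: b) + 2%:C * dotp a b.
        by rewrite dotpBr dotpZr conjE conjc_real subrK.
      rewrite reD reM rereal imreal mul0r subr0.
      have := re_le (dotp a (a - 2%:C *: b)); have := re_le (dotp a b).
      have := dotp_CS a (a - 2%:C *: b); have := nr_ge0 a; have := nr_ge0 (a - 2%:C *: b); nra.
    rewrite -(@ler_pXn2r _ 2) ?nnegrE ?nr_ge0//; last lra.
    have -> : (e / 2) ^+ 2 = e ^+ 2 / 4 by field.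
    by lra.
  have -> : twist k x - psi x = alpha k (psi w) + (alpha k (psi x) - psi x).
    by rewrite /w /twist pB// aB// addrA subrK.
  rewrite (L2D hLa); [|by apply: aM; exact: pM|by apply: (vnB hM) => //; exact: aM].
  apply: le_trans (nrD _ _) _; rewrite aL2; last exact: pM.
  by lra.
(* Homogeneity. The scale [t] is kept free because [La x] may vanish, in which case [t] is taken
   large. *)
move=> x Mx; have hs' (t : R) : 0 <= t -> t * nr (La x) <= 1 ->
    t * nr (La (twist k x - psi x)) <= e.
  move=> t0 ht; have Mtx := vnZ hM t%:C Mx.
  have := unit _ Mtx; rewrite (L2Z hM hLa)// nr_real_scale// => /(_ ht).
  have -> : twist k (t%:C *: x) - psi (t%:C *: x) = t%:C *: (twist k x - psi x).
    rewrite /twist (ucpZ hM hpsi)// (autZ hM)// (ucpZ hM hpsi); last exact: aM.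
    by rewrite (autZ hM) ?scalerBr//; apply: pM; exact: aM.
  rewrite (L2Z hM hLa) ?nr_real_scale//.
  by apply: (vnB hM); [apply: aM; apply: pM; exact: aM|exact: pM].
have [n0|n0] := eqVneq (nr (La x)) 0.
  rewrite n0 mulr0; set q := nr (La (twist k x - psi x)) in hs' *; rewrite leNgt; apply/negP => q0.
  have := hs' ((e + 1) / q); rewrite n0 mulr0 divrK ?unitfE ?gt_eqF//.
  have e1 : 0 <= e + 1 by lra.
  by rewrite divr_ge0 ?(ltW q0)// => /(_ isT ler01); lra.
have nx : 0 < nr (La x) by rewrite lt_def n0 nr_ge0.
have := hs' (nr (La x))^-1; rewrite invr_ge0 nr_ge0 mulVf// => /(_ isT (lexx _)).
by rewrite ler_pdivrMl// mulrC.
Qed.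

(** With [m = l' h l] one has [l' g l = m k] for [k = l^-1 h^-1 g l], and conjugation by the
    isometry [alpha m] reduces the claim to [twist_near] at [k]. The size of [alpha k y - y] is that
    of [alpha (g l) y - alpha (h l) y], which [bi_net] controls. *)
Lemma twist_net e : 0 < e -> exists hs : seq G, forall g, exists2 h, h \in hs &
  forall l l' x, M x ->
    nr (La (twist (l' * g * l)%g x) - La (twist (l' * h * l)%g x)) <= e * nr (La x).
Proof.
move=> e0; have [X XM [d d0 hX]] := twist_near e0.
have [hs hhs] := bi_net hM alpha_action alpha_compact hLa XM d0.
exists hs => g; have [h hh hg] := hhs g; exists h => // l l' x Mx.
pose m := (l' * h * l)%g; pose k := (l^-1 * h^-1 * g * l)%g.
have mk : (l' * g * l)%g = (m * k)%g by rewrite /m /k !mulgA mulgK mulgK.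
have Mx' : M (alpha m^-1%g x) by exact: aM.
have [Mt Mp] : M (twist k (alpha m^-1%g x)) /\ M (psi (alpha m^-1%g x)).
  by split; [apply: aM; apply: pM; apply: aM|exact: pM].
have -> : twist (l' * g * l)%g x = alpha m (twist k (alpha m^-1%g x)).
  rewrite mk /twist invgM (alphaM alpha_action) ?(alphaM alpha_action k^-1%g)//.
  by apply: pM; apply: aM; exact: aM.
rewrite -(LB (aM _ Mt) (aM m Mp)) -aB// aL2; last exact: vnB.
rewrite -(aL2 m^-1%g Mx); apply: hX => // y yX; have My := XM y yX.
rewrite -(aL2 (h * l)%g); last by apply: (vnB hM) => //; exact: aM.
rewrite aB//; last exact: aM.
rewrite -(alphaM alpha_action)//.
have -> : (h * l * k = g * l)%g by rewrite /k !mulgA mulgK mulgV mul1g.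
exact: hg.
Qed.

End Twist.

Section Averaging.
Variables (R : realType) (H : hilbertType R) (M : set (H -> H)) (nu : (H -> H) -> R[i]).
Variables (G : groupType) (alpha : G -> vn_aut M nu).
Local Notation C := R[i].
Local Notation re := (@complex.Re R).
Local Notation "x %:C" := (real_complex _ x) : ring_scope.
Hypotheses (hM : vn_alg M) (hnu : faithful_normal_state M nu).
Hypothesis alpha_action : is_action alpha.
Variables (K : hilbertType R) (La : (H -> H) -> K) (hLa : is_L2 M nu La).
Variable psi : (H -> H) -> (H -> H).
Hypotheses (hpsi : ucp M psi) (psi_state : forall x, M x -> nu (psi x) = nu x).
Hypothesis psi_net : forall e : R, 0 < e -> exists hs : seq G, forall g, exists2 h, h \in hs &
  forall l l' x, M x ->
    nr (La (twist alpha psi (l' * g * l)%g x) - La (twist alpha psi (l' * h * l)%g x))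
      <= e * nr (La x).
Implicit Types (g h : G) (k s t : seq G) (x y : H -> H) (e d : R).
Local Notation tw := (twist alpha psi).
Local Notation lmul g := (fun h => (g * h)%g).

Let aM g x : M x -> M (alpha g x). Proof. exact: aut_in. Qed.
Let pM x : M x -> M (psi x). Proof. exact: (ucp_in hpsi). Qed.
Let aL2 g x : M x -> nr (La (alpha g x)) = nr (La x). Proof. exact: aut_L2. Qed.

Lemma twist_ucp g : ucp M (tw g).
Proof. by apply: (ucp_comp (aut_ucp hM _)); apply: (ucp_comp hpsi); exact: aut_ucp. Qed.

Lemma twistM g h x : M x -> tw (g * h)%g x = alpha g (tw h (alpha g^-1%g x)).
Proof.
move=> Mx; rewrite /twist invgM (alphaM alpha_action) ?(alphaM alpha_action h^-1%g)//.
by apply: pM; apply: aM; exact: aM.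
Qed.

(** Repetitions in the list matter: [k] stands for a finitely supported probability measure with
    rational weights, and lists of products are convolutions. *)
Definition average k x : H -> H := ((size k)%:R^-1 : C) *: \sum_(i <- k) tw i x.
Definition avL k x : K := (size k)%:R^-1%:C *: \sum_(i <- k) La (tw i x).

Lemma average_ucp k : (0 < size k)%N -> ucp M (average k).
Proof. by move=> k0; apply: (ucp_average hM k0); exact: twist_ucp. Qed.

Let tM g x : M x -> M (tw g x). Proof. exact: (ucp_in (twist_ucp g)). Qed.

Lemma L2_sum (I : Type) (r : seq I) (f : I -> H -> H) : (forall i, M (f i)) ->
  La (\sum_(i <- r) f i) = \sum_(i <- r) La (f i).
Proof.
move=> Mf; elim: r => [|i r IH]; first by rewrite !big_nil (L2_0 hM hLa).
by rewrite !big_cons (L2D hLa) ?IH//; exact: vn_sum.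
Qed.

Lemma average_L2 k x : M x -> La (average k x) = avL k x.
Proof.
move=> Mx; rewrite /average (L2Z hM hLa); last by apply: (vn_sum hM) => i _; exact: tM.
by rewrite L2_sum; [rewrite /avL fmorphV rmorph_nat|move=> i; exact: tM].
Qed.

Lemma average_state k x : (0 < size k)%N -> M x -> nu (average k x) = nu x.
Proof.
move=> k0 Mx; have Mt i := tM i Mx; rewrite /average (stZ hM hnu); last exact: vn_sum.
rewrite (st_sum hM hnu)// (eq_bigr (fun=> nu x)).
  have -> : \sum_(i <- k) nu x = (size k)%:R * nu x.
    by rewrite big_const_seq count_predT iter_addr_0 mulr_natl.
  by rewrite mulrA mulVf ?mul1r// pnatr_eq0 -lt0n.
move=> i _; rewrite /twist vn_aut_state; last by apply: pM; exact: aM.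
by rewrite psi_state ?vn_aut_state//; exact: aM.
Qed.

Lemma avL_map g k x : M x -> avL (map (lmul g) k) x = La (alpha g (average k (alpha g^-1%g x))).
Proof.
move=> Mx; have Mt i := tM i (aM g^-1%g Mx).
rewrite /average (autZ hM); last exact: vn_sum.
rewrite (L2Z hM hLa); last by apply: aM; exact: vn_sum.
rewrite (aut_sum hM)// L2_sum; last by move=> i; exact: aM.
rewrite /avL size_map fmorphV rmorph_nat big_map; congr (_ *: _); apply: eq_bigr => i _.
by rewrite twistM.
Qed.

Lemma avL_mul s k g x : M x ->
  avL (map (lmul g) [seq (h * i)%g | h <- s, i <- k]) x =
  (size s)%:R^-1%:C *: \sum_(h <- s) avL (map (lmul (g * h)%g) k) x.
Proof.
move=> Mx; rewrite /avL size_map size_allpairs big_map big_allpairs_dep /=.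
rewrite natrM invfM rmorphM -scalerA; congr (_ *: _).
rewrite scaler_sumr; apply: eq_bigr => h _; rewrite size_map big_map; congr (_ *: _).
by apply: eq_bigr => i _; rewrite mulgA.
Qed.

Lemma avL_le s (f : G -> K) d : 0 <= d -> (forall i, i \in s -> nr (f i) <= d) ->
  nr ((size s)%:R^-1%:C *: \sum_(i <- s) f i) <= d.
Proof.
move=> d0 hf; rewrite nr_real_scale ?invr_ge0//.
have h : nr (\sum_(i <- s) f i) <= (size s)%:R * d.
  elim: s hf => [|i s IH] hf; first by rewrite big_nil nr0 mul0r.
  rewrite big_cons; apply: le_trans (nrD _ _) _; rewrite /= -natr1 mulrDl mul1r addrC lerD//.
    by apply: IH => j js; apply: hf; rewrite in_cons js orbT.
  by apply: hf; exact: mem_head.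
have [->|s0] := posnP (size s); first by rewrite invr0 mul0r.
by rewrite ler_pdivrMl ?ltr0n.
Qed.

(** Left translates of an average are its conjugates by [alpha g], by [avL_map]; so [d] measures, in
    the operator norm of [L2], the failure of equivariance. *)
Definition spread k d := forall g h x, M x ->
  nr (avL (map (lmul g) k) x - avL (map (lmul h) k) x) <= d * nr (La x).

Lemma spread2 k : (0 < size k)%N -> spread k 2.
Proof.
move=> k0 g h x Mx; have u i : nr (avL (map (lmul i) k) x) <= nr (La x).
  rewrite avL_map// aL2; last by apply: (ucp_in (average_ucp k0)); exact: aM.
  apply: le_trans (ucp_L2 hM hnu (average_ucp k0) _ hLa (aM _ Mx)) _.
    by move=> y My; exact: average_state.
  by rewrite aL2.
by apply: le_trans (nrB _ _) _; rewrite mulr_natl mulr2n lerD.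
Qed.

Let sum_pairs s t k g h d x : 0 <= d -> spread k d -> M x -> size s = size t ->
  nr (\sum_(i <- s) avL (map (lmul (g * i)%g) k) x - \sum_(i <- t) avL (map (lmul (h * i)%g) k) x)
    <= (size s)%:R * (d * nr (La x)).
Proof.
move=> d0 hk Mx; elim: s t => [|i s IH] [|j t]//=.
  by move=> _; rewrite !big_nil subrr nr0 mul0r.
move=> [st]; rewrite !big_cons opprD addrACA; apply: le_trans (nrD _ _) _.
by rewrite -natr1 mulrDl mul1r [leRHS]addrC lerD//; [exact: hk|exact: IH].
Qed.

(* One pair of terms of the two averages is [e]-close, by the choice of [s], and all the
   others are [d]-close. *)
Lemma spread_contract s k d e : (0 < size s)%N -> 0 <= d -> 0 <= e ->
  (forall g, exists2 h, h \in s & forall l l' x, M x ->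
    nr (La (tw (l' * g * l)%g x) - La (tw (l' * h * l)%g x)) <= e * nr (La x)) ->
  spread k d ->
  spread [seq (h * i)%g | h <- s, i <- k] ((e + ((size s)%:R - 1) * d) / (size s)%:R).
Proof.
move=> s0 d0 e0 net hk g g' x Mx; rewrite !avL_mul// -scalerBr nr_real_scale ?invr_ge0//.
have n0 : 0 < (size s)%:R :> R by rewrite ltr0n.
rewrite ler_pdivrMl// mulrA mulrCA divff ?mulr1 ?gt_eqF//.
case: s s0 net n0 => [//|h0 s] _ net n0.
(* For this [h], the twists by [g' h i] and [g h0 i] are close for every [i]; moving [h] to the head
   of the second copy of the list pairs the two close terms. *)
have [h hs hh] := net (g'^-1 * g * h0)%g.
rewrite [X in nr (_ - X)](perm_big _ (perm_to_rem hs)) !big_cons opprD addrACA.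
apply: le_trans (nrD _ _) _; rewrite mulrDl lerD//.
  rewrite /avL !size_map -scalerBr -(size_map (lmul (g * h0)) k) size_map !big_map -sumrB.
  apply: avL_le => [|i _]; first by rewrite mulr_ge0 ?nr_ge0.
  have := hh i g' x Mx; rewrite !mulgA mulgV mul1g.
  exact.
have sz : size s = size (rem h (h0 :: s)) by rewrite size_rem.
apply: le_trans (sum_pairs _ _ d0 hk Mx sz) _.
by rewrite -[(size (h0 :: s))%:R]natr1 addrK mulrA.
Qed.

(** Convolving with an [e / 2]-net of size [n] lowers a spread [d >= e] by at least [e / (2 n)], so
    finitely many convolutions suffice. The result is an average of left translates of the original,
    hence within [d0] of it. *)
Lemma spread_small k0 d0 e : (0 < size k0)%N -> spread k0 d0 -> 0 < e ->
  exists k, [/\ (0 < size k)%N, spread k e &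
    forall x, M x -> nr (La (average k x) - La (average k0 x)) <= d0 * nr (La x)].
Proof.
move=> k00 hd0 e0; have e2 : 0 < e / 2 by rewrite divr_gt0.
have [s net] := psi_net e2.
have s0 : (0 < size s)%N by have [h + _] := net 1%g; case: (s).
have n0 : 0 < (size s)%:R :> R by rewrite ltr0n.
(* The starting value is the trivial bound [2] of [spread2]; no decrease below [e] is claimed. *)
pose D (m : nat) := Num.max e (2 - m%:R * (e / (2 * (size s)%:R))).
have step m : exists k, [/\ (0 < size k)%N, spread k (D m) & forall g x, M x ->
    nr (avL (map (lmul g) k) x - avL k0 x) <= d0 * nr (La x)].
  elim: m => [|m [k [sk hk ck]]].
    exists k0; split=> // [g h x Mx|g x Mx].
      apply: le_trans (spread2 k00 g h Mx) _; rewrite ler_wpM2r ?nr_ge0//.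
      by rewrite /D mul0r subr0 le_max lexx orbT.
    by have := hd0 g 1%g x Mx; rewrite (map_id_in (f := lmul 1%g))// => i _; rewrite mul1g.
  exists [seq (h * i)%g | h <- s, i <- k]; split.
  - by rewrite size_allpairs muln_gt0 s0.
  - have Dm : 0 <= D m by rewrite le_max (ltW e0).
    have hs := spread_contract s0 Dm (ltW e2) net hk.
    move=> g h x Mx; apply: le_trans (hs g h x Mx) _; rewrite ler_wpM2r ?nr_ge0//.
    rewrite ler_pdivrMr// /D -[m.+1%:R]natr1.
    set n : R := (size s)%:R in n0 *; set q := e / (2 * n).
    have eq : e = 2 * n * q by rewrite /q mulrC divfK// mulf_neq0 ?gt_eqF.
    have n1 : 1 <= n by rewrite ler1n.
    have q0 : 0 < q by rewrite divr_gt0// mulr_gt0.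
    set r := 2 - m%:R * q; have -> : 2 - (m%:R + 1) * q = r - q by rewrite /r; ring.
    rewrite maxEle; case: ifP => er; rewrite maxEle; case: ifP => er'; nra.
  - move=> g x Mx; rewrite avL_mul// -[avL k0 x]scale1r.
    have -> : 1 = (size s)%:R^-1%:C * (size s)%:R :> C.
      by rewrite fmorphV rmorph_nat mulVf// pnatr_eq0 -lt0n.
    rewrite -scalerA -scalerBr scaler_nat.
    have -> : avL k0 x *+ size s = \sum_(h <- s) avL k0 x.
      by rewrite big_const_seq count_predT iter_addr_0.
    rewrite -sumrB; apply: avL_le => [|h _]; last exact: ck.
    by apply: le_trans (ck g x Mx); exact: nr_ge0.
have [m hm] : exists m : nat, 2 <= m%:R * (e / (2 * (size s)%:R)).
  exists (Num.truncn (2 / (e / (2 * (size s)%:R)))).+1.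
  by rewrite -ler_pdivrMr ?ltW ?truncnS_gt ?divr_gt0 ?mulr_gt0.
have [k [sk hk ck]] := step m; exists k; split=> //.
  move=> g h x Mx; apply: le_trans (hk g h x Mx) _; rewrite ler_wpM2r ?nr_ge0//.
  by rewrite /D ge_max lexx; lra.
move=> x Mx; rewrite !average_L2//; have := ck 1%g x Mx.
by rewrite (map_id_in (f := lmul 1%g))// => i _; rewrite mul1g.
Qed.

(** Each step halves the bound on the spread, and the step from [m] moves the average by at most
    [2^-m]; the factor [2] sums the geometric series. *)
Lemma averages : exists k : nat -> seq G, forall m : nat,
  [/\ (0 < size (k m))%N, spread (k m) (2^-1 ^+ m) & forall p x, (m <= p)%N -> M x ->
    nr (La (average (k p) x) - La (average (k m) x)) <= 2 * 2^-1 ^+ m * nr (La x)].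
Proof.
have e0 m : 0 < 2^-1 ^+ m :> R by rewrite exprn_gt0// invr_gt0.
(* A choice for all pairs, with the list itself as default where the premises fail, so that the
   recursion can be written before its invariant is proved. *)
have /choice[f hf] : forall q : seq G * nat, exists k, (0 < size q.1)%N ->
    spread q.1 (2^-1 ^+ q.2) -> [/\ (0 < size k)%N, spread k (2^-1 ^+ q.2.+1) &
    forall x, M x -> nr (La (average k x) - La (average q.1 x)) <= 2^-1 ^+ q.2 * nr (La x)].
  move=> [k m] /=; have [h|h] := pselect ((0 < size k)%N /\ spread k (2^-1 ^+ m)).
    by have [k' hk'] := spread_small h.1 h.2 (e0 m.+1); exists k'.
  by exists k => h1 h2; case: h.
have [k0 [sk0 hk0 _]] := spread_small (isT : (0 < size [:: 1%g : G])%N) (spread2 (k := [:: 1%g]) isT) (e0 0%N).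
pose k := fix k m := if m is m'.+1 then f (k m', m') else k0.
have hk m : (0 < size (k m))%N /\ spread (k m) (2^-1 ^+ m).
  by elim: m => [//|m [h1 h2]] /=; have [] := hf (k m, m) h1 h2.
have hS m x : M x -> nr (La (average (k m.+1) x) - La (average (k m) x)) <= 2^-1 ^+ m * nr (La x).
  by move=> Mx; have [h1 h2] := hk m; have [_ _] := hf (k m, m) h1 h2; exact.
exists k => m; have [h1 h2] := hk m; split=> // p x mp Mx.
suff : nr (La (average (k p) x) - La (average (k m) x)) <=
    2 * (2^-1 ^+ m - 2^-1 ^+ p) * nr (La x).
  by move=> h; apply: le_trans h _; rewrite ler_wpM2r ?nr_ge0//; have := e0 p; lra.
elim: p mp => [|p IH]; first by rewrite leqn0 => /eqP ->; rewrite !subrr nr0 mulr0 mul0r.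
rewrite leq_eqVlt => /orP[/eqP ->|mp]; first by rewrite !subrr nr0 mulr0 mul0r.
apply: le_trans (nr_tri _ (La (average (k p) x)) _) _.
have := hS p x Mx; have := IH mp; rewrite exprS; have := nr_ge0 (La x); nra.
Qed.

End Averaging.

(** * The equivariant mean *)

Section Equivariant.
Variables (R : realType) (H : hilbertType R) (M : set (H -> H)) (nu : (H -> H) -> R[i]).
Variables (G : groupType) (alpha : G -> vn_aut M nu).
Local Notation C := R[i].
Local Notation re := (@complex.Re R).
Local Notation "x %:C" := (real_complex _ x) : ring_scope.
Hypotheses (hM : vn_alg M) (hnu : faithful_normal_state M nu).
Hypotheses (alpha_action : is_action alpha) (alpha_compact : compact_action alpha).
Variables (K : hilbertType R) (La : (H -> H) -> K) (hLa : is_L2 M nu La).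
Variable psi : (H -> H) -> (H -> H).
Hypotheses (hpsi : ucp M psi) (psi_state : forall x, M x -> nu (psi x) = nu x).
Implicit Types (g h : G) (x y : H -> H) (e d : R).

Lemma half_pow_small (c e : R) : 0 < e -> exists m : nat, 2 * 2^-1 ^+ m * c < e.
Proof.
move=> e0; have [c0|c0] := leP c 0.
  by exists 0%N; rewrite expr0; lra.
pose m := (Num.truncn (2 * c / e)).+1; exists m.
have h : 2 * c / e < 2 ^+ m.
  apply: lt_trans (truncnS_gt _) _; rewrite -/m -natrX ltr_nat; exact: ltn_expl.
rewrite exprVn mulrAC ltr_pdivrMr ?exprn_gt0//.
by rewrite ltr_pdivrMr// in h; rewrite [e * _]mulrC.
Qed.

Let aM g x : M x -> M (alpha g x). Proof. exact: aut_in. Qed.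
Let aL2 g x : M x -> nr (La (alpha g x)) = nr (La x). Proof. exact: aut_L2. Qed.

(** Each twist maps the unit ball into the image, under an isometry, of a totally bounded set, and
    finite sums and multiples preserve total boundedness. *)
Lemma average_totally_bounded (k : seq G) : L2_totally_bounded M La psi ->
  L2_totally_bounded M La (average alpha psi k).
Proof.
move=> tb; have tw g : L2_totally_bounded M La (twist alpha psi g).
  move=> e e0; have [s hs] := tb e e0.
  have h1 a x y : M x -> M y -> (La \o alpha g) (a *: x + y) =
      a *: (La \o alpha g) x + (La \o alpha g) y.
    by move=> Mx My; rewrite /= (autL (alpha g))// (L2_lin hLa)//; exact: aM.
  have h2 x : M x -> nr ((La \o alpha g) x) <= 1 * nr (La x).
    by move=> Mx /=; rewrite aL2// mul1r.
  have [U [lU bU UE]] := extension (vn_lsub hM) (L2_lin hLa) h1 h2 ler01 (L2_dense hLa).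
  exists (map U s) => _ [x [Mx nx] <-].
  have Mx' := aM g^-1%g Mx.
  have [|y ys hy] := hs (La (psi (alpha g^-1%g x))).
    by exists (alpha g^-1%g x); rewrite //= aL2.
  exists (U y); first exact: map_f.
  rewrite /twist -[La (alpha g _)]/((La \o alpha g) _) -UE; last exact: (ucp_in hpsi).
  by rewrite -(linBE _ _ lU); apply: le_trans (bU _) _; rewrite mul1r.
have sum (s : seq G) : totally_bounded [set \sum_(i <- s) La (twist alpha psi i x) |
    x in [set x | M x /\ nr (La x) <= 1]].
  elim: s => [|i s IH].
    move=> e e0; exists [:: 0] => _ [x _ <-]; exists 0; first exact: mem_head.
    by rewrite big_nil subrr nr0 ltW.
  apply: totally_bounded_sub (totally_boundedD (tw i) IH) => _ [x xB <-].
  by exists (La (twist alpha psi i x)), (\sum_(j <- s) La (twist alpha psi j x));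
    split; [exists x|exists x|rewrite big_cons].
have c0 : 0 <= (size k)%:R^-1 :> R by rewrite invr_ge0.
have hc (x y : K) : nr ((size k)%:R^-1%:C *: x - (size k)%:R^-1%:C *: y) <=
    (size k)%:R^-1 * nr (x - y) by rewrite -scalerBr nr_real_scale.
apply: totally_bounded_sub (totally_bounded_image c0 hc (sum k)) => _ [x [Mx nx] <-].
rewrite (average_L2 alpha hM hLa hpsi)//; exists (\sum_(i <- k) La (twist alpha psi i x)) => //.
by exists x.
Qed.

(** The averages are Cauchy in [L2] and bounded in operator norm, so [L2_ball_complete] puts their
    limits in [M]; uniformity on the unit ball preserves total boundedness. For the last clause,
    [psi' x - x] is a limit of averages of [alpha i (psi y - y)] with [y = alpha i^-1 x], so it is
    controlled by [psi] on the orbit of [x]. *)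
Lemma equivariant_average (T : K -> K) : compact_op T ->
  (forall x, M x -> T (La x) = La (psi x)) ->
  exists psi', [/\ ucp M psi' /\ (forall x, M x -> nu (psi' x) = nu x),
    forall g x, M x -> psi' (alpha g x) = alpha g (psi' x),
    L2_totally_bounded M La psi' &
    forall x (b : R), M x -> (forall g, nr (La (psi (alpha g x) - alpha g x)) <= b) ->
      nr (La (psi' x - x)) <= b].
Proof.
move=> hT TE.
have net := twist_net hM hnu alpha_action alpha_compact hLa hpsi psi_state hT TE.
have [k hk] := averages hM hnu alpha_action hLa hpsi psi_state net.
pose av m := average alpha psi (k m).
have uav m : ucp M (av m) by have [h _ _] := hk m; exact: (average_ucp alpha hM hpsi h).
have Mav m x : M x -> M (av m x) by exact: (ucp_in (uav m)).
have cauchy m p x : (m <= p)%N -> M x ->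
    nr (La (av p x) - La (av m x)) <= 2 * 2^-1 ^+ m * nr (La x).
  by move=> mp Mx; have [_ _] := hk m; apply.
pose lim_at x y := [/\ M y, La (av m x) @[m --> \oo] --> La y &
  forall u, av m x u @[m --> \oo] --> y u].
have lim_ex x : M x -> exists y, lim_at x y.
  move=> Mx; have [l hl] : exists l : K, La (av m x) @[m --> \oo] --> l.
    apply: cauchy_nr => e e0; have e2 : 0 < e / 2 by rewrite divr_gt0.
    have [m hm] := half_pow_small (nr (La x)) e2.
    exists [set p | (m <= p)%N]; first by exists m.
    move=> p q /= mp mq; have := cauchy m p x mp Mx; have := cauchy m q x mq Mx.
    have := nr_tri (La (av p x)) (La (av m x)) (La (av q x)).
    by rewrite -(nrN (La (av m x) - La (av q x))) opprB; lra.
  have [lx [r r0 hr]] := vn_bop hM Mx.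
  have [y [My yl hy]] := L2_ball_complete hM hnu hLa r0 (fun m => Mav m x Mx)
    (fun m => ucp_bound hM (uav m) Mx r0 hr) hl.
  by exists y; split=> //; rewrite yl.
pose psi' x := xget 0 [set y | lim_at x y].
have hlim x : M x -> lim_at x (psi' x).
  by move=> /lim_ex[y hy]; apply: (@xgetPex _ 0 [set y | lim_at x y]); exists y.
have Mp x : M x -> M (psi' x) by move=> /hlim[].
have Lcv x : M x -> La (av m x) @[m --> \oo] --> La (psi' x) by move=> /hlim[].
have up : ucp M psi'.
  by apply: (@ucp_lim R H M hM nat \oo _ av psi' uav Mp) => x u /hlim[].
have dist m x : M x -> nr (La (psi' x) - La (av m x)) <= 2 * 2^-1 ^+ m * nr (La x).
  move=> Mx; apply: (cvg_nr_le (F := \oo) (f := fun p => La (av p x) - La (av m x))).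
    by apply: cvgB; [exact: Lcv|exact: cvg_cst].
  by exists m => // p /= mp; exact: cauchy.
exists psi'; split.
- split=> // x Mx; have Mid := vn_id hM.
  have h : (fun m => dotp (La (av m x)) (La id)) @ \oo --> (dotp (La (psi' x)) (La id) : C^o).
    by apply: cvg_dotpl; exact: Lcv.
  rewrite (L2_id hM hLa (Mp x Mx)); apply: (cvgC_uniq h).
  apply/cvgC_nrP => e e0; apply: nearW => m; have [sk _ _] := hk m.
  rewrite -(L2_id hM hLa); last exact: Mav.
  by rewrite (average_state alpha hM hnu hpsi psi_state)// subrr nr0.
- move=> g x Mx; have [Mgx Mpx] := conj (aM g Mx) (Mp x Mx).
  apply: (L2_inj hM hnu hLa); [exact: Mp|exact: aM|].
  apply/eqP; rewrite -subr_eq0; apply/eqP/nr_le_eq0 => e e0.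
  have e5 : 0 < e / 3 by rewrite divr_gt0.
  have [m hm] := half_pow_small (nr (La x)) e5.
  have [sk sp _] := hk m.
  have d1 := dist m _ Mgx; have d2 := dist m _ Mx; rewrite aL2// in d1.
  (* The translates by [1] and by [g], evaluated at [alpha g x], are the average at [alpha g x] and
     [alpha g] of the average at [x]. *)
  have d3 : nr (La (av m (alpha g x)) - La (alpha g (av m x))) <= 2^-1 ^+ m * nr (La x).
    have := sp 1%g g (alpha g x) Mgx.
    rewrite !(avL_map hM alpha_action hLa hpsi)// aL2// (alphaK alpha_action)//.
    rewrite invg1 !(alpha1 alpha_action)//; exact: Mav.
  have d4 : nr (La (alpha g (av m x)) - La (alpha g (psi' x))) = nr (La (psi' x) - La (av m x)).
    have Mm := Mav m x Mx; rewrite -(L2B hM hLa (aM g Mm) (aM g Mpx)).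
    rewrite -(ucpB hM (aut_ucp hM (alpha g)))// aL2; last exact: vnB.
    by rewrite (L2B hM hLa)// -nrN opprB.
  have := nr_tri (La (psi' (alpha g x))) (La (av m (alpha g x))) (La (alpha g (psi' x))).
  have := nr_tri (La (av m (alpha g x))) (La (alpha g (av m x))) (La (alpha g (psi' x))).
  have : 0 <= 2^-1 ^+ m * nr (La x) by rewrite mulr_ge0 ?nr_ge0// exprn_ge0// invr_ge0.
  by rewrite d4; lra.
- apply: totally_bounded_approx => e e0.
  have [m hm] := half_pow_small 1 e0.
  exists [set La (av m x) | x in [set x | M x /\ nr (La x) <= 1]].
    by apply: average_totally_bounded; exact: (compact_L2_totally_bounded hT TE).
  move=> _ [x [Mx nx] <-]; exists (La (av m x)); first by exists x.
  apply: le_trans (dist m x Mx) _; rewrite mulr1 in hm; apply: le_trans (ltW hm).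
  by rewrite ler_piMr// mulr_ge0// exprn_ge0// invr_ge0.
- move=> x b Mx hb; rewrite (L2B hM hLa)//; last exact: Mp.
  apply: (cvg_nr_le (F := \oo) (f := fun m => La (av m x) - La x)).
    by apply: cvgB; [exact: Lcv|exact: cvg_cst].
  apply: nearW => m; have [sk _ _] := hk m.
  rewrite (average_L2 alpha hM hLa hpsi)//.
  have -> : La x = (size (k m))%:R^-1%:C *: \sum_(i <- k m) La x.
    rewrite big_const_seq count_predT iter_addr_0 -[La x *+ _]scaler_nat scalerA.
    by rewrite fmorphV rmorph_nat mulVf ?scale1r// pnatr_eq0 -lt0n.
  rewrite /avL -scalerBr -sumrB; apply: avL_le => [|i _].
    by apply: le_trans (hb 1%g); exact: nr_ge0.
  have Mx' := aM i^-1%g Mx; have Mpx' := ucp_in hpsi Mx'.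
  have e1 : x = alpha i (alpha i^-1%g x) by rewrite (alphaVK alpha_action).
  rewrite [in La x]e1 /twist -(L2B hM hLa (aM i Mpx') (aM i Mx')).
  by rewrite -(ucpB hM (aut_ucp hM (alpha i)))// aL2; [exact: hb|exact: vnB].
Qed.

End Equivariant.

Lemma hs_dominated (R : realType) (I : choiceType) (H L : hilbertType R) (delta : I -> H -> L)
    (u v : L) (c : R) : hilbert_sum delta -> 0 <= c ->
  (forall g, nr (coord delta g u) <= c * nr (coord delta g v)) -> nr u <= c * nr v.
Proof.
move=> hd c0 h; apply: (nr_le_trunc hd) => F.
apply: (@le_trans _ _ (c * nr (trunc delta F v))); last by rewrite ler_wpM2l ?trunc_le.
rewrite -(@ler_pXn2r _ 2) ?nnegrE ?mulr_ge0 ?nr_ge0// exprMn !(trunc_nr hd) mulr_sumr.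
by apply: ler_sum => g _; rewrite -exprMn ler_pXn2r ?nnegrE ?mulr_ge0 ?nr_ge0.
Qed.

(** At the points [g] and [1], with [1] and minus the conjugate of [phi g] as coefficients, the
    positive form equals [1 - |phi g|^2]. *)
Lemma positive_definite_le1 (R : realType) (G : groupType) (phi : G -> R[i]) g :
  positive_definite phi -> phi 1%g = 1 -> nr (phi g) <= 1.
Proof.
move=> hphi phi1.
have hk := positive_definite_psd (fun b : bool => if b then g else 1%g) hphi.
have := hk (fun b => if b then 1 else - (phi g)^*); have := psd_herm true false hk.
rewrite !big_bool /= !invg1 !mulg1 !mul1g mulgV phi1 => ->.
set z := phi g; rewrite rmorph1 rmorphN /= conjCK !mulr1 ?mul1r.
have -> : 1 + - z^* * z + (- z * z^* + - z * - z^*) = 1 - z * z^* by ring.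
rewrite mulcJ => /cge0P[+ _]; rewrite !reimE => h.
by rewrite -(@ler_pXn2r _ 2) ?nnegrE ?nr_ge0// expr1n; lra.
Qed.

(** The operator comes from [extension]. A vector of the unit ball of [K] is first approximated by
    some [La x], which is then shrunk into the ball where total boundedness is known. *)
Lemma totally_bounded_L2_compact (R : realType) (H K : hilbertType R) (N : set (H -> H))
    (nu : (H -> H) -> R[i]) (La : (H -> H) -> K) (f : (H -> H) -> H -> H) :
  vn_alg N -> is_L2 N nu La -> (forall x, N x -> N (f x)) -> linear_on N f ->
  (forall x, N x -> nr (La (f x)) <= nr (La x)) -> L2_totally_bounded N La f ->
  L2_compact N nu f.
Proof.
move=> hN hLa Nf lf cf tb.
have h1 a x y : N x -> N y -> La (f (a *: x + y)) = a *: La (f x) + La (f y).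
  by move=> Nx Ny; rewrite lf// (L2_lin hLa)//; exact: Nf.
have h2 x : N x -> nr (La (f x)) <= 1 * nr (La x) by rewrite mul1r; exact: cf.
have [T [lT bT TE]] := extension (vn_lsub hN) (L2_lin hLa) h1 h2 ler01 (L2_dense hLa).
exists K, La, T; split=> //; split; first by apply/bop_bounded; split=> //; exists 1.
apply: totally_bounded_precompact; apply: totally_bounded_approx => e e0.
eexists; first exact: tb.
move=> _ [z nz <-]; move: nz; rewrite /= nrE lecR => nz.
have e2 : 0 < e / 2 by rewrite divr_gt0.
have [_ [x Nx <-] hx] := L2_dense hLa z e2.
(* The factor that brings [La x], of norm at most [1 + e / 2], into the unit ball at a cost of at
   most [e / 2]. *)
pose c := (1 + e / 2)^-1; have c1 : 0 < 1 + e / 2 by lra.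
have c0 : 0 < c by rewrite invr_gt0.
have cE : c * (1 + e / 2) = 1 by rewrite mulVf// gt_eqF.
have nx : nr (La x) <= 1 + e / 2.
  have := nrB z (z - La x); rewrite opprB addrCA subrr addr0; lra.
have Ncx : N (c%:C%C *: x) by exact: vnZ.
exists (La (f (c%:C%C *: x))).
  exists (c%:C%C *: x) => //=; split=> //.
  by rewrite (L2Z hN hLa)// nr_real_scale ?(ltW c0)// -[leRHS]cE ler_wpM2l// ltW.
rewrite -TE// -(linBE _ _ lT); apply: le_trans (bT _) _; rewrite mul1r.
apply: le_trans (nr_tri _ (La x) _) _.
rewrite (L2Z hN hLa)//.
have -> : La x - c%:C%C *: La x = (1 - c)%:C%C *: La x.
  by rewrite rmorphB scalerBl rmorph1 scale1r.
have c2 : 0 <= 1 - c by nra.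
rewrite nr_real_scale//; have := nr_ge0 (La x); nra.
Qed.

(** * The Haagerup property of the crossed product *)

Section Final.
Variables (R : realType) (H : hilbertType R) (M : set (H -> H)) (nu : (H -> H) -> R[i]).
Variables (G : groupType) (alpha : G -> vn_aut M nu) (L : hilbertType R) (delta : G -> H -> L).
Local Notation C := R[i].
Local Notation re := (@complex.Re R).
Local Notation "x %:C" := (real_complex _ x) : ring_scope.
Hypotheses (M_vn : von_neumann M) (hnu : faithful_normal_state M nu).
Hypotheses (alpha_action : is_action alpha) (hd : hilbert_sum (I := G) delta).
Let hM : vn_alg M := von_neumann_alg M_vn.
Local Notation N := (crossed_product delta alpha).
Local Notation nuh := (dual_state nu delta).
Implicit Types (g h : G) (e d : R).

Section Phi.
Variables (K : hilbertType R) (La : (H -> H) -> K) (hLa : is_L2 M nu La).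
Let hN : vn_alg N := crossed_vn_alg M_vn hnu alpha_action hd hLa.
Let hnuh : faithful_normal_state N nuh := dual_state_faithful_normal M_vn hnu alpha_action hd hLa.
Variables (phi : G -> C) (hphi : positive_definite phi) (phi1 : phi 1%g = 1).
Variables (psi : (H -> H) -> (H -> H)) (hpsi : ucp M psi).
Hypothesis psi_equiv : forall g m, M m -> psi (alpha g m) = alpha g (psi m).
Hypothesis psi_state : forall m, M m -> nu (psi m) = nu m.
Local Notation Phi := (multiplier alpha delta phi psi).
Let uPhi : ucp N Phi := multiplier_ucp M_vn hnu alpha_action hd hLa hphi phi1 hpsi psi_equiv.
Let sPhi x : N x -> nuh (Phi x) = nuh x :=
  multiplier_state M_vn hnu alpha_action hd hLa hphi phi1 hpsi psi_equiv psi_state (x := x).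
Let Mx x g h : N x -> M (entry delta x g h).
Proof. exact: (crossed_entry M_vn hnu alpha_action hd hLa). Qed.

Lemma multiplier_normal_ucp : normal_ucp N Phi.
Proof.
case: (uPhi) => h1 h2 h3 h4; split=> //.
exact: (ucp_normal hN hnuh uPhi sPhi).
Qed.

Variables (Lh : hilbertType R) (dh : G -> K -> Lh) (hdh : hilbert_sum (I := G) dh).
Local Notation Lah := (dual_La delta La dh).
Let hLah : is_L2 N nuh Lah := dual_La_L2 M_vn hnu alpha_action hd hLa hdh.

Lemma coord_multiplier x g : N x ->
  coord dh g (Lah (Phi x)) = phi g *: La (psi (entry delta x g 1%g)).
Proof.
move=> Nx; rewrite (coord_dual_La M_vn hnu alpha_action hd hLa hdh); last exact: (ucp_in uPhi).
rewrite (multiplier_entry M_vn hnu alpha_action hd hLa hphi phi1 hpsi psi_equiv)//.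
by rewrite invg1 mulg1 (L2Z hM hLa)//; apply: (ucp_in hpsi); exact: Mx.
Qed.

(** Outside a finite set [F] the function [phi] is at most [e], so truncation to the coordinates in
    [F] moves the image of the unit ball by at most [e]; the truncated image lies in a finite sum of
    scaled copies of a totally bounded set. *)
Lemma multiplier_L2_compact :
  (forall e : C, 0 < e -> finite_set [set g | e <= `|phi g|]) ->
  L2_totally_bounded M La psi -> L2_compact N nuh Phi.
Proof.
move=> phi_c0 tb; apply: (totally_bounded_L2_compact hN hLah).
- exact: (ucp_in uPhi).
- by case: uPhi.
- by move=> x Nx; exact: (ucp_L2 hN hnuh uPhi sPhi hLah Nx).
apply: totally_bounded_approx => e e0.
have [F hF] : exists F : {fset G}, forall g, g \notin F -> nr (phi g) <= e.
  have /phi_c0/finite_fsetP[F hF] : 0 < e%:C :> C by rewrite ltcR.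
  exists F => g; apply: contraNT; rewrite -ltNge => eg.
  have : [set g | e%:C <= `|phi g|] g by rewrite /= nrE lecR ltW.
  by rewrite hF.
exists [set trunc dh F (Lah (Phi x)) | x in [set x | N x /\ nr (Lah x) <= 1]].
  have : totally_bounded [set \sum_(g <- F) dh g (phi g *: La (psi (entry delta x g 1%g))) |
      x in [set x | N x /\ nr (Lah x) <= 1]].
    elim: (enum_fset F) => [|g s IH].
      move=> t t0; exists [:: 0] => _ [x _ <-]; exists 0; first exact: mem_head.
      by rewrite big_nil subrr nr0 ltW.
    have hg (u v : K) : nr (dh g (phi g *: u) - dh g (phi g *: v)) <= nr (phi g) * nr (u - v).
      by rewrite -(linBE _ _ (hs_lin hdh g)) (hs_nr hdh) -scalerBr nrZ.
    have tg := totally_bounded_image (nr_ge0 (phi g)) hg tb.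
    apply: totally_bounded_sub (totally_boundedD tg IH) => _ [x [Nx nx] <-].
    exists (dh g (phi g *: La (psi (entry delta x g 1%g)))),
      (\sum_(h <- s) dh h (phi h *: La (psi (entry delta x h 1%g)))).
    split; [|by exists x|by rewrite big_cons].
    exists (La (psi (entry delta x g 1%g))) => //.
    exists (entry delta x g 1%g) => //=; split; first exact: Mx.
    rewrite -(coord_dual_La M_vn hnu alpha_action hd hLa hdh)//.
    apply: le_trans nx; rewrite -(@ler_pXn2r _ 2) ?nnegrE ?nr_ge0//.
    by have := bessel hdh [fset g]%fset (Lah x); rewrite big_seq_fset1.
  apply: totally_bounded_sub => _ [x [Nx nx] <-]; exists x => //.
  by rewrite /trunc; apply: eq_bigr => g _; rewrite coord_multiplier.
move=> _ [x [Nx nx] <-]; exists (trunc dh F (Lah (Phi x))); first by exists x.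
apply: (@le_trans _ _ (e * nr (Lah x))); last by rewrite ler_piMr// ltW.
apply: (hs_dominated hdh (ltW e0)) => g.
rewrite (linBE _ _ (coord_lin hdh g)) (coord_trunc hdh).
case: ifPn => gF; first by rewrite subrr nr0 mulr_ge0 ?nr_ge0// ltW.
rewrite subr0 coord_multiplier// nrZ (coord_dual_La M_vn hnu alpha_action hd hLa hdh)//.
by apply: ler_pM; rewrite ?nr_ge0 ?hF//; apply: (ucp_L2 hM hnu hpsi psi_state hLa); exact: Mx.
Qed.

Lemma coord_multiplier_le x g : N x -> nr (coord dh g (Lah (Phi x))) <= nr (coord dh g (Lah x)).
Proof.
move=> Nx; rewrite coord_multiplier// nrZ (coord_dual_La M_vn hnu alpha_action hd hLa hdh)//.
have Mxg := Mx g 1%g Nx.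
rewrite -[leRHS]mul1r; apply: ler_pM; rewrite ?nr_ge0//; first exact: positive_definite_le1.
exact: (ucp_L2 hM hnu hpsi psi_state hLa).
Qed.

End Phi.

Section Convergence.
Variables (K : hilbertType R) (La : (H -> H) -> K) (hLa : is_L2 M nu La).
Variables (phi : nat -> G -> C) (psi : nat -> (H -> H) -> (H -> H)).
Hypotheses (hphi : forall n, positive_definite (phi n)) (phi1 : forall n, phi n 1%g = 1).
Hypotheses (hpsi : forall n, ucp M (psi n)) (psi_state : forall n m, M m -> nu (psi n m) = nu m).
Hypothesis psi_equiv : forall n g m, M m -> psi n (alpha g m) = alpha g (psi n m).
Hypothesis phi_cvg : forall g, phi n g @[n --> \oo] --> (1 : C^o).
Hypothesis psi_cvg : forall m, M m -> La (psi n m) @[n --> \oo] --> La m.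
Variables (Lh : hilbertType R) (dh : G -> K -> Lh) (hdh : hilbert_sum (I := G) dh).
Local Notation Lah := (dual_La delta La dh).
Local Notation Phi n := (multiplier alpha delta (phi n) (psi n)).

(** Dominated convergence: each coordinate converges, and [coord_multiplier_le] bounds the part
    outside [F], uniformly in [n], by that of [v]. *)
Lemma multiplier_cvg x : N x -> Lah (Phi n x) @[n --> \oo] --> Lah x.
Proof.
move=> Nx; set v := Lah x; have FF := fin_filter_proper G.
have coordE n g : coord dh g (Lah (Phi n x)) = phi n g *: La (psi n (entry delta x g 1%g)).
  exact: (coord_multiplier hLa (hphi n) (phi1 n) (hpsi n) (psi_equiv n) hdh g Nx).
have hc g : coord dh g (Lah (Phi n x)) @[n --> \oo] --> coord dh g v.
  have Mxg : M (entry delta x g 1%g) by exact: (crossed_entry M_vn hnu alpha_action hd hLa).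
  have h : phi n g *: La (psi n (entry delta x g 1%g)) @[n --> \oo] -->
      (1 : C) *: La (entry delta x g 1%g).
    by apply: cvgZ; [exact: phi_cvg|exact: psi_cvg].
  rewrite /v (coord_dual_La M_vn hnu alpha_action hd hLa hdh)// -[La _]scale1r.
  by rewrite (_ : (fun n => _) = fun n => phi n g *: La (psi n (entry delta x g 1%g)))//;
    apply/funext => n.
apply/cvg_nrP => e e0; have e4 : 0 < e / 4 by rewrite divr_gt0.
have [F hF] := @filter_ex _ _ FF _ (cvg_nr (trunc_cvg hdh (v := v)) e4).
have ht : trunc dh F (Lah (Phi n x)) @[n --> \oo] --> trunc dh F v.
  rewrite /trunc; elim: (enum_fset F) => [|g s IH].
    by rewrite big_nil (_ : (fun n => _) = fun=> 0); [exact: cvg_cst|apply/funext => n; rewrite big_nil].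
  rewrite big_cons (_ : (fun n => _) = fun n => dh g (coord dh g (Lah (Phi n x))) +
    \sum_(h <- s) dh h (coord dh h (Lah (Phi n x)))); last by apply/funext => n; rewrite big_cons.
  by apply: cvgD; [apply: bop_cvg; [exact: hs_bop|exact: hc]|exact: IH].
have hn4 : \forall n \near \oo, nr (trunc dh F v - trunc dh F (Lah (Phi n x))) < e / 4.
  exact: cvg_nr ht e4.
apply: filterS hn4 => n hn.
have h1 : nr (Lah (Phi n x) - trunc dh F (Lah (Phi n x))) <= 1 * nr (v - trunc dh F v).
  apply: (hs_dominated hdh ler01) => g; rewrite mul1r !(linBE _ _ (coord_lin hdh g)).
  rewrite !(coord_trunc hdh); case: ifP => gF; first by rewrite !subrr.
  by rewrite !subr0; apply: (coord_multiplier_le hLa (hphi n) (phi1 n) (hpsi n)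
    (psi_equiv n) (psi_state n) hdh g Nx).
apply: le_lt_trans (nr_tri _ (trunc dh F v) _) _.
have := nr_tri (trunc dh F v) (trunc dh F (Lah (Phi n x))) (Lah (Phi n x)).
rewrite -(nrN (trunc dh F (Lah (Phi n x)) - _)) opprB; lra.
Qed.

End Convergence.

(** [psi n] approaches the identity uniformly on the orbit of [m]: on a finite net by pointwise
    convergence, and off the net because [psi n] is a contraction in [L2]. *)
Lemma equivariant_cvg (alpha_compact : compact_action alpha) (K : hilbertType R)
    (La : (H -> H) -> K) (hLa : is_L2 M nu La) (psi psi' : nat -> (H -> H) -> H -> H) :
  (forall n, ucp M (psi n)) -> (forall n m, M m -> nu (psi n m) = nu m) ->
  (forall n x, M x -> M (psi' n x)) ->
  (forall m, M m -> La (psi n m) @[n --> \oo] --> La m) ->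
  (forall n x b, M x -> (forall g, nr (La (psi n (alpha g x) - alpha g x)) <= b) ->
    nr (La (psi' n x - x)) <= b) ->
  forall m, M m -> La (psi' n m) @[n --> \oo] --> La m.
Proof.
move=> hpsi psi_state Mp hcvg hb m Mm; apply/cvg_nrP => e e0.
have e4 : 0 < e / 4 by rewrite divr_gt0.
have [|hs hhs] := aut_net hM alpha_compact hLa (X := [:: m]) _ e4.
  by move=> x; rewrite mem_seq1 => /eqP ->.
have aM g : M (alpha g m) by exact: aut_in.
have : \forall n \near \oo, forall h, h \in hs ->
    nr (La (alpha h m) - La (psi n (alpha h m))) < e / 4.
  elim: (hs) => [|h s IH]; first by apply: nearW => n h; rewrite in_nil.
  apply: filterS (filterI IH (cvg_nr (hcvg _ (aM h)) e4)) => n [h1 h2] g.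
  by rewrite in_cons => /orP[/eqP ->//|/h1].
apply: filterS => n hn.
rewrite -nrN opprB -(L2B hM hLa (Mp n m Mm) Mm).
suff : nr (La (psi' n m - m)) <= e * 3 / 4 by lra.
apply: hb => // g; have [h hh /(_ m (mem_head _ _)) hg] := hhs g.
have [Mg Mh] := conj (aM g) (aM h); have MB := vnB hM Mg Mh.
have [Mpg Mph] := conj (ucp_in (hpsi n) Mg) (ucp_in (hpsi n) Mh).
have := ucp_L2 hM hnu (hpsi n) (psi_state n) hLa MB.
rewrite (ucpB hM (hpsi n))// (L2B hM hLa)// (L2B hM hLa Mpg Mg) => h1.
have := nr_tri (La (psi n (alpha g m))) (La (psi n (alpha h m))) (La (alpha g m)).
have := nr_tri (La (psi n (alpha h m))) (La (alpha h m)) (La (alpha g m)).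
rewrite (L2B hM hLa Mg Mh) in h1 hg.
rewrite -(nrN (La (alpha h m) - La (alpha g m))) opprB.
rewrite -(nrN (La (psi n (alpha h m)) - La (alpha h m))) opprB.
have := hn h hh; lra.
Qed.

End Final.

Theorem proposition6p18 (R : realType) (H : hilbertType R) (M : set (H -> H))
    (nu : (H -> H) -> R[i]) (G : groupType) (alpha : G -> vn_aut M nu)
    (L : hilbertType R) (delta : G -> H -> L)
    (M_vn : von_neumann M) (M_sep : separable_predual M)
    (nu_state : faithful_normal_state M nu)
    (G_countable : countable [set: G])
    (alpha_action : is_action alpha) (alpha_compact : compact_action alpha)
    (G_haagerup : group_haagerup R G) (M_haagerup : haagerup_wrt M nu)
    (L_l2 : is_l2 delta) :
  haagerup (crossed_product delta alpha).
Proof.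
have hM := von_neumann_alg M_vn.
have hd : hilbert_sum (I := G) delta by [].
have [psi [hpsi psi_cvg]] := M_haagerup; have [phi [hphi phi_cvg]] := G_haagerup.
have upsi n : ucp M (psi n) by have [/normal_ucp_ucp] := hpsi n.
have spsi n m : M m -> nu (psi n m) = nu m by have [_ + _] := hpsi n; exact.
(* Compactness of each [psi n] comes with its own model of [L2(M)]. The closeness clause is restated
   for every model, which is possible because [nu] determines the norm of [La y]; one model can then
   serve all [n]. *)
have eqv n : exists psi', [/\ ucp M psi' /\ (forall x, M x -> nu (psi' x) = nu x),
    forall g x, M x -> psi' (alpha g x) = alpha g (psi' x),
    exists (K : hilbertType R) (La : (H -> H) -> K),
      is_L2 M nu La /\ L2_totally_bounded M La psi' &
    forall (K : hilbertType R) (La : (H -> H) -> K), is_L2 M nu La -> forall x (b : R), M x ->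
      (forall g, nr (La (psi n (alpha g x) - alpha g x)) <= b) -> nr (La (psi' x - x)) <= b].
  have [_ _ [K [La [T [hLa hT TE]]]]] := hpsi n.
  have [psi' [[up sp] ep tb close]] := equivariant_average hM nu_state alpha_action alpha_compact
    hLa (upsi n) (spsi n) hT TE.
  exists psi'; split=> //; first by exists K, La.
  move=> K' La' hLa' x b Mx.
  have same y : M y -> nr (La' y) = nr (La y).
    by move=> My; apply: (@complexI R); rewrite -(L2_norm2 hLa' My) -(L2_norm2 hLa My).
  have Mpx := ucp_in up Mx.
  move=> h; rewrite same; last exact: (vnB hM).
  apply: close => // g; have Mgx : M (alpha g x) by exact: aut_in.
  by rewrite -same//; apply: (vnB hM) => //; exact: (ucp_in (upsi n)).
have /choice[psi' hpsi'] := eqv.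
(* The model attached to index [0] is fixed for all statements of convergence. *)
have [_ _ [K [La [_ [hLa _ _]]]]] := hpsi 0%N.
have up n : ucp M (psi' n) by have [[]] := hpsi' n.
have sp n m : M m -> nu (psi' n m) = nu m by have [[_ h] _ _ _] := hpsi' n; exact: h.
have ep n g m : M m -> psi' n (alpha g m) = alpha g (psi' n m).
  by have [_ h _ _] := hpsi' n; exact: h.
have pd n : positive_definite (phi n) by have [] := hphi n.
have p1 n : phi n 1%g = 1 by have [] := hphi n.
have hN := crossed_vn_alg M_vn nu_state alpha_action hd hLa.
have hcvg m : M m -> La (psi n m) @[n --> \oo] --> La m.
  move=> Mm; apply/cvg_nrP => e e0.
  have h : \forall n \near \oo, nr (0 - norm2 nu (psi n m - m)) < e.
    exact: cvgC_nr (psi_cvg m Mm) e0.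
  apply: filterS h => n; have Mpm := ucp_in (upsi n) Mm.
  rewrite (L2_norm2 hLa); last exact: vnB.
  by rewrite sub0r nrN nr_real ger0_norm ?nr_ge0// (L2B hM hLa)// -nrN opprB.
have hcvg' : forall m, M m -> La (psi' n m) @[n --> \oo] --> La m.
  apply: (equivariant_cvg M_vn nu_state alpha_compact hLa upsi spsi _ hcvg).
    by move=> n x; exact: (ucp_in (up n)).
  by move=> n x b; have [_ _ _ h] := hpsi' n; exact: h.
exists (dual_state nu delta); split.
  exact: (dual_state_faithful_normal M_vn nu_state alpha_action hd hLa).
exists (fun n => multiplier alpha delta (phi n) (psi' n)); split=> [n|x Nx].
  split.
  - exact: (multiplier_normal_ucp M_vn nu_state alpha_action hd hLa (pd n) (p1 n) (up n) (ep n) (sp n)).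
  - exact: (multiplier_state M_vn nu_state alpha_action hd hLa (pd n) (p1 n) (up n) (ep n) (sp n)).
  (* Compactness is proved in the model where [psi' n] is known to be totally bounded, which depends
     on [n]. *)
  - have [_ _ [Kn [Ln [hLn tb]]] _] := hpsi' n; have [_ _ c0] := hphi n.
    exact: (multiplier_L2_compact M_vn nu_state alpha_action hd hLn (pd n) (p1 n) (up n) (ep n)
      (sp n) (l2_hilbert_sum G Kn) c0 tb).
have hdh := l2_hilbert_sum G K.
have hLah := dual_La_L2 M_vn nu_state alpha_action hd hLa hdh.
have := multiplier_cvg M_vn nu_state alpha_action hd hLa pd p1 up sp ep phi_cvg hcvg' hdh Nx.
move=> h; apply/cvgC_nrP => e e0.
have hn : \forall n \near \oo, nr (dual_La delta La (@l2_delta R G K) x -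
    dual_La delta La (@l2_delta R G K) (multiplier alpha delta (phi n) (psi' n) x)) < e.
  exact: cvg_nr h e0.
apply: filterS hn => n.
have NP := ucp_in (multiplier_ucp M_vn nu_state alpha_action hd hLa (pd n) (p1 n) (up n) (ep n)) Nx.
rewrite (L2_norm2 hLah); last exact: (vnB hN).
by rewrite sub0r nrN nr_real ger0_norm ?nr_ge0// (L2B hN hLah)// -nrN opprB.
Qed.
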